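(* Suppose (A1) $G_{\text{hon}}$ is connected, (A2) each $\nu_k$ is supported on $[0,1]$ and $\mu_1>\mu_2$, and (A3) there is $i^\star\in[n]$ with $1\in\hat S^{(i^\star)}$. Run the algorithm with the proposed blocking rule with $\theta_j=(j/3)^{\rho_1}$ and $\kappa_j=j^{\rho_2}/(K^2S)$, where $$\beta>1,\quad \eta>1,\quad 0<\rho_1\le \tfrac1\eta,\quad \alpha>\tfrac32+\tfrac1{2\beta}+\tfrac1{2\rho_1^2},\quad \tfrac{1}{2\alpha-3}<\rho_2<\rho_1(\beta-1).$$ Then for every honest agent $i\in[n]$ and horizon $T\in\mathbb N$, $$R_T^{(i)}\le 4\alpha\log(T)\min\Big\{\tfrac{2\eta-1}{\eta-1}\sum_{k=2}^{d_{\text{mal}}(i)+3}\tfrac1{\Delta_k}+\sum_{k=d_{\text{mal}}(i)+4}^{S+d_{\text{mal}}(i)+4}\tfrac1{\Delta_k},\ \sum_{k=2}^K\tfrac1{\Delta_k}\Big\}+2\,\mathbb E[A_{2\bar\tau_{\text{spr}}}]+C_\star,$$ where $\Delta_k:=1$ for $k>K$ by convention, and $C_\star$ does not depend on $T$ and satisfies $$C_\star=\tilde O\Big(\max\Big\{\tfrac{d_{\text{mal}}(i)}{\Delta_2},\ \big(\tfrac{K}{\Delta_2}\big)^2,\ S^{\beta/(\rho_1^2(\beta-1))},\ \big(\tfrac{S}{\Delta_2^2}\big)^{\beta/(\beta-1)},\ \bar d^{\,\beta/\rho_1},\ nK^2S\Big\}\Big),$$ with $\tilde O$ hiding constants depending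 only on $\alpha,\beta,\eta,\rho_1,\rho_2$ and factors polylogarithmic in $K,n,m,\Delta_2^{-1}$.
   Context: Setting. $G=([n+m],E)$ undirected; agents $1,\dots,n$ honest, $n+1,\dots,n+m$ malicious. For $i\in[n]$: $N(i)$ its neighbors, $N_{\text{hon}}(i)=N(i)\cap[n]$, $N_{\text{mal}}(i)=N(i)\setminus[n]$, $d(i)=|N(i)|$, $d_{\text{hon}}(i)=|N_{\text{hon}}(i)|$, $d_{\text{mal}}(i)=|N_{\text{mal}}(i)|$, $\bar d=\max_{i\in[n]}d(i)$; $E_{\text{hon}}$ is the set of edges between honest agents and $G_{\text{hon}}=([n],E_{\text{hon}})$. There are $K$ arms; arm $k$ has distribution $\nu_k$ with mean $\mu_k$; rewards $X_{i,t}(k)\sim\nu_k$ are independent over $i,t,k$. Arms are labeled so $\mu_1\ge\cdots\ge\mu_K$; $\Delta_k=\mu_1-\mu_k$. Regret: $R_T^{(i)}=\sum_{t=1}^T\mathbb E[\mu_1-\mu_{I_t^{(i)}}]$. Algorithm (each honest $i$). Parameters $\alpha>0,\beta>1,\eta>1$, integer $S\le K-2$, sticky set $\hat S^{(i)}\subset[K]$, $|\hat S^{(i)}|=S$. $A_0=0$, $A_j=\lceil j^\beta\rceil$; phase $j$ = times $A_{j-1}+1,\dots,A_j$. Active set in phase $j$: $S_j^{(i)}=\hat S^{(i)}\cup\{U_j^{(i)},L_j^{(i)}\}$, $U_j^{(i)}\ne L_j^{(i)}$ non-sticky; $S_1^{(i)}$ arbitrary of this form. $T_k^{(i)}(t)$: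 number of pulls of $k$ by $i$ up to $t$; $\hat\mu_k^{(i)}(t)$: their empirical mean. At time $t$ in phase $j$, pull $I_t^{(i)}\in\arg\max_{k\in S_j^{(i)}}(\hat\mu_k^{(i)}(t-1)+\sqrt{\alpha\log t/T_k^{(i)}(t-1)})$ (index $+\infty$ if unpulled). At $t=A_j$: (1) $B_j^{(i)}\in\arg\max_{k\in S_j^{(i)}}(T_k^{(i)}(A_j)-T_k^{(i)}(A_{j-1}))$; (2) blocklists $P_{j'}^{(i)}\subset[n+m]$, $j'\ge j$ (initially empty) are updated by the blocking rule; (3) $H_j^{(i)}$ is uniform on $N(i)\setminus P_j^{(i)}$, independent of the rest; if $H_j^{(i)}\le n$ then $R_j^{(i)}=B_j^{(H_j^{(i)})}$, else $R_j^{(i)}\in[K]$ is arbitrary (chosen adversarially, measurably in the past); (4) if $R_j^{(i)}\notin S_j^{(i)}$: $U_{j+1}^{(i)}\in\arg\max_{k\in\{U_j^{(i)},L_j^{(i)}\}}(T_k^{(i)}(A_j)-T_k^{(i)}(A_{j-1}))$, $L_{j+1}^{(i)}=R_j^{(i)}$, $S_{j+1}^{(i)}=\hat S^{(i)}\cup\{U_{j+1}^{(i)},L_{j+1}^{(i)}\}$; otherwise $S_{j+1}^{(i)}=S_j^{(i)}$. Proposed blocking rule: at phase $j>1$, if $T^{(i)}_{R_{j-1}^{(i)}}(A_j)\le\kappa_j$ and $B_j^{(i)}=B_{j-1}^{(i)}=\cdots=B_{\lfloor\theta_j\rfloor}^{(i)}$, then $H_{j-1}^{(i)}$ is added to $P_{j'}^{(i)}$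 for all $j'\in\{j,\dots,\lceil j^\eta\rceil\}$. Noisy rumor process: $\Upsilon=\min_{i\in[n]}d_{\text{hon}}(i)/d(i)$. For each $i\in[n]$, $\{\bar Y_j^{(i)}\}_{j\ge1}$ i.i.d. Bernoulli$(\Upsilon)$ and $\{\bar H_j^{(i)}\}_{j\ge1}$ i.i.d. uniform on $N_{\text{hon}}(i)$, all independent. $\bar{\mathcal I}_0=\{i^\star\}$, $\bar{\mathcal I}_j=\bar{\mathcal I}_{j-1}\cup\{i\in[n]\setminus\bar{\mathcal I}_{j-1}:\bar Y_j^{(i)}=1,\ \bar H_j^{(i)}\in\bar{\mathcal I}_{j-1}\}$, and $\bar\tau_{\text{spr}}=\inf\{j\in\mathbb N:\bar{\mathcal I}_j=[n]\}$. *)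

(* Defs.v *)
From HB Require Import structures.
From mathcomp Require Import all_boot all_order all_algebra fingroup perm.
From mathcomp Require Import all_classical all_reals all_analysis.

Set Implicit Arguments.
Unset Strict Implicit.
Unset Printing Implicit Defensive.

Import Order.TTheory GRing.Theory Num.Theory.
Local Open Scope ring_scope.

(*  * Agents are 'I_(n+m); agent h is honest iff (h < n); the honest agent     *)
(*    i : 'I_n is the agent  lshift m i : 'I_(n+m).                            *)
(*  * Arms are natural numbers 1..K (as in the paper); arm 0 is never used.    *)
(*  * Phases are j = 1,2,...; phase j covers times A_(j-1)+1 .. A_j.           *)

Definition ceiln (R : realType) (x : R) : nat := `|Num.ceil x|%N.

Definition phaseA (R : realType) (beta : R) (j : nat) : nat :=
  if j is 0 then 0%N else ceiln (j%:R `^ beta).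

Definition nbr (n m : nat) (adj : rel 'I_(n+m)) (i : 'I_n) : {set 'I_(n+m)} :=
  [set h | adj (lshift m i) h].
Definition deg (n m : nat) (adj : rel 'I_(n+m)) (i : 'I_n) : nat := #|nbr adj i|.
Definition deg_hon (n m : nat) (adj : rel 'I_(n+m)) (i : 'I_n) : nat :=
  #|[set h in nbr adj i | (h < n)%N]|.
Definition deg_mal (n m : nat) (adj : rel 'I_(n+m)) (i : 'I_n) : nat :=
  #|[set h in nbr adj i | (n <= h)%N]|.
Definition dbar (n m : nat) (adj : rel 'I_(n+m)) : nat := \max_(i < n) deg adj i.
Definition adj_hon (n m : nat) (adj : rel 'I_(n+m)) : rel 'I_n :=
  fun a b => adj (lshift m a) (lshift m b).
Definition hon_connected (n m : nat) (adj : rel 'I_(n+m)) : Prop :=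
  forall a b : 'I_n, connect (adj_hon adj) a b.

Definition mean (R : realType) (nu : nat -> probability R R) (k : nat) : R :=
  fine (\int[nu k]_x (x%:E))%E.
Definition gap (R : realType) (nu : nat -> probability R R) (K k : nat) : R :=
  if (1 <= k <= K)%N then mean nu 1 - mean nu k else 1.

Record config (R : realType) (n m : nat) := Config {
  c_adj : rel 'I_(n+m);
  c_K : nat; c_S : nat;
  c_alpha : R; c_beta : R; c_eta : R; c_rho1 : R; c_rho2 : R;
  c_sticky : 'I_n -> seq nat;
  c_U1 : 'I_n -> nat; c_L1 : 'I_n -> nat   (* S_1^(i) = \hat S^(i) u {U_1, L_1} *)
}.

(* One realization of all the randomness / arbitrary choices. *)
Record realiz (R : realType) (n m : nat) := Realiz {
  r_x : 'I_n -> nat -> nat -> R;            (* X_{i,t}(k) *)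
  r_sg : 'I_n -> nat -> {perm 'I_(n+m)};    (* random ordering used to draw H_j^(i) *)
  r_tbI : 'I_n -> nat -> nat;               (* tie-breaking proposal for I_t^(i) *)
  r_tbB : 'I_n -> nat -> nat;               (* tie-breaking proposal for B_j^(i) *)
  r_tbU : 'I_n -> nat -> nat;               (* tie-breaking proposal for U_(j+1)^(i) *)
  r_adv : 'I_n -> nat -> nat                (* adversarial recommendation R_j^(i) *)
}.

Record astate (R : realType) (N : nat) := AState {
  a_cnt : nat -> nat;              (* T_k(current time) *)
  a_cnt0 : nat -> nat;             (* T_k(A_(j-1)), counts at start of the phase *)
  a_sum : nat -> R;
  a_U : nat; a_L : nat;
  a_B : nat -> nat;                (* B_j, 0 = undefined *)
  a_H : nat -> option 'I_N;
  a_R : nat -> option nat;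
  a_blk : nat -> {set 'I_N};
  a_pull : nat -> nat
}.

Definition upd (T : Type) (f : nat -> T) (x : nat) (v : T) : nat -> T :=
  fun y => if y == x then v else f y.

Definition argmax_seq (R : realType) (f : nat -> R) (s : seq nat) : seq nat :=
  [seq k <- s | all (fun k' => f k' <= f k) s].

(* "any element of the argmax": the proposal tb is used when it is a maximiser,
   otherwise a default maximiser; hence every (past-measurable) tie-breaking
   rule is represented by a suitable (past-measurable) proposal. *)
Definition choose_tb (tb : nat) (cand : seq nat) : nat :=
  if tb \in cand then tb else head 0%N cand.

Definition active (R : realType) (n m : nat) (c : config R n m) (i : 'I_n)
  (st : astate R (n+m)) : seq nat := c_sticky c i ++ [:: a_U st; a_L st].

Definition ucb (R : realType) (alpha : R) (N : nat) (st : astate R N) (t k : nat) : R :=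
  a_sum st k / (a_cnt st k)%:R + Num.sqrt (alpha * ln t%:R / (a_cnt st k)%:R).

Definition pull_step (R : realType) (n m : nat) (c : config R n m) (w : realiz R n m)
  (i : 'I_n) (st : astate R (n+m)) (t : nat) : astate R (n+m) :=
  let act := active c i st in
  let unp := [seq k <- act | a_cnt st k == 0%N] in
  let cand := if unp is [::] then argmax_seq (ucb (c_alpha c) st t) act else unp in
  let k := choose_tb (r_tbI w i t) cand in
  {| a_cnt := upd (a_cnt st) k (a_cnt st k).+1;
     a_cnt0 := a_cnt0 st;
     a_sum := upd (a_sum st) k (a_sum st k + r_x w i t k);
     a_U := a_U st; a_L := a_L st; a_B := a_B st; a_H := a_H st; a_R := a_R st;
     a_blk := a_blk st;
     a_pull := upd (a_pull st) t k |}.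

Definition run_pulls (R : realType) (n m : nat) (c : config R n m) (w : realiz R n m)
  (i : 'I_n) (j : nat) (st : astate R (n+m)) : astate R (n+m) :=
  let A := phaseA (c_beta c) in
  foldl (pull_step c w i) st (iota (A j.-1).+1 (A j - A j.-1)).

Definition phase_pulls (R : realType) (N : nat) (st : astate R N) (k : nat) : R :=
  (a_cnt st k - a_cnt0 st k)%:R.

Definition compB (R : realType) (n m : nat) (c : config R n m) (w : realiz R n m)
  (i : 'I_n) (j : nat) (st : astate R (n+m)) : nat :=
  choose_tb (r_tbB w i j) (argmax_seq (phase_pulls st) (active c i st)).

Definition theta (R : realType) (rho1 : R) (j : nat) : R := (j%:R / 3) `^ rho1.
Definition kappa (R : realType) (rho2 : R) (K S j : nat) : R :=
  j%:R `^ rho2 / (K ^ 2 * S)%:R.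

Definition new_blk (R : realType) (n m : nat) (c : config R n m) (j Bj : nat)
  (st : astate R (n+m)) : nat -> {set 'I_(n+m)} :=
  let lo := maxn 1 (Num.truncn (theta (c_rho1 c) j)) in
  match a_R st j.-1, a_H st j.-1 with
  | Some r, Some h =>
      if [&& (1 < j)%N, (a_cnt st r)%:R <= kappa (c_rho2 c) (c_K c) (c_S c) j
           & all (fun j' => a_B st j' == Bj) (iota lo (j - lo))]
      then fun j' => if (j <= j' <= ceiln (j%:R `^ c_eta c))%N
                     then h |: a_blk st j' else a_blk st j'
      else a_blk st
  | _, _ => a_blk st
  end.

Definition end_phase (R : realType) (n m : nat) (c : config R n m) (w : realiz R n m)
  (i : 'I_n) (j : nat) (st : astate R (n+m)) (Bs : 'I_n -> nat) : astate R (n+m) :=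
  let blk := new_blk c j (Bs i) st in
  let avail := [set h | c_adj c (lshift m i) h & h \notin blk j] in
  let H := ohead [seq h <- [seq r_sg w i j p | p <- enum 'I_(n+m)] | h \in avail] in
  let Rj := match H with
            | None => None
            | Some h => Some (match @insub nat (fun x => (x < n)%N) 'I_n (val h) with
                              | Some h' => Bs h'
                              | None => let r := r_adv w i j in
                                        if (1 <= r <= c_K c)%N then r else 1%N
                              end)
            end in
  let act := active c i st in
  let UL := match Rj with
            | Some r => if r \in act then (a_U st, a_L st)
                        else (choose_tb (r_tbU w i j)
                                (argmax_seq (phase_pulls st) [:: a_U st; a_L st]), r)
            | None => (a_U st, a_L st)
            end in
  {| a_cnt := a_cnt st; a_cnt0 := a_cnt st; a_sum := a_sum st;
     a_U := UL.1; a_L := UL.2;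
     a_B := upd (a_B st) j (Bs i); a_H := upd (a_H st) j H; a_R := upd (a_R st) j Rj;
     a_blk := blk; a_pull := a_pull st |}.

Definition init_state (R : realType) (n m : nat) (c : config R n m) (i : 'I_n)
  : astate R (n+m) :=
  {| a_cnt := fun=> 0%N; a_cnt0 := fun=> 0%N; a_sum := fun=> 0;
     a_U := c_U1 c i; a_L := c_L1 c i; a_B := fun=> 0%N; a_H := fun=> None;
     a_R := fun=> None; a_blk := fun=> finset.set0; a_pull := fun=> 0%N |}.

Fixpoint sim (R : realType) (n m : nat) (c : config R n m) (w : realiz R n m) (j : nat)
  : 'I_n -> astate R (n+m) :=
  match j with
  | 0 => init_state c
  | j'.+1 =>
      let st1 := fun i => run_pulls c w i j (sim c w j' i) in
      let Bs := fun i => compB c w i j (st1 i) in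
      fun i => end_phase c w i j (st1 i) Bs
  end.

(* I_t^(i): time t lies in a phase <= t since A_j >= j *)
Definition arm_at (R : realType) (n m : nat) (c : config R n m) (w : realiz R n m)
  (i : 'I_n) (t : nat) : nat := a_pull (sim c w t i) t.

Inductive pidx (n : nat) := PX of 'I_n & nat & nat | PV of 'I_n & nat.

Definition pvalid (n K : nat) (p : pidx n) : bool :=
  match p with PX _ t k => (1 <= t)%N && (1 <= k <= K)%N | PV _ j => (1 <= j)%N end.

Definition pevent (R : realType) (d : measure_display) (Omega : measurableType d)
  (n m : nat) (X : 'I_n -> nat -> nat -> Omega -> R)
  (sg : 'I_n -> nat -> Omega -> {perm 'I_(n+m)})
  (Ex : set R) (Ev : set {perm 'I_(n+m)}) (p : pidx n) : set Omega :=
  match p with PX i t k => (X i t k @^-1` Ex)%classic | PV i j => (sg i j @^-1` Ev)%classic end.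

Definition mutually_indep (R : realType) (d : measure_display) (Omega : measurableType d)
  (P : probability Omega R) (n m K : nat) (X : 'I_n -> nat -> nat -> Omega -> R)
  (sg : 'I_n -> nat -> Omega -> {perm 'I_(n+m)}) : Prop :=
  forall (N : nat) (f : 'I_N -> pidx n) (Ex : 'I_N -> set R)
         (Ev : 'I_N -> set {perm 'I_(n+m)}),
    injective f -> (forall r, pvalid K (f r)) -> (forall r, measurable (Ex r)) ->
    P (\bigcap_(r in [set: 'I_N]) pevent X sg (Ex r) (Ev r) (f r))%classic =
    (\prod_(r < N) P (pevent X sg (Ex r) (Ev r) (f r)))%E.

Definition past_gen (R : realType) (d : measure_display) (Omega : measurableType d)
  (n m K : nat) (X : 'I_n -> nat -> nat -> Omega -> R)
  (sg : 'I_n -> nat -> Omega -> {perm 'I_(n+m)}) (t : nat) (pj : nat -> bool)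
  : set (set Omega) :=
  [set A | (exists i t' k (B : set R),
               [/\ (1 <= t' <= t)%N, (1 <= k <= K)%N, measurable B & A = X i t' k @^-1` B])
        \/ (exists i j' (s : {perm 'I_(n+m)}),
               [/\ (1 <= j')%N, pj j' & A = sg i j' @^-1` [set s]])]%classic.

Definition past_measurable (R : realType) (d : measure_display) (Omega : measurableType d)
  (n m K : nat) (X : 'I_n -> nat -> nat -> Omega -> R)
  (sg : 'I_n -> nat -> Omega -> {perm 'I_(n+m)}) (t : nat) (pj : nat -> bool)
  (f : Omega -> nat) : Prop :=
  forall z : nat, ((<<s past_gen K X sg t pj >>) (f @^-1` [set z]))%classic.

Definition Upsilon (R : realType) (n m : nat) (adj : rel 'I_(n+m)) : R :=
  \big[Num.min/1]_(i < n) ((deg_hon adj i)%:R / (deg adj i)%:R).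

(* \bar I_j, driven by out r i = (\bar Y_r^(i), \bar H_r^(i)) *)
Fixpoint rumor_set (n : nat) (istar : 'I_n) (out : nat -> 'I_n -> bool * 'I_n) (j : nat)
  : {set 'I_n} :=
  match j with
  | 0 => [set istar]
  | j'.+1 => let I := rumor_set istar out j' in
             I :|: [set i | [&& i \notin I, (out j i).1 & (out j i).2 \in I]]
  end.

(* law of \bar H^(i): uniform on N_hon(i) (d_hon(i) >= 1 under (A1) when n >= 2) *)
Definition hbar_w (R : realType) (n m : nat) (adj : rel 'I_(n+m)) (i h : 'I_n) : R :=
  if deg_hon adj i == 0%N then (h == i)%:R
  else (adj_hon adj i h)%:R / (deg_hon adj i)%:R.

Definition rumor_out (n j : nat) (w : {ffun 'I_j -> {ffun 'I_n -> bool * 'I_n}})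
  : nat -> 'I_n -> bool * 'I_n :=
  fun r i => match @insub nat (fun x => (x < j)%N) 'I_j r.-1 with
             | Some r' => w r' i | None => (false, i) end.

(* P(\bar tau_spr <= j): exact probability over the first j rounds *)
Definition tau_le (R : realType) (n m : nat) (adj : rel 'I_(n+m)) (istar : 'I_n) (j : nat) : R :=
  let U := Upsilon R adj in
  \sum_(w : {ffun 'I_j -> {ffun 'I_n -> bool * 'I_n}})
     ((\prod_(r < j) \prod_(i < n)
         ((if (w r i).1 then U else 1 - U) * hbar_w R adj i (w r i).2))
      * (rumor_set istar (rumor_out w) j == [set: 'I_n]%SET)%:R).

Definition tau_eq (R : realType) (n m : nat) (adj : rel 'I_(n+m)) (istar : 'I_n) (j : nat) : R :=
  tau_le R adj istar j - (if j is j'.+1 then tau_le R adj istar j' else 0).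

(* E[A_{2 \bar tau_spr}] (= +oo if \bar tau_spr = oo with positive probability) *)
Definition exp_A2tau (R : realType) (beta : R) (n m : nat) (adj : rel 'I_(n+m))
  (istar : 'I_n) : \bar R :=
  ((\sum_(0 <= j <oo) ((phaseA beta (2 * j))%:R * tau_eq R adj istar j)%:E)
   + (if `[< forall e : R, (0 < e)%R -> exists j, (1 - e < tau_le R adj istar j)%R >]
      then 0 else +oo))%E.

Definition Cstar_max (R : realType) (beta rho1 : R) (n m : nat) (adj : rel 'I_(n+m))
  (K S : nat) (D2 : R) (i : 'I_n) : R :=
  Num.max ((deg_mal adj i)%:R / D2)
  (Num.max ((K%:R / D2) ^+ 2)
  (Num.max (S%:R `^ (beta / (rho1 ^+ 2 * (beta - 1))))
  (Num.max ((S%:R / D2 ^+ 2) `^ (beta / (beta - 1)))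
  (Num.max ((dbar adj)%:R `^ (beta / rho1))
           (n * K ^ 2 * S)%:R)))).

(* Main.v *)
Require Import Defs.
From HB Require Import structures.
From mathcomp Require Import all_boot all_order all_algebra fingroup perm.
From mathcomp Require Import all_classical all_reals all_analysis.
From mathcomp Require Import measurable_realfun.
From mathcomp Require Import zify ring lra.
Set Implicit Arguments.
Unset Strict Implicit.
Unset Printing Implicit Defensive.
Import Order.TTheory GRing.Theory Num.Theory.
Local Open Scope ring_scope.

(** Rewards concentrate around their means (Hoeffding's lemma and an exponential
    supermartingale), so after a random phase every UCB index is accurate and, in each
    phase, the most played arm is nearly the best active one.  Along such a run the mean of
    the recommended arm drifts by at most [K] times a vanishing amount (each arm can be
    lost only once per level), which is too little for the blocking rule to fire against an
    honest neighbour, provided that neighbour has heard from the agent recently; the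
    latter fails with exponentially small probability.  Once honest agents no longer block
    each other, the set of agents having the best arm active dominates the noisy rumor
    process, by peeling off one round at a time; hence after a phase of order
    [2 * tau_spr] every honest agent keeps playing and recommending arm [1].  From then on
    only malicious recommendations cost anything: a malicious neighbour is blocked for
    [p^eta] phases after being useless in phase [p], so the logarithms of its successive
    recommendation times grow geometrically with ratio [eta] and sum to at most
    [eta / (eta - 1) * ln T].  The expectation of the first good phase is summed by parts. *)

(** * Deterministic analysis of a run *)

(** Accuracy is required with radius [(1 - eps)] times the bonus. An active, rarely pulled arm then
    keeps [eps] of its large bonus above its mean, which turns a count below [kap] into a certified
    gap without knowing the means. The price is [2 * alpha * (1 - eps) ^+ 2] in place of
    [2 * alpha], a loss of less than 1 for [eps = 1 / (4 * alpha)]. Ruling out a block at [j0] needs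
    accuracy since phase [lo j0], and clearing the block lists around phase [j] needs this for all
    [j0 >= lo j]. The window of a target phase therefore starts at [lo (lo j)], of order
    [j ^ (rho1 ^ 2)]. An error at time [t] can spoil phases that end as late as
    [t ^ (1 / rho1 ^ 2)]: hence the last term in the condition on [alpha]. An apparent circle
    remains: an agent is not blocked if the neighbour has heard from it, but the neighbour may have
    stopped listening because of a block of its own. It is broken by counting such a block as
    hearing, because the block is itself evidence that the arm of the agent was active at the
    neighbour. *)

Record trace (R : realType) (n m : nat) := Trace {
  tI : 'I_n -> nat -> nat;
  tmh : 'I_n -> nat -> nat -> R;
  tact : 'I_n -> nat -> seq nat;
  tB : 'I_n -> nat -> nat;
  tH : 'I_n -> nat -> option 'I_(n+m);
  tR : 'I_n -> nat -> option nat;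
  tblk : 'I_n -> nat -> {set 'I_(n+m)}
}.

Section TraceDefs.
Context {R : realType} {n m : nat}.
Variables (A : nat -> nat) (K S : nat) (alpha : R) (adj : rel 'I_(n+m)).
Variables (kap : nat -> R) (lo up : nat -> nat) (tr : trace R n m).

Definition cnt (i : 'I_n) (t k : nat) : nat :=
  count (pred1 k) [seq tI tr i t' | t' <- iota 1 t].

Definition bonus (t c : nat) : R := Num.sqrt (alpha * ln t%:R / c%:R).

Definition pp (i : 'I_n) (j k : nat) : nat := (cnt i (A j) k - cnt i (A j.-1) k)%N.

(** The decision taken by [i] at the end of phase [j0] about the neighbour contacted one phase
    earlier; its duration is left to [ok_blk]. *)
Definition blockat (i : 'I_n) (j0 : nat) (h : 'I_(n+m)) : Prop :=
  [/\ (1 < j0)%N, tH tr i j0.-1 = Some h &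
   exists r, [/\ tR tr i j0.-1 = Some r, (cnt i (A j0) r)%:R <= kap j0 &
     forall j', (lo j0 <= j' < j0)%N -> tB tr i j' = tB tr i j0]].

(** The only facts about the algorithm used by the pathwise analysis; tie-breaking and adversarial
    choices are quantified away. An unpulled arm has infinite index, so [ok_ucb] speaks only when
    the pulled arm already has a sample, and then provides one for every active arm. In [ok_keep]
    the survivor need not be [tB] itself, since ties may be broken differently. *)
Record trace_ok : Prop := {
  ok_I : forall i j t, (A j < t <= A j.+1)%N -> tI tr i t \in tact tr i j.+1;
  ok_ucb : forall i j t k, (A j < t <= A j.+1)%N -> k \in tact tr i j.+1 ->
    (0 < cnt i t.-1 (tI tr i t))%N -> (0 < cnt i t.-1 k)%N /\
    tmh tr i t.-1 k + bonus t (cnt i t.-1 k)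
      <= tmh tr i t.-1 (tI tr i t) + bonus t (cnt i t.-1 (tI tr i t));
  ok_size : forall i j, size (tact tr i j.+1) = S.+2;
  ok_valid : forall i j k, k \in tact tr i j.+1 -> (1 <= k <= K)%N;
  ok_B : forall i j, tB tr i j.+1 \in tact tr i j.+1;
  ok_Bmax : forall i j k, k \in tact tr i j.+1 -> (pp i j.+1 k <= pp i j.+1 (tB tr i j.+1))%N;
  ok_stay : forall i j, (forall r, tR tr i j.+1 = Some r -> r \in tact tr i j.+1) ->
    tact tr i j.+2 = tact tr i j.+1;
  ok_new : forall i j r, tR tr i j.+1 = Some r -> r \in tact tr i j.+2;
  ok_keep : forall i j, exists u, [/\ u \in tact tr i j.+1, u \in tact tr i j.+2
    & (pp i j.+1 (tB tr i j.+1) <= pp i j.+1 u)%N];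
  ok_rem : forall i j, exists x, forall k, k \in tact tr i j.+1 -> k != x ->
    k \in tact tr i j.+2;
  ok_H : forall i j h, tH tr i j.+1 = Some h -> adj (lshift m i) h /\ h \notin tblk tr i j.+1;
  ok_HR : forall i j i', tH tr i j.+1 = Some (lshift m i') ->
    tR tr i j.+1 = Some (tB tr i' j.+1);
  ok_RH : forall i j r, tR tr i j.+1 = Some r -> exists h, tH tr i j.+1 = Some h;
  ok_blk : forall i j h, h \in tblk tr i j.+1 <->
    exists2 j0, (j0 <= j.+1 <= up j0)%N & blockat i j0 h
}.
End TraceDefs.

Ltac keep_nat := repeat match goal with
  | H : context [@Order.le] |- _ => clear H
  | H : context [@Order.lt] |- _ => clear H
  | H : forall _, _ |- _ => clear H
  | H : trace_ok _ _ _ _ _ _ _ _ _ |- _ => clear H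
  | H : _ \in _ |- _ => clear H
  | H : tR _ _ _ = _ |- _ => clear H
  | H : tH _ _ _ = _ |- _ => clear H
  end.
Ltac nlia := keep_nat; lia.

Section Deterministic.
Context {R : realType} {n m : nat}.
Variables (A : nat -> nat) (K S : nat) (alpha eps : R) (adj : rel 'I_(n+m)).
Variables (kap : nat -> R) (lo up : nat -> nat) (tr : trace R n m) (mu : nat -> R).
Hypothesis A0 : A 0 = 0%N.
Hypothesis A_lt : forall j, (A j < A j.+1)%N.
Hypothesis alpha0 : 0 < alpha.
Hypothesis eps0 : 0 <= eps.
Hypothesis Hok : trace_ok A K S alpha adj kap lo up tr.

Notation cn := (@cnt R n m tr).
Notation ppi := (@pp R n m A tr).
Notation bon := (@bonus R alpha).

Lemma A_le i j : (i <= j)%N -> (A i <= A j)%N.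
Proof.
by apply: (homo_leq (leqnn) (leq_trans)) => x; exact: ltnW.
Qed.

Lemma cntS i t k : cn i t.+1 k = (cn i t k + (tI tr i t.+1 == k))%N.
Proof. rewrite /cnt -[in LHS](addn1 t) iotaD map_cat count_cat /= addn0 add1n//.
Qed.

Lemma cnt_le i k : {homo (fun t => cn i t k) : s t / (s <= t)%N}.
Proof.
by apply: (homo_leq (leqnn) (leq_trans)) => x; rewrite cntS leq_addr.
Qed.

Lemma cnt0 i k : cn i 0 k = 0%N. Proof. by []. Qed.

Lemma cnt_le_time i t k : (cn i t k <= t)%N.
Proof. by rewrite /cnt (leq_trans (count_size _ _))// size_map size_iota. Qed.

(** Counts are bounded at the last pull of an arm, the latest moment at which its index is known to
    be maximal. *)
Lemma last_pull i k t1 t2 : (cn i t1 k < cn i t2 k)%N ->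
  exists t, [/\ (t1 < t <= t2)%N, tI tr i t = k & (cn i t.-1 k).+1 = cn i t2 k].
Proof.
elim: t2 => [|t2 IH]; first by rewrite cnt0.
rewrite cntS; have [Ik|_] := eqVneq (tI tr i t2.+1) k.
  rewrite (addn1 (cn i t2 k)) ltnS => h; exists t2.+1; split=> //.
  rewrite leqnn andbT ltnS leqNgt; apply/negP => /(@cnt_le i k).
  rewrite cntS Ik eqxx; lia.
rewrite addn0 => /IH [t [/andP[a b] c d]]; exists t; split=> //.
by rewrite a (leq_trans b).
Qed.

Lemma phase_pulls_sum i j t : (A j <= t <= A j.+1)%N ->
  (t - A j <= \sum_(k <- tact tr i j.+1) (cn i t k - cn i (A j) k))%N.
Proof.
elim: t => [|t IH]; first by rewrite sub0n.
case/andP; rewrite leq_eqVlt => /orP[/eqP ->|]; first by rewrite subnn.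
rewrite ltnS => h1 h2.
have := IH; rewrite h1 (ltnW h2) => /(_ isT) {}IH.
have hI : tI tr i t.+1 \in tact tr i j.+1 by apply: (ok_I Hok); rewrite ltnS h1.
rewrite subSn //; apply: leq_trans (_ : _ <= \sum_(k <- tact tr i j.+1)
  ((cn i t k - cn i (A j) k) + (tI tr i t.+1 == k)))%N _.
  rewrite big_split /= -addn1 leq_add// (big_rem _ hI) /= eqxx leq_addr//.
rewrite leq_eqVlt; apply/orP; left; apply/eqP; apply: eq_bigr => k _.
by rewrite cntS addnBAC// cnt_le.
Qed.

Definition G j := (A j - A j.-1)%N.

(** Pigeonhole: the pulls of a phase are shared by [S.+2] active arms. *)
Lemma pp_B_ge i j : (G j.+1 <= S.+2 * ppi i j.+1 (tB tr i j.+1))%N.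
Proof.
have /(phase_pulls_sum i) : (A j <= A j.+1 <= A j.+1)%N by rewrite leqnn ltnW.
move/leq_trans; apply; rewrite -(ok_size Hok i j) -sum1_size big_distrl /=.
rewrite big_seq [X in (_ <= X)%N]big_seq; apply: leq_sum => k hk.
by rewrite mul1n; exact: (ok_Bmax Hok).
Qed.

(** The radius is [1 - eps] times the bonus of the index, so that the index of an arm exceeds its
    mean by at least [eps] bonuses. *)
Definition clean_at t := forall i k, (1 <= k <= K)%N -> (0 < cn i t.-1 k)%N ->
  `|tmh tr i t.-1 k - mu k| <= (1 - eps) * bon t (cn i t.-1 k).

Lemma bonus_ge0 t c : 0 <= bon t c. Proof. exact: sqrtr_ge0. Qed.

(** The index of [k] is at least its mean plus [eps] bonuses, that of the pulled arm at most its
    mean plus [2 - eps] bonuses, and the latter index is the larger one. *)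
Lemma ucb_compare i j t k : clean_at t -> (A j < t <= A j.+1)%N ->
  k \in tact tr i j.+1 -> (0 < cn i t.-1 (tI tr i t))%N ->
  (0 < cn i t.-1 k)%N /\
  mu k + eps * bon t (cn i t.-1 k)
    <= mu (tI tr i t) + 2 * bon t (cn i t.-1 (tI tr i t)).
Proof.
move=> Hc ht hk c0; have [ck a] := ok_ucb Hok ht hk c0; split=> //.
have := Hc i k (ok_valid Hok hk) ck.
have := Hc i _ (ok_valid Hok (ok_I Hok i ht)) c0.
rewrite !ler_norml => /andP[h1 h2] /andP[h3 h4].
have := bonus_ge0 t (cn i t.-1 (tI tr i t)).
have := bonus_ge0 t (cn i t.-1 k).
set b1 := bon _ _; set b2 := bon _ _ => b10 b20.
have : 0 <= eps * b2 by rewrite mulr_ge0.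
move: a h2 h3; rewrite -/b1 -/b2 !mulrBl !mul1r; lra.
Qed.

Lemma pull_bound i j t k : clean_at t -> (A j < t <= A j.+1)%N ->
  k \in tact tr i j.+1 -> mu (tI tr i t) < mu k ->
  (cn i t.-1 (tI tr i t))%:R <= 4 * alpha * ln t%:R / (mu k - mu (tI tr i t)) ^+ 2.
Proof.
move=> Hc ht hk hlt; have t0 : (0 < t)%N by case/andP: ht; case: (t).
have l0 : 0 <= ln t%:R :> R by rewrite ln_ge0// ler1n.
have d0 : 0 < mu k - mu (tI tr i t) by rewrite subr_gt0.
have [c0|] := posnP (cn i t.-1 (tI tr i t)).
  by rewrite c0 divr_ge0// ?mulr_ge0// ?sqr_ge0// ltW.
move=> c0; have [ck h] := ucb_compare Hc ht hk c0.
set c := cn _ _ _ in c0 h *.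
have : mu k - mu (tI tr i t) <= 2 * bon t c.
  have : 0 <= eps * bon t (cn i t.-1 k) by rewrite mulr_ge0// bonus_ge0.
  lra.
move=> h2; rewrite ler_pdivlMr ?exprn_gt0//.
have h3 : (mu k - mu (tI tr i t)) ^+ 2 <= (2 * bon t c) ^+ 2.
  by rewrite ler_sqr ?nnegrE ?mulr_ge0 ?bonus_ge0// ltW.
have c0' : 0 < c%:R :> R by rewrite ltr0n.
rewrite exprMn sqr_sqrtr in h3; last by rewrite divr_ge0// mulr_ge0// ltW.
apply: le_trans (_ : c%:R * (2 ^+ 2 * (alpha * ln t%:R / c%:R)) <= _).
  by rewrite ler_pM2l.
by rewrite le_eqVlt; apply/orP; left; apply/eqP; field; rewrite gt_eqF.
Qed.

(** Twice the bonus, at the last time of phase [j], of an arm with [G j / (2 * S.+2)] samples, the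
    number guaranteed by [big_pull_phase]. *)
Definition dl (j : nat) : R := 2 * Num.sqrt ((2 * S.+2)%:R * alpha * ln (A j)%:R / (G j)%:R).

Lemma G_gt0 j : (0 < G j.+1)%N.
Proof. by rewrite subn_gt0. Qed.

Lemma bonus_phase j t c : (0 < t <= A j.+1)%N -> (G j.+1 <= 2 * S.+2 * c)%N ->
  bon t c <= Num.sqrt ((2 * S.+2)%:R * alpha * ln t%:R / (G j.+1)%:R).
Proof.
move=> /andP[t0 tA] hc; apply: ler_wsqrtr.
have l0 : 0 <= ln t%:R :> R by rewrite ln_ge0// ler1n.
have g0 : 0 < (G j.+1)%:R :> R by rewrite ltr0n G_gt0.
have c0 : 0 < c%:R :> R.
  by rewrite ltr0n; have := G_gt0 j; case: (c) hc => //; rewrite muln0; lia.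
rewrite ler_pdivrMr// mulrAC ler_pdivlMr//.
have : (G j.+1)%:R <= (2 * S.+2)%:R * c%:R :> R by rewrite -natrM ler_nat.
move=> /(ler_wpM2l (mulr_ge0 (ltW alpha0) l0)); nra.
Qed.

(** At its last pull in the phase, [u] has all but one of its phase pulls behind it. The length
    condition makes these at least two, so at least half of them remain: this is the factor 2. *)
Lemma big_pull_phase i j u : (2 * S.+2 <= G j.+1)%N ->
  (ppi i j.+1 (tB tr i j.+1) <= ppi i j.+1 u)%N ->
  exists t, [/\ (A j < t <= A j.+1)%N, tI tr i t = u, (0 < cn i t.-1 u)%N
    & (G j.+1 <= 2 * S.+2 * cn i t.-1 u)%N].
Proof.
move=> hG hu; have hB := pp_B_ge i j.
have hu2 : (2 <= ppi i j.+1 u)%N.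
  apply: leq_trans hu; move: (leq_trans hG hB); rewrite mulnC leq_mul2l.
  by [].
have [t [t1 t2 t3]] : exists t, [/\ (A j < t <= A j.+1)%N, tI tr i t = u
    & (cn i t.-1 u).+1 = cn i (A j.+1) u].
  by apply: last_pull; move: hu2; rewrite /pp /=; lia.
exists t; split=> //.
  by move: hu2; rewrite /pp /=; lia.
have : (ppi i j.+1 u <= 2 * cn i t.-1 u)%N.
  by move: hu2; rewrite /pp /=; lia.
move=> h; apply: (leq_trans hB); apply: leq_trans (_ : S.+2 * (2 * cn i t.-1 u) <= _)%N.
  by rewrite leq_mul2l (leq_trans hu h) orbT.
by rewrite mulnA (mulnC S.+2).
Qed.

Lemma ln_nat_le s t : (0 < s)%N -> (s <= t)%N -> ln s%:R <= ln t%:R :> R.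
Proof. by move=> s0 st; rewrite ler_ln ?posrE ?ltr0n ?ler_nat// (leq_trans s0). Qed.

(** Stated for every [u] played as much as the most played arm, since such an arm is what [ok_keep]
    carries into the next phase. *)
Lemma near_best i j u k :
  (forall t, (A j < t <= A j.+1)%N -> clean_at t) -> (2 * S.+2 <= G j.+1)%N ->
  (ppi i j.+1 (tB tr i j.+1) <= ppi i j.+1 u)%N -> k \in tact tr i j.+1 ->
  mu k - dl j.+1 <= mu u.
Proof.
move=> Hc hG hu hk; have [t [ht Iu c0 hc]] := big_pull_phase hG hu.
have [] := ucb_compare (Hc t ht) ht hk; first by rewrite Iu.
rewrite Iu => _ h.
have t0 : (0 < t <= A j.+1)%N by move: ht; lia.
have := bonus_phase t0 hc.
have : Num.sqrt ((2 * S.+2)%:R * alpha * ln t%:R / (G j.+1)%:R) <= dl j.+1 / 2.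
  rewrite /dl [X in _ <= X]mulrC mulKf//; apply: ler_wsqrtr.
  rewrite ler_pM2r ?invr_gt0 ?ltr0n ?G_gt0// ler_pM2l ?mulr_gt0 ?ltr0n//.
  by apply: ln_nat_le; lia.
have : 0 <= eps * bon t (cn i t.-1 k) by rewrite mulr_ge0// bonus_ge0.
lra.
Qed.

(** When the most played arm is pulled, an active [r] with at most [kap] samples loses in spite of
    its large spare bonus, so its mean must be lower by that much. *)
Lemma few_pulls_gap i j r :
  (forall t, (A j < t <= A j.+1)%N -> clean_at t) -> (2 * S.+2 <= G j.+1)%N ->
  r \in tact tr i j.+1 -> (cn i (A j.+1) r)%:R <= kap j.+1 ->
  exists2 t, (A j < t <= A j.+1)%N & 
  mu r + eps * Num.sqrt (alpha * ln t%:R / kap j.+1)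
    <= mu (tB tr i j.+1) + 2 * Num.sqrt ((2 * S.+2)%:R * alpha * ln t%:R / (G j.+1)%:R).
Proof.
move=> Hc hG hr hk; have [t [ht Iu c0 hc]] := big_pull_phase hG (leqnn (ppi i j.+1 (tB tr i j.+1))).
exists t => //.
have [] := ucb_compare (Hc t ht) ht hr; first by rewrite Iu.
rewrite Iu => r0 h.
have t0 : (0 < t <= A j.+1)%N by move: ht; lia.
have h1 := bonus_phase t0 hc.
have cr : (cn i t.-1 r <= cn i (A j.+1) r)%N by apply: cnt_le; lia.
have kr : (cn i t.-1 r)%:R <= kap j.+1 by apply: le_trans hk; rewrite ler_nat.
have r0' : 0 < (cn i t.-1 r)%:R :> R by rewrite ltr0n.
have : Num.sqrt (alpha * ln t%:R / kap j.+1) <= bon t (cn i t.-1 r).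
  apply: ler_wsqrtr; rewrite ler_wpM2l//.
    by rewrite mulr_ge0// ?ln_ge0 ?ler1n//; [exact: ltW|lia].
  by rewrite lef_pV2// posrE (lt_le_trans r0').
move=> /(ler_wpM2l eps0); lra.
Qed.

(** Pigeonhole: there are [K] disjoint levels of width [d] below [x0], and [k0] lies above all of
    them, so the other [K - 1] arms leave one level empty. *)
Lemma level_gap (x0 d : R) k0 : (1 <= k0 <= K)%N -> x0 <= mu k0 -> 0 <= d ->
  exists2 r, (r < K)%N & forall k, (1 <= k <= K)%N ->
    x0 - r.+1%:R * d <= mu k -> x0 - r%:R * d <= mu k.
Proof.
move=> hk0 hx d0.
pose P r k := (x0 - r.+1%:R * d <= mu k) && (mu k < x0 - r%:R * d).
have [/hasP[r]|/hasPn H] := boolP (has (fun r => ~~ has (P r) (iota 1 K)) (iota 0 K)).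
  rewrite mem_iota => /andP[_ rK] /hasPn H; exists r => // k hk h1.
  have := H k; rewrite mem_iota add1n ltnS => /(_ hk); rewrite /P h1 /=.
  by rewrite -leNgt.
exfalso.
(* If every level were inhabited, [f] would inject the [K] levels into the arms other than [k0]. *)
pose f r := nth 0%N (iota 1 K) (find (P r) (iota 1 K)).
have fP r : (r < K)%N -> P r (f r) /\ f r \in iota 1 K.
  move=> rK; have := H r; rewrite mem_iota /= add0n => /(_ rK); rewrite negbK => hP.
  by split; [exact: nth_find | rewrite mem_nth// -has_find].
have finj : {in iota 0 K &, injective f}.
  suff Hlt r s : (r < K)%N -> (s < K)%N -> (r < s)%N -> f r != f s.
    move=> r s; rewrite !mem_iota /= !add0n => rK sK e.
    by case: (ltngtP r s) => // h; [have := Hlt _ _ rK sK h|have := Hlt _ _ sK rK h];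
      rewrite e eqxx.
  move=> rK sK rs; apply/eqP => e.
  have [/andP[h1 _] _] := fP r rK; have [/andP[_ h2] _] := fP s sK.
  move: h2; rewrite -e ltNge => /negP; apply; apply: le_trans h1.
  by rewrite lerD2l lerN2 ler_wpM2r// ler_nat.
have : (size [seq f r | r <- iota 0 K] <= size [seq k <- iota 1 K | k != k0])%N.
  apply: uniq_leq_size; first by rewrite map_inj_in_uniq// iota_uniq.
  move=> k /mapP[r]; rewrite mem_iota /= add0n => rK ->.
  have [/andP[_ h1] h2] := fP r rK; rewrite mem_filter h2 andbT.
  apply/eqP => e; move: h1; rewrite e ltNge => /negP; apply.
  by apply: le_trans hx; rewrite gerBl mulr_ge0.
rewrite size_map size_iota size_filter.
have := count_predC (pred1 k0) (iota 1 K); rewrite size_iota.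
rewrite (count_uniq_mem _ (iota_uniq _ _)) mem_iota add1n ltnS hk0 /=.
by rewrite (eq_count (a2 := fun k => k != k0))//; lia.
Qed.

(** One phase lowers the mean of the surviving arm by at most [d], too short a step to jump over the
    empty level of [level_gap]. The number of phases between [p] and [q] therefore does not enter
    the loss. *)
Lemma drift i p q k0 (d : R) : (0 < p)%N -> (p <= q)%N -> k0 \in tact tr i p -> 0 <= d ->
  (forall v u k, (p <= v <= q)%N -> (ppi i v (tB tr i v) <= ppi i v u)%N ->
     u \in tact tr i v ->  k \in tact tr i v -> mu k - d <= mu u) ->
  mu k0 - K%:R * d <= mu (tB tr i q).
Proof.
move=> p0 pq hk0 d0 Hn.
have vk0 : (1 <= k0 <= K)%N by move: hk0; case: (p) p0 => // p' _; exact: (ok_valid Hok).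
have [r rK hr] := level_gap vk0 (lexx (mu k0)) d0.
have [k hk1 hk2] : exists2 k, k \in tact tr i q & mu k0 - r%:R * d <= mu k.
  have : forall v, (p <= v <= q)%N -> exists2 k, k \in tact tr i v & mu k0 - r%:R * d <= mu k.
    elim=> [|v IH] ; first by rewrite leqn0 (gtn_eqF p0).
    case/andP; rewrite leq_eqVlt => /orP[/eqP <- _|].
      by exists k0 => //; rewrite gerBl mulr_ge0.
    rewrite ltnS => pv vq; have [|k hk1 hk2] := IH; first by rewrite pv ltnW.
    case: v {IH} pv vq hk1 hk2 => [|v] pv vq hk1 hk2; first by move: p0 pv; case: (p).
    have [u [u1 u2 u3]] := ok_keep Hok i v; exists u => //.
    apply: hr; first exact: (ok_valid Hok u1).
    have := Hn v.+1 u k; rewrite pv (ltnW vq) => /(_ isT u3 u1 hk1).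
    rewrite -natr1 mulrDl mul1r; lra.
  by apply; rewrite pq leqnn.
case: q pq Hn hk1 => [|q] pq Hn hk1; first by move: p0 pq; case: (p).
have := Hn q.+1 (tB tr i q.+1) k; rewrite pq leqnn => /(_ isT (leqnn _) (ok_B Hok _ _) hk1) h.
have : mu k0 - r%:R * d <= mu (tB tr i q.+1).
  apply: hr; first exact: (ok_valid Hok (ok_B Hok _ _)).
  rewrite -natr1 mulrDl mul1r; lra.
apply: le_trans; rewrite lerD2l lerN2 ler_wpM2r// ler_nat; exact: ltnW.
Qed.

(** Blocking [i] counts as hearing from [i]. After phase [(j0 + 2) %/ 3] the bans decided up to
    [lo j0] have expired; the bound [j0 - 2] leaves time for the arm heard to be active at [i'] in
    phase [j0 - 1], where [i'] makes the recommendation under scrutiny. *)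
Definition hear i' i j0 := exists2 q, ((j0 + 2) %/ 3 < q <= j0 - 2)%N
  & lshift m i \in tblk tr i' q \/ tH tr i' q = Some (lshift m i).

(* The numerical condition under which a pull count below [kap j0] certifies a gap
   larger than the total drift [K * d] accrued since phase [lo j0]. *)
Definition block_margin j0 := exists d : R, [/\ 0 <= d,
  (forall v, (lo j0 <= v <= j0)%N -> (2 * S.+2 <= G v)%N /\ dl v <= d) &
  (forall t, (A j0.-1 < t <= A j0)%N ->
   K%:R * d + 2 * Num.sqrt ((2 * S.+2)%:R * alpha * ln t%:R / (G j0)%:R)
     < eps * Num.sqrt (alpha * ln t%:R / kap j0))].

Lemma nonblock i i' j0 :
  (0 < lo j0 <= j0)%N -> (lo j0 <= (j0 + 2) %/ 3)%N ->
  (forall j, (j <= lo j0)%N -> (up j <= (j0 + 2) %/ 3)%N) ->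
  block_margin j0 -> (forall t, (A (lo j0).-1 < t <= A j0)%N -> clean_at t) ->
  hear i' i j0 -> ~ blockat A kap lo tr i j0 (lshift m i').
Proof.
move=> /andP[lo0 loj] lo3 Hup [d [d0 Hd Hm]] Hc [q /andP[q1 q2] Hq] [j01 HH [r [Hr rk HB]]].
have clean_ph v : (lo j0 <= v <= j0)%N ->
    forall t, (A v.-1 < t <= A v)%N -> clean_at t.
  move=> hv t ht; apply: Hc.
  have h1 : (A (lo j0).-1 <= A v.-1)%N by apply: A_le; nlia.
  have h2 : (A v <= A j0)%N by apply: A_le; nlia.
  nlia.
have Hn ia v u k : (lo j0 <= v <= j0)%N -> (ppi ia v (tB tr ia v) <= ppi ia v u)%N ->
     u \in tact tr ia v ->  k \in tact tr ia v -> mu k - d <= mu u.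
  move=> hv hu _ hk; have [g1 g2] := Hd v hv.
  have : mu k - dl v <= mu u.
    have := clean_ph v hv.
    by case: v hv g1 g2 hu hk => [|v] hv g1 g2 hu hk ; [move: lo0 hv; nlia|move=> hcl; exact: near_best hk].
  lra.
have gapB ia j r' : (lo j0 <= j.+1 <= j0)%N -> r' \in tact tr ia j.+1 ->
   (cn ia (A j.+1) r')%:R <= kap j.+1 -> exists2 t, (A j < t <= A j.+1)%N & 
  mu r' + eps * Num.sqrt (alpha * ln t%:R / kap j.+1)
    <= mu (tB tr ia j.+1) + 2 * Num.sqrt ((2 * S.+2)%:R * alpha * ln t%:R / (G j.+1)%:R).
  move=> hv; apply: few_pulls_gap; [exact: clean_ph hv|by case: (Hd _ hv)].
set k := tB tr i j0 in HB.
have rB : r = tB tr i' j0.-1.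
  case: (j0) j01 HH Hr => // -[|j] // _ /= HH; rewrite (ok_HR Hok HH); by case.
have rgap : mu r < mu k - K%:R * d.
  have hr : r \in tact tr i j0 by case: (j0) j01 Hr => // -[|j] // _ /= /(ok_new Hok).
  have j0S : j0 = j0.-1.+1 by rewrite prednK// (ltn_trans _ j01).
  have [|||t ht] := gapB i j0.-1 r; rewrite -?j0S//; first by rewrite loj leqnn.
  rewrite -/k => h; have := Hm t; rewrite [X in (_ < _ <= A X)%N]j0S => /(_ ht); lra.
suff: mu k - K%:R * d <= mu (tB tr i' j0.-1) by rewrite -rB; lra.
have drift' p k0 : (lo j0 <= p)%N -> (p <= j0.-1)%N -> k0 \in tact tr i' p ->
    mu k0 - K%:R * d <= mu (tB tr i' j0.-1).
  move=> h1 h2 h3; apply: drift (h2) h3 d0 _; first by nlia.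
  by move=> v u k' hv; apply: Hn; nlia.
(* A ban of [i] by [i'] in force at [q] was decided after [lo j0], older ones having expired, and
   was triggered by a recommendation of [i], hence by [k]. That arm was then active at [i'], which
   is as useful as a contact. *)
case: Hq => [|Hh].
- case: q q1 q2 => [//|q] q1 q2; rewrite (ok_blk Hok) => -[j2 /andP[j2a j2b] [j21 HH2 [r2 [Hr2 r2k HB2]]]].
  have j2lo : (lo j0 < j2)%N.
    by rewrite ltnNge; apply/negP => /Hup; nlia.
  have r2E : r2 = k.
    have : r2 = tB tr i j2.-1.
      case: (j2) j21 HH2 Hr2 => // -[|j] // _ /= HH2; rewrite (ok_HR Hok HH2); by case.
    by move->; apply: HB; nlia.
  have hr2 : r2 \in tact tr i' j2 by case: (j2) j21 Hr2 => // -[|j] // _ /= /(ok_new Hok).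
  have j2S : j2 = j2.-1.+1 by rewrite prednK// (ltn_trans _ j21).
  rewrite -r2E; apply: drift' hr2; nlia.
- have Hk : tR tr i' q = Some k.
    case: (q) q1 q2 Hh => // q' q1 q2 /(ok_HR Hok) ->.
    by congr Some; apply: HB; nlia.
  have hk : k \in tact tr i' q.+1 by case: (q) q1 Hk => // q' _ /(ok_new Hok).
  by apply: drift' hk; nlia.
Qed.

Variable Dl : nat -> R.
Hypothesis K2 : (1 < K)%N.
Hypothesis DlE : forall k, (1 <= k <= K)%N -> Dl k = mu 1 - mu k.
Hypothesis Dl_le1 : forall k, (2 <= k)%N -> 0 < Dl k <= 1.
Hypothesis Dl_le : forall k l, (2 <= k <= l)%N -> (Dl l)^-1 <= (Dl k)^-1.

Lemma gap2_le k : (1 <= k <= K)%N -> k != 1%N -> mu k <= mu 1 - Dl 2.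
Proof.
move=> hk k1; have k2 : (2 <= k)%N by move: hk k1; lia.
have := Dl_le (k := 2) (l := k); rewrite k2 => /(_ isT).
have /andP[h1 _] := Dl_le1 k2; have /andP[h2 _] := Dl_le1 (leqnn 2).
rewrite lef_pV2 ?posrE// (DlE hk); lra.
Qed.

(** With [dl] below the smallest gap, an arm that is nearly the best active one can only be arm
    1. *)
Lemma best_arm_phase i j :
  (forall t, (A j < t <= A j.+1)%N -> clean_at t) -> (2 * S.+2 <= G j.+1)%N ->
  dl j.+1 < Dl 2 -> 1%N \in tact tr i j.+1 ->
  tB tr i j.+1 = 1%N /\ 1%N \in tact tr i j.+2.
Proof.
move=> Hc hG hdl h1.
have H u : (ppi i j.+1 (tB tr i j.+1) <= ppi i j.+1 u)%N -> u \in tact tr i j.+1 -> u = 1%N.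
  move=> hu hin; apply/eqP; apply/negPn/negP => /(gap2_le (ok_valid Hok hin)).
  have := near_best Hc hG hu h1; lra.
split; first exact: H (leqnn _) (ok_B Hok _ _).
by have [u [u1 u2 u3]] := ok_keep Hok i j; rewrite -(H u).
Qed.

Lemma phase_of t : (0 < t)%N -> exists j, (A j < t <= A j.+1)%N.
Proof.
move=> t0; have [J] : exists J, (t <= A J)%N.
  by exists t; elim: (t) => // s IH; apply: leq_ltn_trans IH _.
elim: J => [|j IH]; first by rewrite A0 leqNgt t0.
by case: (leqP t (A j)) => [/IH//|h1 h2]; exists j; rewrite h1.
Qed.

(** Fractional knapsack: with capacity [c] per item and [c * D] in total, decreasing weights are
    best used by filling the first [D] items. *)
Lemma knapsack (x v : nat -> R) (c : R) D :
  (forall k l, (2 <= k <= l)%N -> x l <= x k) -> (forall k, (2 <= k)%N -> 0 <= x k) ->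
  0 <= c -> (forall k, (2 <= k <= K)%N -> 0 <= v k <= c) ->
  \sum_(2 <= k < K.+1) v k <= c * D%:R ->
  \sum_(2 <= k < K.+1) v k * x k <= c * \sum_(2 <= k < D.+2) x k.
Proof.
move=> xle x0 c0 hv hs; set y := x D.+2.
have y0 : 0 <= y by apply: x0.
(* Lagrangian bound whose multiplier [y] is the first weight left out. *)
have h1 : \sum_(2 <= k < K.+1) v k * x k <=
    \sum_(2 <= k < K.+1) (v k * y + (if (k < D.+2)%N then c * (x k - y) else 0)).
  rewrite big_nat [X in _ <= X]big_nat; apply: ler_sum => k hk.
  have /andP[v0 vc] : 0 <= v k <= c by apply: hv; rewrite -ltnS.
  case: ifPn => kD.
    have : y <= x k by apply: xle; move: hk kD; lia.
    nra.
  have : x k <= y by apply: xle; move: kD; lia.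
  nra.
apply: (le_trans h1); rewrite big_split /= -mulr_suml.
have h2 : \sum_(2 <= k < K.+1) (if (k < D.+2)%N then c * (x k - y) else 0)
    <= \sum_(2 <= k < D.+2) (c * (x k - y)).
  rewrite -big_mkcond /= (big_nat_widen 2 D.+2 (K.+1 + D.+2)) ?leq_addl//=.
  rewrite [X in _ <= X](big_cat_nat (n := K.+1)) ?leq_addr//=; last exact: ltnW.
  rewrite lerDl big_nat_cond sumr_ge0// => k /andP[/andP[k1 k2] kD].
  by rewrite mulr_ge0// subr_ge0 xle//; move: K2 k1 kD; lia.
apply: (le_trans (lerD (ler_wpM2r y0 hs) h2)).
rewrite -mulr_sumr sumrB sumr_const_nat subn2 /= -mulr_natl; lra.
Qed.

Lemma sum_mem_le (s : seq nat) a b :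
  (\sum_(a <= k < b) (k \in s) <= size s)%N.
Proof.
rewrite -big_mkcond /= sum1_count -size_filter; apply: uniq_leq_size.
  by rewrite filter_uniq// iota_uniq.
by move=> k; rewrite mem_filter => /andP[].
Qed.


(** * Regret once every honest agent keeps and recommends arm 1 *)

Section Regret.
Variables (i : 'I_n) (j j1 T N : nat) (eta : R).
Hypothesis j0 : (0 < j)%N.
Hypothesis TN : (T <= A N)%N.
Hypothesis Hact : forall i' p, (j <= p <= N)%N -> 1%N \in tact tr i' p.
Hypothesis HB1 : forall i' p, (j <= p <= N)%N -> tB tr i' p = 1%N.
Hypothesis Hclean : forall t, (A j < t <= A N)%N -> clean_at t.

Let x k := (Dl k)^-1.
Let ek k := (cn i T k - cn i (A j) k)%N.

Lemma late_phase t : (A j < t <= A N)%N -> exists p, [/\ (A p < t <= A p.+1)%N, (j <= p)%N & (p < N)%N].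
Proof.
case/andP=> h1 h2; have [p hp] : exists p, (A p < t <= A p.+1)%N by apply: phase_of; lia.
exists p; split=> //.
  rewrite leqNgt; apply/negP => h; have := A_le h; lia.
rewrite ltnNge; apply/negP => h; have := A_le h; lia.
Qed.

Lemma late_pull k t : (2 <= k <= K)%N -> (A j < t <= A N)%N -> tI tr i t = k ->
  (cn i t.-1 k)%:R <= 4 * alpha * ln t%:R * x k ^+ 2.
Proof.
move=> hk ht Ik; have [p [hp jp pN]] := late_phase ht.
have h1 : 1%N \in tact tr i p.+1 by apply: Hact; lia.
have kK : (1 <= k <= K)%N by lia.
have /andP[d0 _] : 0 < Dl k <= 1 by apply: Dl_le1; lia.
have := pull_bound (Hclean ht) hp h1; rewrite Ik -(DlE kK) exprVn; apply.
by move: d0; rewrite (DlE kK); lra.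
Qed.

Lemma tI_valid s t : (1 <= t <= s)%N -> (1 <= tI tr i t <= K)%N.
Proof.
by case/andP=> /phase_of[p hp] _; exact: (ok_valid Hok (ok_I Hok i hp)).
Qed.

Lemma regret_split : \sum_(1 <= t < T.+1) (mu 1 - mu (tI tr i t))
  <= (A j)%:R + \sum_(2 <= k < K.+1) Dl k * (ek k)%:R.
Proof.
have hI := @tI_valid T; have hI' := @tI_valid (A j).
have E t : (forall s, (1 <= s <= t)%N -> (1 <= tI tr i s <= K)%N) ->
    forall F : nat -> R, \sum_(1 <= s < t.+1) F (tI tr i s) = \sum_(1 <= k < K.+1) F k * (cn i t k)%:R.
  move=> + F; elim: t => [|t IH] hs.
    by rewrite big_geq// big1// => k _; rewrite cnt0 mulr0.
  rewrite big_nat_recr//= IH; last by move=> s hs'; apply: hs; lia.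
  under [RHS]eq_bigr do rewrite cntS natrD mulrDr.
  rewrite big_split /=; congr (_ + _).
  rewrite (bigD1_seq (tI tr i t.+1)) ?iota_uniq//=; last first.
    by rewrite mem_index_iota ltnS; apply: hs; rewrite /= leqnn.
  rewrite eqxx mulr1 big1 ?addr0// => k; rewrite eq_sym => /negbTE ->.
  by rewrite mulr0.
rewrite (E T hI (fun k => mu 1 - mu k)).
apply: le_trans (_ : \sum_(1 <= k < K.+1) ((cn i (A j) k)%:R + Dl k * (ek k)%:R) <= _).
  rewrite big_nat [X in _ <= X]big_nat; apply: ler_sum => k hk.
  have kK : (1 <= k <= K)%N by move: hk; lia.
  rewrite -(DlE kK).
  have h1 : (cn i T k)%:R <= (cn i (A j) k)%:R + (ek k)%:R :> R.
    by rewrite -natrD ler_nat /ek; lia.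
  have h2 : 0 <= Dl k <= 1.
    have [->|k1] := eqVneq k 1%N; first by rewrite DlE ?subrr ?lexx ?ler01//; move: K2; lia.
    have /andP[/ltW -> ->//] : 0 < Dl k <= 1 by apply: Dl_le1; lia.
  have h3 : 0 <= (cn i (A j) k)%:R :> R by [].
  case/andP: h2; move: h1 h3; set a : R := (cn i T k)%:R; set b : R := (cn i (A j) k)%:R; nra.
rewrite big_split /=; apply: lerD.
  have := E (A j) hI' (fun=> 1); under [X in _ = X -> _]eq_bigr do rewrite mul1r.
  by move=> <-; rewrite sumr_const_nat subn1.
rewrite big_ltn ?(ltnW K2)//; last by rewrite ltnS ltnW.
by rewrite DlE ?subrr ?mul0r ?add0r//; move: K2; lia.
Qed.

(** The final pull costs the extra 1. Keeping [ln t] at the last pull, instead of [ln T], is what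
    makes arms dropped early cheap. *)
Lemma arm_regret k : (2 <= k <= K)%N -> (0 < ek k)%N -> exists t,
  [/\ (A j < t <= T)%N, tI tr i t = k & Dl k * (ek k)%:R <= 4 * alpha * (ln t%:R * x k) + 1].
Proof.
move=> hk e0; have [t [ht Ik hc]] : exists t, [/\ (A j < t <= T)%N, tI tr i t = k
    & (cn i t.-1 k).+1 = cn i T k] by apply: last_pull; move: e0; rewrite /ek; lia.
exists t; split=> //.
have ht' : (A j < t <= A N)%N by move: ht; lia.
have := late_pull hk ht' Ik.
have /andP[d0 d1] : 0 < Dl k <= 1 by apply: Dl_le1; lia.
have : (ek k)%:R <= (cn i t.-1 k)%:R + 1 :> R by rewrite natr1 ler_nat hc /ek; lia.
have : Dl k * x k = 1 by rewrite divff// gt_eqF.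
rewrite expr2; set c : R := (cn i t.-1 k)%:R; set e : R := (ek k)%:R; set a := 4 * alpha * _.
move=> h1 h2 h3.
apply: le_trans (_ : Dl k * (a * (x k * x k) + 1) <= _).
  by rewrite ler_pM2l//; lra.
have -> : Dl k * (a * (x k * x k) + 1) = (Dl k * x k) * (a * x k) + Dl k by ring.
by rewrite h1 mul1r /a !mulrA lerD2l.
Qed.

Lemma regret_all : \sum_(1 <= t < T.+1) (mu 1 - mu (tI tr i t))
  <= (A j)%:R + K%:R + 4 * alpha * (ln T%:R * \sum_(2 <= k < K.+1) x k).
Proof.
apply: (le_trans regret_split); rewrite -addrA lerD2l.
apply: le_trans (_ : \sum_(2 <= k < K.+1) (1 + 4 * alpha * (ln T%:R * x k)) <= _).
  rewrite big_nat [X in _ <= X]big_nat; apply: ler_sum => k hk.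
  have /andP[d0 d1] : 0 < Dl k <= 1 by apply: Dl_le1; lia.
  have x0 : 0 <= x k by rewrite invr_ge0 ltW.
  have l0 : 0 <= ln T%:R :> R.
    by have [->|T0] := posnP T; [rewrite ln0|rewrite ln_ge0// ler1n].
  have a0 := ltW alpha0.
  have [e0|e0] := posnP (ek k).
    by rewrite e0 mulr0 addr_ge0// !mulr_ge0.
  have [|t [/andP[t1 t2] _ ht]] := arm_regret _ e0; first by move: hk; lia.
  apply: (le_trans ht); rewrite addrC lerD2l ler_pM2l ?mulr_gt0//.
  by rewrite ler_wpM2r// ln_nat_le//; lia.
rewrite big_split /= -!mulr_sumr lerD2r sumr_const_nat ler_nat; lia.
Qed.

(** Selected terms grow by a factor [eta], and [e = eta / (eta - 1)] solves [e = 1 + e / eta]: a sum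
    bounded by [e] times its last selected term keeps this property when a term is added. *)
Lemma geometric_sum (a : nat -> R) (Q : pred nat) (c : R) M :
  1 < eta -> 0 <= c -> (forall p, (j1 < p < M)%N -> Q p -> 0 <= a p <= c) ->
  (forall p p', (j1 < p)%N -> (p < p' < M)%N -> Q p -> Q p' -> eta * a p <= a p') ->
  \sum_(j1.+1 <= p < M) (Q p)%:R * a p <= eta / (eta - 1) * c.
Proof.
move=> eta1 c0; set e := eta / (eta - 1).
have e0 : 0 < e by rewrite divr_gt0 ?subr_gt0//; apply: lt_trans eta1.
have eE : e = 1 + e / eta by rewrite /e; field; rewrite ?gt_eqF ?subr_gt0//; lra.
suff H : (forall p, (j1 < p < M)%N -> Q p -> 0 <= a p <= c) ->
  (forall p p', (j1 < p)%N -> (p < p' < M)%N -> Q p -> Q p' -> eta * a p <= a p') ->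
  \sum_(j1.+1 <= p < M) (Q p)%:R * a p = 0 \/
  exists2 q, (j1 < q < M)%N && Q q & \sum_(j1.+1 <= p < M) (Q p)%:R * a p <= e * a q.
  move=> h1 h2; case: (H h1 h2) => [->|[q /andP[hq Qq]]]; first by rewrite mulr_ge0// ltW.
  by move=> /le_trans; apply; rewrite ler_pM2l//; case/andP: (h1 q hq Qq).
elim: M => [|M IH] h1 h2; first by left; rewrite big_geq.
have [jM|Mj] := leqP j1.+1 M; last by left; rewrite big_geq//.
have := IH _ _; case => [p hp|p p' hp hp'||[q /andP[hq Qq] hs]].
- by apply: h1; lia.
- by apply: h2; lia.
- move=> s0; rewrite big_nat_recr//= s0 add0r.
  have [QM|_] := boolP (Q M); last by left; rewrite mul0r.
  right; exists M; first by rewrite QM jM ltnS leqnn.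
  rewrite mul1r ler_peMl//; first by have /andP[] := h1 M ltac:(lia) QM.
  by rewrite eE lerDl divr_ge0 ?ltW//; lra.
- right; rewrite big_nat_recr//=.
  have [QM|_] := boolP (Q M); last first.
    by exists q; [rewrite Qq andbT; lia|rewrite mul0r addr0].
  exists M; first by rewrite QM jM ltnS leqnn.
  rewrite mul1r [X in _ <= X * _]eE mulrDl mul1r addrC lerD2l; apply: (le_trans hs).
  have -> : e / eta * a M = e * (a M / eta) by rewrite mulrAC mulrA.
  rewrite ler_pM2l// ler_pdivlMr; last by lra.
  by rewrite mulrC; apply: h2 => //; lia.
Qed.

Lemma removal q J k : (q <= J)%N -> k \in tact tr i q -> k \notin tact tr i J ->
  exists2 p, (q <= p < J)%N & (k \in tact tr i p) && (k \notin tact tr i p.+1).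
Proof.
elim: J => [|J IH]; first by rewrite leqn0 => /eqP -> ->.
rewrite leq_eqVlt => /orP[/eqP <- -> //|]; rewrite ltnS => qJ kq kJ.
have [kJ'|/IH[]//] := boolP (k \in tact tr i J); first by exists J; rewrite ?kJ' ?kJ ?qJ ?ltnS//=.
by move=> p hp ?; exists p => //; lia.
Qed.

(** The cost of an arm is governed by the logarithm of its last pull. An arm active in phase [J.+1],
    which contains [T], is charged [ln T]; at most [S.+1] arms besides arm 1 are active there. Any
    other arm was expelled in some phase [p] after its last pull and is charged at most [ln (A p)].
    Expulsions up to [j1] go into the term with [ln (A j1)]; later ones are grouped by malicious
    sender and summed by [geometric_sum]. Both groups of charges are then spread over the arms by
    [knapsack]. *)
Lemma regret_blocked J : 1 < eta -> (A J < T <= A J.+1)%N -> (j <= j1)%N -> (A j < T)%N ->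
  (forall p, (j1 < p)%N -> (j <= lo p.+1)%N /\
     (A j)%:R + 1 + 4 * alpha * ln (A p.+1)%:R * x 2 ^+ 2 <= kap p.+1) ->
  (forall p p', (j1 < p)%N -> (up p.+1 < p')%N -> eta * ln (A p)%:R <= ln (A p')%:R) ->
  \sum_(1 <= t < T.+1) (mu 1 - mu (tI tr i t))
  <= (A j)%:R + K%:R + 4 * alpha * (K%:R * (x 2 * ln (A j1)%:R))
     + 4 * alpha * ln T%:R * (eta / (eta - 1) * (\sum_(2 <= k < (deg_mal adj i).+2) x k)
                       + \sum_(2 <= k < S.+3) x k).
Proof.
move=> eta1 hJ jj1 AjT Hp Hg; set L : R := ln T%:R; set e := eta / (eta - 1).
have e1 : 1 <= e by rewrite ler_pdivlMr; lra.
have T0 : (0 < T)%N by nlia.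
have L0 : 0 <= L by rewrite ln_ge0// ler1n.
have JN : (J < N)%N.
  rewrite ltnNge; apply/negP => h; have := A_le h; move: TN hJ; nlia.
have jJ : (j <= J)%N.
  rewrite leqNgt; apply/negP => h; have := A_le h; nlia.
have A1 p : (j <= p)%N -> (0 < A p)%N.
  by move=> /A_le; have := A_lt 0; have := A_le j0; nlia.
have a0 := ltW alpha0.
have x0 k : (2 <= k)%N -> 0 <= x k.
  by move=> k2; have /andP[h _] := Dl_le1 k2; rewrite invr_ge0 ltW.
pose rem p k := (k \in tact tr i p) && (k \notin tact tr i p.+1).
pose rmv p := has (rem p) (iota 1 K).
pose W k : R := \sum_(j1.+1 <= p < J.+1) (rem p k)%:R * ln (A p)%:R.
have lnA0 p : 0 <= ln (A p)%:R :> R.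
  by have [->|h] := posnP (A p); [rewrite ln0|rewrite ln_ge0// ler1n].
have W0 k : 0 <= W k by apply: sumr_ge0 => p _; rewrite mulr_ge0.
(* An arm may be expelled several times, so [W k] can exceed [L]; the minimum keeps the charge
   within the capacity of the knapsack. *)
have lk k : (2 <= k <= K)%N -> Dl k * (ek k)%:R <= 1 +
    4 * alpha * (L * (k \in tact tr i J.+1)%:R * x k + ln (A j1)%:R * x 2 + Num.min L (W k) * x k).
  move=> hk; have xk : 0 <= x k by apply: x0; nlia.
  have xk2 : x k <= x 2 by apply: Dl_le; nlia.
  have x2 : 0 <= x 2 by apply: x0.
  have m0 : 0 <= Num.min L (W k) by rewrite le_min L0 W0.
  have [ek0|ekp] := posnP (ek k).
    by rewrite ek0 mulr0 addr_ge0// mulr_ge0 ?mulr_ge0// !addr_ge0// !mulr_ge0.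
  have [t [/andP[t1 t2] Ik ht]] := arm_regret hk ekp; apply: (le_trans ht).
  rewrite addrC lerD2l ler_wpM2l ?mulr_ge0//.
  have lt0 : 0 <= ln t%:R :> R by rewrite ln_ge0// ler1n; nlia.
  have ltT : ln t%:R <= L by apply: ln_nat_le => //; nlia.
  have hlA := mulr_ge0 (lnA0 j1) x2.
  have hmx := mulr_ge0 m0 xk.
  have hLx : 0 <= L * (k \in tact tr i J.+1)%:R * x k by rewrite !mulr_ge0.
  have [kJ|kJ] := boolP (k \in tact tr i J.+1).
    rewrite mulr1; have := ler_wpM2r xk ltT; lra.
  have [|q [hq jq qN]] := @late_phase t; first by nlia.
  have kq : k \in tact tr i q.+1 by rewrite -Ik; exact: (ok_I Hok).
  have qJ : (q.+1 <= J.+1)%N.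
    rewrite ltnS leqNgt; apply/negP => h; have := A_le h; nlia.
  have [p hp remp] := removal qJ kq kJ.
  have tp : ln t%:R <= ln (A p)%:R :> R.
    have hqp : (A q.+1 <= A p)%N by apply: A_le; nlia.
    by apply: ln_nat_le; nlia.
  have [pj1|j1p] := leqP p j1.
    have tj : ln t%:R <= ln (A j1)%:R :> R.
      by apply: (le_trans tp); apply: ln_nat_le; [apply: A1; nlia|exact: A_le].
    have : ln t%:R * x k <= ln (A j1)%:R * x 2 by apply: ler_pM.
    rewrite mulr0 mul0r; lra.
  have tW : ln t%:R <= Num.min L (W k).
    rewrite le_min ltT /=; apply: (le_trans tp).
    rewrite /W (bigD1_seq p) ?iota_uniq//=; last by rewrite mem_index_iota; nlia.
    by rewrite /rem remp mul1r lerDl sumr_ge0// => s _; rewrite mulr_ge0.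
  have := ler_wpM2r xk tW; rewrite mulr0 mul0r; lra.
apply: (le_trans regret_split); rewrite -!addrA lerD2l.
apply: le_trans (_ : \sum_(2 <= k < K.+1) (1 +
    4 * alpha * (L * (k \in tact tr i J.+1)%:R * x k + ln (A j1)%:R * x 2 + Num.min L (W k) * x k)) <= _).
  rewrite big_nat [X in _ <= X]big_nat; apply: ler_sum => k hk; apply: lk; nlia.
rewrite big_split /= sumr_const_nat; apply: lerD; first by rewrite ler_nat; nlia.
rewrite -mulr_sumr -[X in _ <= _ + X]mulrA -mulrDr ler_wpM2l ?mulr_ge0//.
rewrite big_split /= big_split /= sumr_const_nat.
have hxle k l : (2 <= k <= l)%N -> x l <= x k by exact: Dl_le.
have S1 : \sum_(2 <= k < K.+1) L * (k \in tact tr i J.+1)%:R * x k <= L * \sum_(2 <= k < S.+3) x k.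
  apply: knapsack => //.
    by move=> k _; case: (k \in _); rewrite ?mulr1 ?mulr0 ?L0 ?lexx.
  rewrite -mulr_sumr ler_wpM2l// -natr_sum ler_nat.
  (* Arm 1 occupies one of the [S.+2] active places. *)
  have := sum_mem_le (tact tr i J.+1) 1 K.+1; rewrite (ok_size Hok).
  rewrite big_ltn; last by move: K2; nlia.
  by rewrite (Hact i (p := J.+1)) ?add1n//; nlia.
have S2 : ln (A j1)%:R * x 2 *+ (K.+1 - 2) <= K%:R * (x 2 * ln (A j1)%:R).
  rewrite -mulr_natl (mulrC (ln _)) ler_wpM2r ?ler_nat//; last by nlia.
  by rewrite mulr_ge0// x0.
suff S3 : \sum_(2 <= k < K.+1) Num.min L (W k) * x k <= e * L * \sum_(2 <= k < (deg_mal adj i).+2) x k.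
  move: S1 S2 S3; lra.
have eL0 : 0 <= e * L by rewrite mulr_ge0//; lra.
apply: knapsack => //.
  move=> k _; rewrite le_min L0 W0 /=; apply: le_trans (_ : L <= _); first by rewrite ge_min lexx.
  by rewrite ler_peMl.
have rem_rmv p : (0 < p)%N -> \sum_(2 <= k < K.+1) (rem p k)%:R <= (rmv p)%:R :> R.
  move=> p0; rewrite /rmv; case: hasP => [_|h].
    case: p p0 => // p _; have [y hy] := ok_rem Hok i p.
    apply: le_trans (_ : \sum_(2 <= k < K.+1) (k == y)%:R <= _).
      apply: ler_sum => k _; rewrite ler_nat.
      case: eqVneq => [_|ky]; first by case: (rem _ _).
      rewrite leqn0 eqb0.
      by apply/negP => /andP[h1 h2]; move: h2; rewrite hy.
    rewrite -natr_sum ler_nat; have := sum_mem_le [:: y] 2 K.+1.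
    by under eq_bigr do rewrite inE.
  rewrite big_nat big1// => k hk; case: (boolP (rem p k)) => // hr; exfalso; apply: h.
  by exists k => //; rewrite mem_iota; nlia.
pose mal := [set h in nbr adj i | (n <= h)%N].
(* Honest neighbours now recommend arm 1, which is already active, so only a malicious one can
   change the active set. *)
have rmvH p : (j1 < p < J.+1)%N -> rmv p -> exists h r, [/\ tH tr i p = Some h, h \in mal,
    tR tr i p = Some r & r \notin tact tr i p].
  move=> hp /hasP[k _ /andP[k1 k2]].
  have pj : (j <= p <= N)%N by nlia.
  case: p hp k1 k2 pj => // p hp k1 k2 pj.
  have [r Hr rn] : exists2 r, tR tr i p.+1 = Some r & r \notin tact tr i p.+1.
    case E : (tR tr i p.+1) => [r|]; last first.
      by move: k2; rewrite (ok_stay Hok) ?k1// => r; rewrite E.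
    exists r => //; apply/negP => hr; move: k2; rewrite (ok_stay Hok) ?k1//.
    by move=> r'; rewrite E => -[<-].
  have [h Hh] := ok_RH Hok Hr; exists h, r; split=> //.
  have [adjh _] := ok_H Hok Hh; rewrite !inE adjh /= leqNgt; apply/negP => hn.
  have hE : h = lshift m (Ordinal hn) by apply: val_inj.
  move: rn; rewrite hE in Hh; move: Hr; rewrite (ok_HR Hok Hh) => -[<-].
  by rewrite HB1// Hact.
have rmvL p : (j1 < p < J.+1)%N ->
   (rmv p)%:R * ln (A p)%:R <= \sum_(h in mal) ((tH tr i p == Some h) && rmv p)%:R * ln (A p)%:R :> R.
  move=> hp; case: (boolP (rmv p)) => hr; last first.
    by rewrite mul0r sumr_ge0// => h _; rewrite mulr_ge0.
  have [h [r [Hh hm _ _]]] := rmvH p hp hr.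
  rewrite (bigD1 h)//= Hh eqxx lerDl sumr_ge0// => h' _; by rewrite mulr_ge0.
apply: le_trans (_ : \sum_(2 <= k < K.+1) W k <= _).
  by apply: ler_sum => k _; rewrite ge_min lexx orbT.
rewrite /W exchange_big /=.
apply: le_trans (_ : \sum_(j1.+1 <= p < J.+1) \sum_(h in mal) ((tH tr i p == Some h) && rmv p)%:R * ln (A p)%:R <= _).
  rewrite big_nat [X in _ <= X]big_nat; apply: ler_sum => p hp; apply: le_trans (rmvL p hp).
  by rewrite -mulr_suml ler_wpM2r// rem_rmv//; nlia.
rewrite exchange_big /= /deg_mal -/mal mulr_natr -sumr_const; apply: ler_sum => h _.
apply: geometric_sum => //.
  move=> p hp _; rewrite lnA0 /=; apply: ln_nat_le; first by apply: A1; nlia.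
  have hpJ : (A p <= A J)%N by apply: A_le; nlia.
  by nlia.
move=> p p' hp hp' /andP[/eqP Hh hr] /andP[/eqP Hh' hr'].
have [h0 [r [Hh0 _ Hr rn]]] := rmvH p ltac:(nlia) hr.
rewrite Hh in Hh0; case: Hh0 => ?; subst h0.
(* Were the second expulsion caused by [h] within the ban earned by the first, [h] could not have
   been contacted. *)
apply: Hg => //; rewrite ltnNge; apply/negP => hup.
have Hb : blockat A kap lo tr i p.+1 h.
  have [Hlo Hk] := Hp p hp; split; [by nlia|exact: Hh|exists r; split=> //].
    apply: le_trans Hk.
    have p0 : (0 < p)%N by nlia.
    have hr2 : r \in tact tr i p.+1 by case: (p) p0 Hr => // p'' _ /(ok_new Hok).
    have rv := ok_valid Hok hr2.
    have r1 : r != 1%N by apply: contraNneq rn => ->; apply: Hact; nlia.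
    have r2 : (2 <= r <= K)%N by nlia.
    (* Either [r] has not been pulled since phase [j] and has at most [A j] samples, or its last
       pull gives the logarithmic bound. *)
    have [hle|hlt] := leqP (cn i (A p.+1) r) (cn i (A j) r).
      rewrite -addrA; apply: le_trans (_ : (A j)%:R <= _).
        by rewrite ler_nat; apply: leq_trans hle _; exact: cnt_le_time.
      by rewrite lerDl addr_ge0// !mulr_ge0// ?x0// sqr_ge0.
    have [t [ht Ik hc]] := last_pull hlt.
    have pN : (A p.+1 <= A N)%N by apply: A_le; nlia.
    have ht' : (A j < t <= A N)%N by nlia.
    have := late_pull r2 ht' Ik; rewrite -hc -natr1 => hl.
    apply: le_trans (_ : 4 * alpha * ln t%:R * x r ^+ 2 + 1 <= _); first by lra.
    have xr0 : 0 <= x r by apply: x0; nlia.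
    have : 4 * alpha * ln t%:R * x r ^+ 2 <= 4 * alpha * ln (A p.+1)%:R * x 2 ^+ 2.
      have lt0 : 0 <= ln t%:R :> R by rewrite ln_ge0// ler1n; nlia.
      apply: ler_pM; rewrite ?mulr_ge0 ?sqr_ge0//.
        by rewrite ler_wpM2l ?mulr_ge0// ln_nat_le//; nlia.
      by rewrite !expr2; apply: ler_pM => //; apply: hxle; nlia.
    have : 0 <= (A j)%:R :> R by []. 
    lra.
  by move=> j' hj'; rewrite !HB1//; nlia.
have : h \in tblk tr i p'.
  case: (p') hp' hup => // p'' hp' hup; apply/(ok_blk Hok); exists p.+1 => //; nlia.
case: (p') hp' Hh' => // p'' hp' Hh'.
by have [_ /negP] := ok_H Hok Hh'.
Qed.

End Regret.
End Deterministic.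

(** * The simulator produces admissible runs *)

Lemma choose_tb_in tb cand : cand != [::] -> choose_tb tb cand \in cand.
Proof.
by rewrite /choose_tb; case: ifP => // _; case: cand => // a l _ /=; rewrite inE eqxx.
Qed.

Lemma ohead_mem (T : eqType) (s : seq T) x : ohead s = Some x -> x \in s.
Proof. by case: s => //= a s [->]; rewrite inE eqxx. Qed.

Lemma argmax_seqP (R : realType) (f : nat -> R) s k :
  reflect (k \in s /\ forall k', k' \in s -> f k' <= f k) (k \in argmax_seq f s).
Proof.
rewrite mem_filter; apply: (iffP andP) => [[/allP h ks]|[ks h]]; first by split.
by split=> //; apply/allP.
Qed.

Lemma argmax_seq_neq0 (R : realType) (f : nat -> R) s : s != [::] -> argmax_seq f s != [::].
Proof.
move=> s0; suff [k hk] : exists k, k \in argmax_seq f s by case: argmax_seq hk.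
elim: s s0 => // a [_ _|b s /(_ isT)[k /argmax_seqP[ks hk]] _].
  exists a; apply/argmax_seqP; split; first by rewrite inE.
  by move=> k'; rewrite inE => /eqP ->.
have [h|h] := leP (f a) (f k).
  exists k; apply/argmax_seqP; split; first by rewrite inE ks orbT.
  by move=> k'; rewrite inE => /orP[/eqP ->|/hk].
exists a; apply/argmax_seqP; split; first by rewrite inE eqxx.
move=> k'; rewrite inE => /orP[/eqP ->//|/hk hk']; exact: le_trans hk' (ltW h).
Qed.

Section Simulation.
Context {R : realType} {n m : nat}.
Variables (c : config R n m) (w : realiz R n m).
Let A := phaseA (c_beta c).
Hypothesis A_lt : forall j, (A j < A j.+1)%N.
(** The maximum with 1 keeps phase 0, in which no arm is recorded, out of the constancy test. *)
Definition loph j := maxn 1 (Num.truncn (theta (c_rho1 c) j)).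
Definition upph j := ceiln (j%:R `^ c_eta c).
Definition kapph := kappa (c_rho2 c) (c_K c) (c_S c).

(** State of [i] after [s] pulls of phase [j.+1]; [sim] itself exposes only the ends of phases. *)
Definition stp i j s := foldl (pull_step c w i) (sim c w j i) (iota (A j).+1 s).

Definition pick_arm i (st : astate R (n+m)) t :=
  let act := active c i st in
  let unp := [seq k <- act | a_cnt st k == 0%N] in
  choose_tb (r_tbI w i t)
    (if unp is [::] then argmax_seq (ucb (c_alpha c) st t) act else unp).

Definition tsum i t k : R := \sum_(1 <= s < t.+1) (arm_at c w i s == k)%:R * r_x w i s k.

(** The active set of phase [j] is the one left by phase [j.-1]. Means are rebuilt from the arm
    sequence so that they make sense inside a phase. *)
Definition sim_trace : trace R n m := {|
  tI := arm_at c w;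
  tmh := fun i t k => tsum i t k / (count (pred1 k) [seq arm_at c w i s | s <- iota 1 t])%:R;
  tact := fun i j => active c i (sim c w j.-1 i);
  tB := fun i j => a_B (sim c w j i) j;
  tH := fun i j => a_H (sim c w j i) j;
  tR := fun i j => a_R (sim c w j i) j;
  tblk := fun i j => a_blk (sim c w j i) j |}.

Lemma stpS i j s : stp i j s.+1 = pull_step c w i (stp i j s) (A j + s).+1.
Proof. by rewrite /stp -(addn1 s) iotaD foldl_cat. Qed.

Lemma stp_same i j s : [/\ a_U (stp i j s) = a_U (sim c w j i), a_L (stp i j s) = a_L (sim c w j i),
  a_B (stp i j s) = a_B (sim c w j i), a_H (stp i j s) = a_H (sim c w j i) &
  [/\ a_R (stp i j s) = a_R (sim c w j i), a_blk (stp i j s) = a_blk (sim c w j i) &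
      a_cnt0 (stp i j s) = a_cnt0 (sim c w j i)]].
Proof.
by elim: s => [|s IH]; [|rewrite stpS /pull_step /=; move: IH; rewrite /stp].
Qed.

Lemma active_stp i j s : active c i (stp i j s) = active c i (sim c w j i).
Proof. by have [h1 h2 _ _ _] := stp_same i j s; rewrite /active h1 h2. Qed.

Lemma pull_stp i j s t : a_pull (stp i j s) t =
  if (A j < t <= A j + s)%N then pick_arm i (stp i j (t - (A j).+1)) t
  else a_pull (sim c w j i) t.
Proof.
elim: s => [|s IH].
  by rewrite /stp /=; case: ifP => //; lia.
rewrite stpS /= /upd; case: eqVneq => [->|ts].
  rewrite ltnS leq_addr addnS leqnn /= subSS addKn; exact: erefl.
rewrite IH; congr (if _ then _ else _); move: ts; lia.
Qed.

Lemma phase_gap j : (A j + (A j.+1 - A j) = A j.+1)%N.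
Proof. by rewrite subnKC// ltnW. Qed.

Lemma phaseA_ge j : (j <= A j)%N.
Proof. by elim: j => // j IH; apply: leq_ltn_trans IH (A_lt _). Qed.

Lemma phaseA_le i j : (i <= j)%N -> (A i <= A j)%N.
Proof. by apply: (homo_leq (leqnn) (leq_trans)) => x; exact: ltnW. Qed.

Lemma simS i j : sim c w j.+1 i = end_phase c w i j.+1 (stp i j (A j.+1 - A j))
  (fun i => compB c w i j.+1 (stp i j (A j.+1 - A j))).
Proof. by []. Qed.

Lemma pull_sim i j j' t : (A j < t <= A j.+1)%N -> (j < j')%N ->
  a_pull (sim c w j' i) t = pick_arm i (stp i j (t - (A j).+1)) t.
Proof.
move=> ht; elim: j' => // j' IH; rewrite ltnS leq_eqVlt => /orP[/eqP <-|jj'].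
  by rewrite simS /= pull_stp phase_gap ht.
rewrite simS /= pull_stp phase_gap IH// ifF//.
have := phaseA_le jj'; lia.
Qed.

Lemma arm_atE i j t : (A j < t <= A j.+1)%N ->
  arm_at c w i t = pick_arm i (stp i j (t - (A j).+1)) t.
Proof.
by move=> ht; apply: pull_sim => //; have := phaseA_ge j; lia.
Qed.

Notation cn := (cnt sim_trace).

Lemma tsumS i t k : tsum i t.+1 k = tsum i t k + (arm_at c w i t.+1 == k)%:R * r_x w i t.+1 k.
Proof. by rewrite /tsum big_nat_recr. Qed.

Lemma cntS' i t k : cn i t.+1 k = (cn i t k + (arm_at c w i t.+1 == k))%N.
Proof. by rewrite /cnt -[in LHS](addn1 t) iotaD map_cat count_cat /= addn0 add1n. Qed.

Lemma sim_cnt_aux i j : (a_cnt (sim c w j i) =1 cn i (A j)) -> (a_sum (sim c w j i) =1 tsum i (A j)) ->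
  forall s, (s <= A j.+1 - A j)%N -> (a_cnt (stp i j s) =1 cn i (A j + s)) /\
    (a_sum (stp i j s) =1 tsum i (A j + s)).
Proof.
move=> h1 h2; elim=> [|s IH] hs; first by rewrite addn0.
have {}IH := IH (ltnW hs); case: IH => IH1 IH2.
have pE : arm_at c w i (A j + s).+1 = pick_arm i (stp i j s) (A j + s).+1.
  rewrite (@arm_atE i j); last by have := A_lt j; lia.
  by rewrite subSS addKn.
split=> k; rewrite stpS addnS /= -/(pick_arm i (stp i j s) (A j + s).+1) -pE.
  rewrite cntS' /upd eq_sym; case: eqVneq => [<-|_]; first by rewrite IH1 addn1.
  by rewrite IH1 addn0.
rewrite tsumS /upd eq_sym; case: eqVneq => [<-|_]; first by rewrite IH2 mul1r.
by rewrite IH2 mul0r addr0.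
Qed.

Lemma sim_cnt i j : (a_cnt (sim c w j i) =1 cn i (A j)) /\ (a_sum (sim c w j i) =1 tsum i (A j)).
Proof.
elim: j => [|j [IH1 IH2]].
  by split=> k //=; rewrite /tsum big_geq.
have := sim_cnt_aux IH1 IH2 (leqnn _); rewrite phase_gap => -[h1 h2].
by rewrite simS.
Qed.

Lemma stp_cnt i j s : (s <= A j.+1 - A j)%N ->
  (a_cnt (stp i j s) =1 cn i (A j + s)) /\ (a_sum (stp i j s) =1 tsum i (A j + s)).
Proof. by have [h1 h2] := sim_cnt i j; exact: sim_cnt_aux. Qed.

Lemma sim_cnt0 i j : a_cnt0 (sim c w j i) =1 cn i (A j).
Proof.
case: j => [|j] k //; rewrite simS /=.
by have [h _] := stp_cnt i (leqnn (A j.+1 - A j)); rewrite h phase_gap.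
Qed.

Lemma phase_pullsE i j k : phase_pulls (stp i j (A j.+1 - A j)) k = (pp A sim_trace i j.+1 k)%:R :> R.
Proof.
rewrite /phase_pulls /pp /=; have [h _] := stp_cnt i (leqnn (A j.+1 - A j)).
by have [_ _ _ _ [_ _ ->]] := stp_same i j (A j.+1 - A j); rewrite h phase_gap sim_cnt0.
Qed.

Lemma simB_stable i j j' : (j <= j')%N -> a_B (sim c w j' i) j = a_B (sim c w j i) j.
Proof.
elim: j' => [|j' IH]; first by rewrite leqn0 => /eqP ->.
rewrite leq_eqVlt => /orP[/eqP -> //|]; rewrite ltnS => jj'.
rewrite simS /= /upd ltn_eqF ?ltnS//.
by have [_ _ -> _ _] := stp_same i j' (A j'.+1 - A j'); exact: IH.
Qed.

Lemma tBE i j : tB sim_trace i j.+1 = compB c w i j.+1 (stp i j (A j.+1 - A j)).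
Proof. by rewrite /= /upd eqxx. Qed.

Lemma active_neq0 i st : active c i st != [::].
Proof. by rewrite /active; case: (c_sticky c i). Qed.

Lemma tB_argmax i j : tB sim_trace i j.+1 \in
  argmax_seq (phase_pulls (stp i j (A j.+1 - A j))) (active c i (sim c w j i)).
Proof.
rewrite tBE /compB active_stp; apply: choose_tb_in; apply: argmax_seq_neq0; exact: active_neq0.
Qed.

Lemma pick_arm_cases i st t : let k := pick_arm i st t in
  (k \in active c i st) /\
  ((0 < a_cnt st k)%N -> forall k', k' \in active c i st -> (0 < a_cnt st k')%N /\
     ucb (c_alpha c) st t k' <= ucb (c_alpha c) st t k).
Proof.
rewrite /pick_arm; set unp := [seq _ <- _ | _]; case E : unp => [|a l].
  have /argmax_seqP[h1 h2] := choose_tb_in (r_tbI w i t)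
    (argmax_seq_neq0 (ucb (c_alpha c) st t) (active_neq0 i st)).
  split=> // _ k' hk'; split; last exact: h2.
  rewrite lt0n; apply/negP => h0; suff: k' \in unp by rewrite E.
  by rewrite mem_filter h0.
have := @choose_tb_in (r_tbI w i t) (a :: l) isT; rewrite -E mem_filter => /andP[/eqP h1 h2].
by split=> //; rewrite h1.
Qed.

Definition phase_end i j := stp i j (A j.+1 - A j).

Definition choose_H i j := ohead [seq h <- [seq r_sg w i j p | p <- enum 'I_(n+m)]
   | h \in [set h | c_adj c (lshift m i) h & h \notin a_blk (sim c w j i) j]].

Lemma tHE i j : tH sim_trace i j.+1 = choose_H i j.+1.
Proof. by rewrite /= /upd eqxx. Qed.

Lemma tRE i j : tR sim_trace i j.+1 = match tH sim_trace i j.+1 with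
  | None => None
  | Some h => Some (match @insub nat (fun x => (x < n)%N) 'I_n (val h) with
                              | Some h' => tB sim_trace h' j.+1
                              | None => let r := r_adv w i j.+1 in
                                        if (1 <= r <= c_K c)%N then r else 1%N
                              end) end.
Proof.
rewrite /= /upd !eqxx; by case: (ohead _).
Qed.

Lemma tactE i j : tact sim_trace i j.+2 = match tR sim_trace i j.+1 with
  | Some r => if r \in tact sim_trace i j.+1 then tact sim_trace i j.+1
     else c_sticky c i ++ [:: choose_tb (r_tbU w i j.+1) (argmax_seq (phase_pulls (phase_end i j))
             [:: a_U (sim c w j i); a_L (sim c w j i)]); r]
  | None => tact sim_trace i j.+1 end.
Proof.
rewrite /tact /sim_trace /= {1}/active /=.
have [hU hL _ _ _] := stp_same i j (A j.+1 - A j).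
rewrite -/(phase_end i j) in hU hL *; rewrite /upd eqxx.
have -> : run_pulls c w i j.+1 (sim c w j i) = phase_end i j by [].
have hact : active c i (phase_end i j) = active c i (sim c w j i) by rewrite /active hU hL.
rewrite hact hU hL.
case: (match ohead _ with Some _ => _ | None => _ end) => [r|] //.
by case: ifP.
Qed.

Hypothesis K1 : (1 <= c_K c)%N.
Hypothesis Hsticky : forall i, size (c_sticky c i) = c_S c /\
  all (fun k => (1 <= k <= c_K c)%N) (c_sticky c i).
Hypothesis HUL : forall i, (1 <= c_U1 c i <= c_K c)%N /\ (1 <= c_L1 c i <= c_K c)%N.

Lemma sim_valid i j k : k \in tact sim_trace i j.+1 -> (1 <= k <= c_K c)%N.
Proof.
elim: j i k => [|j IH] i k.
  have [[_ /allP hs] [hU hL]] := (Hsticky i, HUL i).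
  by rewrite /= /active /= mem_cat !inE => /orP[/hs|/orP[]/eqP ->].
rewrite tactE; case E : (tR _ _ _) => [r|]; last exact: IH.
case: ifPn => hr; first exact: IH.
have [_ /allP hs] := Hsticky i.
rewrite mem_cat !inE => /orP[/hs//|/orP[/eqP ->|/eqP ->]].
  have /argmax_seqP[h _] := choose_tb_in (r_tbU w i j.+1)
     (@argmax_seq_neq0 _ (phase_pulls (phase_end i j)) [:: a_U (sim c w j i); a_L (sim c w j i)] isT).
  by apply: (IH i); rewrite /= /active mem_cat h orbT.
move: E; rewrite tRE; case: (tH _ _ _) => // h [].
case: insub => [h'|] <-.
  by apply: (IH h'); have /argmax_seqP[] := tB_argmax h' j.
by case: ifP => //; rewrite leqnn K1.
Qed.

(** A ban is written at once into all the phases it covers, so the induction on [j] keeps [p] free;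
    [p = j] is the form required by [ok_blk]. *)
Lemma sim_blk i j p h : h \in a_blk (sim c w j i) p <->
  exists2 j0, (j0 <= j)%N && (j0 <= p <= upph j0)%N & blockat A kapph loph sim_trace i j0 h.
Proof.
elim: j => [|j IH].
  rewrite /= inE; split=> // -[j0 /andP[]]; rewrite leqn0 => /eqP -> _ [] //.
rewrite simS /= /new_blk.
have [_ _ hB hH [hR hblk _]] := stp_same i j (A j.+1 - A j).
have [hc _] := stp_cnt i (leqnn (A j.+1 - A j)); rewrite phase_gap in hc.
have BE j' : (j' < j.+1)%N -> a_B (stp i j (A j.+1 - A j)) j' = tB sim_trace i j'.
  by rewrite ltnS hB => h1; rewrite simB_stable.
set Bj := compB _ _ _ _ _; have BjE : Bj = tB sim_trace i j.+1 by rewrite tBE.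
have key : blockat A kapph loph sim_trace i j.+1 h <->
  exists r, [/\ a_R (stp i j (A j.+1 - A j)) j = Some r, a_H (stp i j (A j.+1 - A j)) j = Some h &
   [&& (1 < j.+1)%N, (a_cnt (stp i j (A j.+1 - A j)) r)%:R <= kapph j.+1
           & all (fun j' => a_B (stp i j (A j.+1 - A j)) j' == Bj) (iota (loph j.+1) (j.+1 - loph j.+1))]].
  rewrite hR hH; split=> [[j1 h1 [r [h2 h3 h4]]]|[r [h1 h2 /and3P[h3 h4 /allP h5]]]].
    exists r; split=> //; apply/and3P; split=> //; first by rewrite hc.
    by apply/allP => j'; rewrite mem_iota => hj'; rewrite BE ?BjE ?h4//; lia.
  split=> //; exists r; split=> //; first by rewrite -hc.
  move=> j' hj'; have := h5 j'; rewrite mem_iota BE; last by lia.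
  by rewrite -BjE => /(_ ltac:(lia))/eqP.
have split_ex : (exists2 j0, (j0 <= j.+1)%N && (j0 <= p <= upph j0)%N & blockat A kapph loph sim_trace i j0 h)
   <-> (h \in a_blk (sim c w j i) p) \/ ((j.+1 <= p <= upph j.+1)%N /\ blockat A kapph loph sim_trace i j.+1 h).
  split=> [[j0 /andP[]]|[/IH[j0 /andP[h1 h2] h3]|[h1 h2]]].
  - rewrite leq_eqVlt => /orP[/eqP -> h1 h2|h0 h1 h2]; first by right.
    by left; apply/IH; exists j0 => //; rewrite -ltnS h0.
  - by exists j0 => //; rewrite h2 andbT ltnW.
  - by exists j.+1 => //; rewrite leqnn.
rewrite split_ex key -hblk.
case ER : (a_R _ j) => [r|]; last by split; [left|case=> // -[_ [r []]]].
case EH : (a_H _ j) => [h'|]; last by split; [left|case=> // -[_ [r' []]]].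
rewrite -/kapph -/(loph j.+1); case: ifPn => hcond; last first.
  split; [by left|case=> // -[_ [r' [[<-] _ h1]]]].
  by rewrite h1 in hcond.
rewrite -/(upph j.+1); case: ifPn => hp.
  rewrite in_setU1; split=> [/orP[/eqP hh|]|[->|[_ [r' [_ [->] _]]]]].
  - by right; split=> //; exists r; rewrite hh.
  - by left.
  - by rewrite orbT.
  - by rewrite eqxx.
by split; [left|case=> // -[]].
Qed.

Lemma sim_trace_ok : trace_ok A (c_K c) (c_S c) (c_alpha c) (c_adj c) kapph loph upph sim_trace.
Proof.
split.
- move=> i j t ht /=; rewrite (arm_atE _ ht) -(active_stp i j (t - (A j).+1)).
  by case: (pick_arm_cases i (stp i j (t - (A j).+1)) t).
- move=> i j t k ht hk; rewrite /bonus /= (arm_atE _ ht).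
  set st := stp _ _ _; have [_ h] := pick_arm_cases i st t.
  have hs : (t - (A j).+1 <= A j.+1 - A j)%N by lia.
  have [h1 h2] := stp_cnt i hs.
  have tE : (A j + (t - (A j).+1) = t.-1)%N by lia.
  rewrite tE -/st in h1 h2.
  rewrite -!h1 => /h/(_ k); rewrite active_stp => /(_ hk)[-> h3]; split=> //.
  by move: h3; rewrite /ucb !h1 !h2.
- by move=> i j; rewrite /= /active size_cat addn2; have [-> _] := Hsticky i.
- exact: sim_valid.
- by move=> i j; have /argmax_seqP[] := tB_argmax i j.
- move=> i j k hk; have /argmax_seqP[_ h] := tB_argmax i j.
  by have := h k hk; rewrite !phase_pullsE ler_nat.
- move=> i j h; rewrite tactE; case E : (tR _ _ _) => [r|] //.
  by rewrite h.
- move=> i j r E; rewrite tactE E; case: ifPn => // _.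
  by rewrite mem_cat !inE eqxx !orbT.
(* A sticky most played arm survives by itself; otherwise it belongs to the pair [U], [L], and the
   survivor of the pair is played at least as much. *)
- move=> i j; have /argmax_seqP[h1 h2] := tB_argmax i j; rewrite tactE.
  have triv : exists u, [/\ u \in tact sim_trace i j.+1, u \in tact sim_trace i j.+1
    & (pp A sim_trace i j.+1 (tB sim_trace i j.+1) <= pp A sim_trace i j.+1 u)%N].
    by exists (tB sim_trace i j.+1).
  case: (tR _ _ _) => [r|] //; case: ifPn => // hr.
  have /argmax_seqP[h3 h4] := choose_tb_in (r_tbU w i j.+1)
     (@argmax_seq_neq0 _ (phase_pulls (phase_end i j)) [:: a_U (sim c w j i); a_L (sim c w j i)] isT).
  move: h1; rewrite /active mem_cat => /orP[hs|hUL].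
    exists (tB sim_trace i j.+1); split=> //; first by rewrite /= /active mem_cat hs.
    by rewrite mem_cat hs.
  set u := choose_tb _ _ in h3 h4 *; exists u; split.
  + by rewrite /= /active mem_cat h3 orbT.
  + by rewrite mem_cat !inE eqxx orbT.
  + by have := h4 _ hUL; rewrite !phase_pullsE ler_nat.
- move=> i j; rewrite tactE.
  case: (tR _ _ _) => [r|]; last by exists 0%N.
  case: ifPn => hr; first by exists 0%N.
  have /argmax_seqP[h3 h4] := choose_tb_in (r_tbU w i j.+1)
     (@argmax_seq_neq0 _ (phase_pulls (phase_end i j)) [:: a_U (sim c w j i); a_L (sim c w j i)] isT).
  set u := choose_tb _ _ in h3 h4 *.
  exists (if u == a_U (sim c w j i) then a_L (sim c w j i) else a_U (sim c w j i)) => k.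
  rewrite /= /active !mem_cat => /orP[->//|]; move: h3; rewrite !inE.
  by case: eqVneq => [->|hu] /=; [move=> _ /orP[->|->]//; rewrite orbT
     |move=> /eqP -> /orP[->//|->]]; rewrite ?orbT.
- move=> i j h; rewrite tHE /choose_H => E.
  have : h \in [seq h <- [seq r_sg w i j.+1 p | p <- enum 'I_(n+m)]
     | h \in [set h | c_adj c (lshift m i) h & h \notin a_blk (sim c w j.+1 i) j.+1]].
    exact: ohead_mem.
  by rewrite mem_filter inE => /andP[/andP[]].
- move=> i j i' E; rewrite tRE E; case: insubP => [u _ hu|]; last by rewrite /= ltn_ord.
  by rewrite (_ : u = i')//; apply: val_inj.
- move=> i j r; rewrite tRE; case: (tH _ _ _) => // h _; by exists h.
- move=> i j h; split=> [/sim_blk[j0 /andP[_ h1] h2]|[j0 /andP[h1 h2] h3]]; first by exists j0.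
  by apply/sim_blk; exists j0 => //; rewrite h1 h2.
Qed.

End Simulation.

(** * Rumor spreading *)

Section FirstAvailable.
Variable N : nat.

(** A uniform ordering does not depend on the available set [V], which is determined by the past;
    the dependence sits in this function only. *)
Definition first_in (V : {set 'I_N}) (s : {perm 'I_N}) : option 'I_N :=
  ohead [seq h <- [seq s p | p <- enum 'I_N] | h \in V].

Lemma first_in_mem V s h : first_in V s = Some h -> h \in V.
Proof. by move/ohead_mem; rewrite mem_filter => /andP[]. Qed.

Lemma first_in_some V s : V != finset.set0 -> exists2 h, h \in V & first_in V s = Some h.
Proof.
case/set0Pn => x xV; case E : (first_in V s) => [h|]; first by exists h => //; exact: first_in_mem E.
have : x \in [seq h <- [seq s p | p <- enum 'I_N] | h \in V].
  by rewrite mem_filter xV; apply/mapP; exists ((s^-1)%g x); rewrite ?mem_enum// permKV.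
by move: E; rewrite /first_in; case: [seq _ <- _ | _].
Qed.

Lemma first_in_tperm (V : {set 'I_N}) (s : {perm 'I_N}) (a b : 'I_N) : a \in V -> b \in V ->
  first_in V (s * tperm a b)%g = omap (tperm a b) (first_in V s).
Proof.
move=> aV bV; rewrite /first_in.
have -> : [seq (s * tperm a b)%g p | p <- enum 'I_N] = map (tperm a b) [seq s p | p <- enum 'I_N].
  by elim: (enum 'I_N) => //= p l ->; rewrite permM.
elim: [seq s p | p <- enum 'I_N] => //= x l IH.
have -> : (tperm a b x \in V) = (x \in V) by case: tpermP => // ->; rewrite aV bV.
by case: ifP.
Qed.

(** Composing with the transposition of [h] and [b] exchanges the orderings that select [h] with
    those that select [b], so the [#|V|] classes have equal size. *)
Lemma card_first_in (V : {set 'I_N}) (h : 'I_N) : h \in V -> (#|[set s | first_in V s == Some h]| * #|V| = N`!)%N.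
Proof.
move=> hV.
have E b : b \in V -> #|[set s | first_in V s == Some b]| = #|[set s | first_in V s == Some h]|.
  move=> bV; rewrite -(card_imset _ (mulIg (tperm h b))); apply: eq_card => s.
  rewrite inE; apply/imsetP/eqP => [[s']|hs].
    by rewrite inE => /eqP hs ->; rewrite first_in_tperm// hs /= tpermR.
  exists (s * tperm h b)%g; last by rewrite -mulgA tperm2 mulg1.
  by rewrite inE first_in_tperm// hs /= tpermL.
have -> : N`! = #|{: {perm 'I_N}}| by rewrite -(card_Sn N).
rewrite -[RHS]sum1_card (partition_big (first_in V) (fun o => [exists b in V, o == Some b])) /=; last first.
  move=> s _; have [|b bV ->] := @first_in_some V s; first by apply/set0Pn; exists h.
  by apply/existsP; exists b; rewrite bV eqxx.
rewrite (reindex_onto Some (odflt h)) /=; last first.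
  by move=> [b|] /existsP[b' /andP[]].
rewrite (eq_bigl (fun b => b \in V)); last first.
  move=> b; rewrite eqxx andbT; apply/existsP/idP => [[b' /andP[b'V /eqP[->]]]//|bV].
  by exists b; rewrite bV eqxx.
rewrite (eq_bigr (fun=> #|[set s | first_in V s == Some h]|)); last first.
  by move=> b bV; rewrite -(E b bV) -[RHS]sum1_card; apply: eq_bigl => s; rewrite !inE.
by rewrite sum_nat_const mulnC.
Qed.

Lemma prob_first_in (R : realType) (V : {set 'I_N}) (h : 'I_N) : h \in V ->
  \sum_(s : {perm 'I_N}) ((N`!)%:R^-1 * (first_in V s == Some h)%:R) = (#|V|%:R)^-1 :> R.
Proof.
move=> hV; rewrite -mulr_sumr -natr_sum.
have -> : (\sum_(s : {perm 'I_N}) (first_in V s == Some h) = #|[set s | first_in V s == Some h]|)%N.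
  by rewrite -sum1_card big_mkcond [RHS]big_mkcond /=; apply: eq_bigr => s _; rewrite inE; case: eqP.
have V0 : #|V|%:R != 0 :> R.
  by rewrite pnatr_eq0 -lt0n; apply/card_gt0P; exists h.
have := card_first_in hV => /(congr1 (fun k => k%:R : R)); rewrite natrM => <-.
have c0 : #|[set s | first_in V s == Some h]|%:R != 0 :> R.
  have := card_first_in hV; rewrite pnatr_eq0; case: #|_| => [|//].
  by rewrite mul0n => /esym/eqP; rewrite gtn_eqF// fact_gt0.
by rewrite invfM mulrAC mulVf// mul1r.
Qed.

End FirstAvailable.

(** * Random sets with independent memberships *)

Section Bernoulli.
Context {R : realType} {n : nat}.

(** Expectation of [G] at a random set that contains each [i] independently with probability
    [p i]. *)
Definition bern (p : 'I_n -> R) (G : {set 'I_n} -> R) : R :=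
  \sum_(B : {set 'I_n}) G B * \prod_i (if i \in B then p i else 1 - p i).

Lemma product_bern (C : finType) (om : 'I_n -> C -> R) (be : 'I_n -> C -> bool) (G : {set 'I_n} -> R) :
  (forall i, \sum_c om i c = 1) ->
  \sum_(f : {ffun 'I_n -> C}) (\prod_i om i (f i)) * G [set i | be i (f i)] =
  bern (fun i => \sum_(c | be i c) om i c) G.
Proof.
move=> om1; rewrite /bern.
rewrite (partition_big (fun f : {ffun 'I_n -> C} => [set i | be i (f i)]) predT) //=.
apply: eq_bigr => B _.
rewrite (eq_bigr (fun f : {ffun 'I_n -> C} => (\prod_i om i (f i)) * G B)); last first.
  by move=> f /eqP ->.
rewrite -mulr_suml mulrC; congr (_ * _).
transitivity (\prod_i \sum_(c | be i c == (i \in B)) om i c).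
  rewrite bigA_distr_big_dep /=; apply: eq_bigl => f.
  apply/eqP/familyP => [<- i|h]; first by rewrite unfold_in /= inE.
  by apply/setP => i; have := h i; rewrite unfold_in /= inE => /eqP.
apply: eq_bigr => i _; case: ifPn => iB; first by apply: eq_bigl => c; rewrite eqb_id.
rewrite -(om1 i) [X in _ = X - _](bigID (be i)) /= addrAC subrr add0r.
by apply: eq_bigl => c; rewrite eqbF_neg.
Qed.

(** Pairing [B] with [B :\ a], the difference of the two sides is [p a - p' a] times a nonnegative
    combination of the differences [G (B :\ a) - G B]. *)
Lemma bern_step (p p' : 'I_n -> R) (G : {set 'I_n} -> R) (a : 'I_n) :
  (forall i, 0 <= p i <= 1) -> (forall i, i != a -> p i = p' i) -> p' a <= p a ->
  (forall B B' : {set 'I_n}, B \subset B' -> G B' <= G B) -> bern p G <= bern p' G.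
Proof.
move=> p01 peq pa Gd; rewrite -subr_ge0 /bern -sumrB.
pose wa (B : {set 'I_n}) := \prod_(i | i != a) (if i \in B then p i else 1 - p i).
have E B : G B * (\prod_i (if i \in B then p' i else 1 - p' i)) - G B * (\prod_i (if i \in B then p i else 1 - p i))
   = (p a - p' a) * (G B * wa B * (if a \in B then -1 else 1)).
  rewrite (bigD1 a)//= [X in _ - _ * X](bigD1 a)//=.
  have -> : \prod_(i < n | i != a) (if i \in B then p' i else 1 - p' i) = wa B.
    by apply: eq_bigr => i ia; rewrite peq.
  rewrite -/(wa B); case: ifP => _; ring.
under eq_bigr do rewrite E.
rewrite -mulr_sumr mulr_ge0 ?subr_ge0//.
rewrite (bigID (fun B : {set 'I_n} => a \in B)) /= addrC.
have E2 (F : {set 'I_n} -> R) : \sum_(B : {set 'I_n} | a \notin B) F B = \sum_(B : {set 'I_n} | a \in B) F (B :\ a).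
  rewrite (reindex_onto (fun B => B :\ a) (fun B => a |: B)) /=; last first.
    by move=> B aB; rewrite finset.setU1K.
  apply: eq_bigl => B; rewrite !inE eqxx /=; apply/eqP/idP => [<-|aB]; first by rewrite !inE eqxx.
  by rewrite finset.setD1K.
rewrite E2.
rewrite -big_split /=; apply: sumr_ge0 => B aB; rewrite aB !inE eqxx /=.
have -> : wa (B :\ a) = wa B by apply: eq_bigr => i ia; rewrite !inE ia.
have w0 : 0 <= wa B.
  by apply: prodr_ge0 => i _; have /andP[h1 h2] := p01 i; case: ifP; rewrite ?subr_ge0.
have := Gd _ _ (subD1set B a) => h; nra.
Qed.

(** The parameters are replaced one at a time; [hyb r] has those in [r] already replaced. *)
Lemma bern_mono (p p' : 'I_n -> R) (G : {set 'I_n} -> R) :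
  (forall i, p i <= 1) -> (forall i, 0 <= p' i <= p i) ->
  (forall B B' : {set 'I_n}, B \subset B' -> G B' <= G B) -> bern p G <= bern p' G.
Proof.
move=> p1 pp' Gd.
pose hyb (r : seq 'I_n) i := if i \in r then p' i else p i.
have hyb01 r i : 0 <= hyb r i <= 1.
  by rewrite /hyb; have /andP[h1 h2] := pp' i; have h3 := p1 i; case: ifP => _; lra.
have H r : bern p G <= bern (hyb r) G.
  elim: r => [|a r IH]; first by rewrite le_eqVlt; apply/orP; left; apply/eqP; apply: eq_bigr.
  apply: (le_trans IH); apply: (bern_step (a := a)) => // [i ia|].
    by rewrite /hyb inE (negbTE ia).
  by rewrite /hyb inE eqxx /=; have /andP[h1 h2] := pp' a; case: ifP.
apply: (le_trans (H (enum 'I_n))); rewrite le_eqVlt; apply/orP; left; apply/eqP.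
apply: eq_bigr => B _; congr (_ * _); apply: eq_bigr => i _; by rewrite /hyb mem_enum.
Qed.

End Bernoulli.

(** * The noisy rumor process and its expected spreading time *)

Section Rumor.
Context {R : realType} {n m : nat}.
Variables (adj : rel 'I_(n+m)) (istar : 'I_n).
Notation U := (Upsilon R adj).
Notation out := (bool * 'I_n)%type.

Definition owt (i : 'I_n) (o : out) : R := (if o.1 then U else 1 - U) * hbar_w R adj i o.2.

Lemma deg_hon_sum i : (\sum_(h < n) adj_hon adj i h = deg_hon adj i)%N.
Proof.
rewrite /deg_hon -sum1_card big_mkcond [RHS]big_mkcond /= big_split_ord /=.
rewrite [X in (_ + X)%N]big1 ?addn0; last first.
  by move=> j _; rewrite !inE /= ltnNge leq_addr andbF.
by apply: eq_bigr => h _; rewrite !inE /= ltn_ord andbT /adj_hon; case: (adj _ _).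
Qed.

Lemma hbar_sum i : \sum_(h < n) hbar_w R adj i h = 1.
Proof.
rewrite /hbar_w; case: (eqVneq (deg_hon adj i) 0%N) => [_|d0].
  by rewrite (bigD1 i)//= eqxx big1 ?addr0// => h /negbTE ->.
by rewrite -mulr_suml -natr_sum deg_hon_sum divff// pnatr_eq0.
Qed.

Lemma owt_sum i : \sum_o owt i o = 1.
Proof.
transitivity (\sum_(b : bool) \sum_(h < n) owt i (b, h)).
  by rewrite pair_bigA /=; apply: eq_bigr => -[].
rewrite big_bool /= /owt /= -!mulr_sumr hbar_sum; ring.
Qed.

Lemma Upsilon_le i : U <= (deg_hon adj i)%:R / (deg adj i)%:R.
Proof. exact: bigmin_le_cond. Qed.

Lemma Upsilon01 : 0 <= U <= 1.
Proof.
rewrite /Upsilon; apply/andP; split; last exact: bigmin_le_id.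
by elim/big_rec: _ => // i x _ x0; rewrite le_min x0 divr_ge0.
Qed.

Lemma owt_ge0 i o : 0 <= owt i o.
Proof.
have /andP[u0 u1] := Upsilon01; rewrite /owt mulr_ge0//; first by case: ifP; lra.
by rewrite /hbar_w; case: ifP => _; rewrite ?divr_ge0.
Qed.

Definition rstep (I : {set 'I_n}) (o : 'I_n -> out) : {set 'I_n} :=
  (I :|: [set i | [&& i \notin I, (o i).1 & (o i).2 \in I]]).

(** Expectation of [g] at the set reached after [j] rounds. *)
Definition rum (j : nat) (g : {set 'I_n} -> R) : R :=
  \sum_(w : {ffun 'I_j -> {ffun 'I_n -> out}})
   (\prod_(r < j) \prod_(i < n) owt i (w r i)) * g (rumor_set istar (rumor_out w) j).

(** Transition operator of the process, seen as a Markov chain on sets. *)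
Definition rumM (g : {set 'I_n} -> R) (I : {set 'I_n}) : R :=
  \sum_(o : {ffun 'I_n -> out}) (\prod_(i < n) owt i (o i)) * g (rstep I o).

Lemma rumor_set_ext o1 o2 j : (forall r i, (1 <= r <= j)%N -> o1 r i = o2 r i) ->
  rumor_set istar o1 j = rumor_set istar o2 j.
Proof.
elim: j => //= j IH h; rewrite IH; last by move=> r i hr; apply: h; lia.
by congr (_ :|: _); apply/setP => i; rewrite !inE h//; lia.
Qed.

(** The last round is split off, so that a comparison with the real run can integrate out its latest
    phase first. *)
Lemma rum_S j g : rum j.+1 g = rum j (rumM g).
Proof.
pose T := {ffun 'I_n -> out}.
pose ext (x : {ffun 'I_j -> T} * T) : {ffun 'I_j.+1 -> T} :=
  [ffun r => if unlift ord_max r is Some r' then x.1 r' else x.2].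
pose res (w : {ffun 'I_j.+1 -> T}) : {ffun 'I_j -> T} * T :=
  ([ffun r => w (lift ord_max r)], w ord_max).
have extK : cancel ext res.
  move=> [w o]; congr pair; last by rewrite ffunE unlift_none.
  by apply/ffunP => r; rewrite !ffunE liftK.
have resK : cancel res ext.
  move=> w; apply/ffunP => r; rewrite !ffunE; case: unliftP => [r' ->|->] //=.
  by rewrite ffunE.
rewrite /rum (reindex ext) /=; last by apply: onW_bij; exists res.
rewrite -(pair_bigA _ (fun w o => (\prod_(r < j.+1) \prod_(i < n) owt i (ext (w, o) r i)) *
   g (rumor_set istar (rumor_out (ext (w, o))) j.+1))) /=.
apply: eq_bigr => w _; rewrite /rumM mulr_sumr; apply: eq_bigr => o _.
rewrite big_ord_recr /=.
have -> : \prod_(r < j) \prod_(i < n) owt i (ext (w, o) (widen_ord (leqnSn j) r) i) =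
   \prod_(r < j) \prod_(i < n) owt i (w r i).
  apply: eq_bigr => r _; apply: eq_bigr => i _; rewrite ffunE.
  have -> : widen_ord (leqnSn j) r = lift ord_max r.
    by apply: val_inj; rewrite /= /bump leqNgt ltn_ord.
  by rewrite liftK.
have -> : \prod_(i < n) owt i (ext (w, o) ord_max i) = \prod_(i < n) owt i (o i).
  by apply: eq_bigr => i _; rewrite ffunE unlift_none.
rewrite -mulrA; congr (_ * (_ * g _)).
have -> : rumor_set istar (rumor_out (ext (w, o))) j = rumor_set istar (rumor_out w) j.
  apply: rumor_set_ext => r i hr; rewrite /rumor_out.
  have h1 : (r.-1 < j.+1)%N by lia.
  have h2 : (r.-1 < j)%N by lia.
  rewrite !insubT ffunE.
  have -> : Sub r.-1 h1 = lift ord_max (Ordinal h2).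
    by apply: val_inj; rewrite /= /bump leqNgt h2.
  by rewrite liftK.
rewrite /rstep; congr (_ :|: _); apply/setP => i; rewrite !inE /rumor_out /=.
have h1 : (j < j.+1)%N by [].
rewrite insubT ffunE.
have -> : Sub j h1 = ord_max :> 'I_j.+1 by apply: val_inj.
by rewrite unlift_none.
Qed.

Lemma rum0 g : rum 0 g = g [set istar].
Proof.
rewrite /rum (eq_bigr (fun=> g [set istar])); last by move=> w _; rewrite big_ord0 mul1r.
by rewrite sumr_const card_ffun card_ord expn0.
Qed.

Lemma owt_prod_sum : \sum_(o : {ffun 'I_n -> out}) \prod_(i < n) owt i (o i) = 1.
Proof. by rewrite -bigA_distr_bigA /= big1// => i _; exact: owt_sum. Qed.

Lemma rumM_cst c : rumM (fun=> c) =1 fun=> c.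
Proof. by move=> I; rewrite /rumM -mulr_suml owt_prod_sum mul1r. Qed.

Lemma rum_cst j c : rum j (fun=> c) = c.
Proof.
elim: j => [|j IH]; first by rewrite rum0.
by rewrite rum_S -[RHS]IH; congr rum; apply: funext => I; exact: rumM_cst.
Qed.

Lemma rum_le j g g' : (forall I, g I <= g' I) -> rum j g <= rum j g'.
Proof.
move=> h; apply: ler_sum => w _; apply: ler_wpM2l => //.
by apply: prodr_ge0 => r _; apply: prodr_ge0 => i _; exact: owt_ge0.
Qed.

(** Its expectation after [j] rounds is the probability that the spreading time exceeds [j]. *)
Definition unspread (I : {set 'I_n}) : R := (I != [set: 'I_n])%:R.

Lemma tau_leE j : 1 - tau_le R adj istar j = rum j unspread.
Proof.
rewrite -[X in X - _](rum_cst j 1) -sumrB; apply: eq_bigr => w _.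
rewrite -mulrBr /unspread; congr (_ * _).
  by case: eqP; rewrite /= ?subrr ?subr0.
Qed.

Lemma rstep_sub (I : {set 'I_n}) (o : 'I_n -> out) : I \subset rstep I o.
Proof. exact: finset.subsetUl. Qed.

Lemma unspread_S j : rum j.+1 unspread <= rum j unspread.
Proof.
rewrite rum_S; apply: rum_le => I; rewrite -[X in _ <= X](rumM_cst (unspread I) I).
apply: ler_sum => o _; apply: ler_wpM2l.
  by apply: prodr_ge0 => i _; exact: owt_ge0.
rewrite /unspread ler_nat; case: (eqVneq I [set: 'I_n]%SET) => [IT|_]; last by case: (_ != _).
have : rstep I o == [set: 'I_n]%SET by rewrite -finset.subTset -{1}IT; exact: rstep_sub.
by move=> /eqP ->; rewrite eqxx.
Qed.

Lemma unspread_ge0 j : 0 <= rum j unspread.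
Proof. by rewrite -(rum_cst j 0); apply: rum_le => I; rewrite /unspread. Qed.

Variable beta : R.
Let A2 l : R := (phaseA beta (2 * l))%:R.
Hypothesis A_lt : forall j, (phaseA beta j < phaseA beta j.+1)%N.

Lemma tau_eqE l : tau_eq R adj istar l.+1 = rum l unspread - rum l.+1 unspread.
Proof. by rewrite /tau_eq -!tau_leE; ring. Qed.

Lemma tau_eq0 : tau_eq R adj istar 0 = 1 - rum 0 unspread.
Proof. by rewrite /tau_eq -tau_leE; ring. Qed.

Lemma tau_eq_ge0 l : 0 <= tau_eq R adj istar l.
Proof.
case: l => [|l]; last by rewrite tau_eqE subr_ge0 unspread_S.
by rewrite tau_eq0 rum0 /unspread subr_ge0 lern1 leq_b1.
Qed.

Lemma A2_0 : A2 0 = 0. Proof. by rewrite /A2 muln0. Qed.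

Lemma A2_le l l' : (l <= l')%N -> A2 l <= A2 l'.
Proof. by move=> h; rewrite ler_nat; apply: (phaseA_le (c := Config adj 0 0 0 beta 0 0 0 (fun=> [::]) (fun=> 0%N) (fun=> 0%N)) A_lt); rewrite leq_mul2l h orbT. Qed.

Lemma abel_rumor N : \sum_(0 <= l < N) (A2 l.+1 - A2 l) * rum l unspread =
  \sum_(0 <= l < N.+1) A2 l * tau_eq R adj istar l + A2 N * rum N unspread.
Proof.
elim: N => [|N IH]; first by rewrite big_geq// big_nat1 A2_0 !mul0r addr0.
rewrite big_nat_recr//= IH [in RHS]big_nat_recr//= tau_eqE; ring.
Qed.

(** Tail-sum form of the expectation. The boundary term of [abel_rumor] is not small on its own: it
    is covered by what the series carries beyond [N], up to the probability of not having spread,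
    which tends to 0 unless the right side is infinite. *)
Lemma exp_A2tau_ge N :
  ((\sum_(0 <= l < N) (A2 l.+1 - A2 l) * rum l unspread)%:E <= exp_A2tau beta adj istar)%E.
Proof.
have s0 M : (0 <= \sum_(0 <= j < M) ((phaseA beta (2 * j))%:R * tau_eq R adj istar j)%:E)%E.
  by apply: sume_ge0 => j _; rewrite lee_fin mulr_ge0// tau_eq_ge0.
have le_lim M : (\sum_(0 <= j < M) ((phaseA beta (2 * j))%:R * tau_eq R adj istar j)%:E <=
   \sum_(0 <= j <oo) ((phaseA beta (2 * j))%:R * tau_eq R adj istar j)%:E)%E.
  by apply: nneseries_lim_ge => j _ _; rewrite lee_fin mulr_ge0// tau_eq_ge0.
rewrite /exp_A2tau; case: ifPn => [/asboolP Hlim|_]; last first.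
  rewrite addey ?leey// gt_eqF//; apply: lt_le_trans (le_lim 0%N); by rewrite big_geq// ltNy0.
rewrite adde0 abel_rumor; apply/lee_addgt0Pr => e e0.
set a := A2 N; have a0 : 0 <= a by rewrite /a /A2.
have [M hM] := Hlim (e / (a + 1)) (divr_gt0 e0 (ltr_wpDl a0 ltr01)).
have {}hM : rum M unspread < e / (a + 1) by have := tau_leE M; lra.
pose M' := maxn M N.
have hM' : rum M' unspread < e / (a + 1).
  apply: le_lt_trans hM; have : (M <= M')%N by rewrite leq_maxl.
  elim: M' => [|k IH]; first by rewrite leqn0 => /eqP ->.
  rewrite leq_eqVlt => /orP[/eqP ->//|]; rewrite ltnS => /IH; apply: le_trans; exact: unspread_S.
have NM : (N.+1 <= M'.+1)%N by rewrite ltnS leq_maxr.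
apply: le_trans (leeD (le_lim M'.+1) (lexx e%:E)).
rewrite sumEFin -EFinD lee_fin [X in _ <= X + _](big_cat_nat (n := N.+1))//= -addrA lerD2l.
(* Beyond [N] the weight [A2] is at least [a], so these terms are worth [a] times the probability of
   spreading between [N] and [M']. *)
have h1 : a * (rum N unspread - rum M' unspread) <= \sum_(N.+1 <= l < M'.+1) A2 l * tau_eq R adj istar l.
  have : (N <= M')%N by rewrite leq_maxr.
  elim: M' {hM' NM} => [|k IH].
    by rewrite leqn0 => /eqP ->; rewrite subrr mulr0 big_geq.
  rewrite leq_eqVlt => /orP[/eqP <-|]; first by rewrite subrr mulr0 big_geq.
  rewrite ltnS => Nk; have {}IH := IH Nk.
  rewrite big_nat_recr//= tau_eqE.
  have : a <= A2 k.+1 by apply: A2_le; apply: leq_trans Nk _.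
  have := unspread_S k; nra.
have h2 : a * rum M' unspread <= e.
  have : (a + 1) * rum M' unspread < e by rewrite mulrC -ltr_pdivlMr//; lra.
  have := unspread_ge0 M'; nra.
rewrite -/a; lra.
Qed.

End Rumor.

Import numFieldNormedType.Exports.

(** * Numerical estimates *)

Section PowerFacts.
Context {R : realType}.
Implicit Types x y z r s : R.

Lemma ler_powR2 x y r : 0 <= r -> 0 <= x -> x <= y -> x `^ r <= y `^ r.
Proof. by move=> r0 x0 xy; apply: ge0_ler_powR => //; rewrite nnegrE// (le_trans x0). Qed.

Lemma powR_ge1 x r : 0 <= r -> 1 <= x -> 1 <= x `^ r.
Proof. by move=> r0 x1; rewrite -[X in X <= _](powRr0 x); exact: ler_powR. Qed.

Lemma powRK x r : 0 <= x -> r != 0 -> (x `^ r) `^ r^-1 = x.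
Proof. by move=> x0 r0; rewrite -powRrM divff// powRr1. Qed.

Lemma powR_le_inv x y r : 0 < r -> 0 <= x -> x `^ r <= y -> x <= y `^ r^-1.
Proof.
move=> r0 x0 h; rewrite -[X in X <= _](@powRK x r x0 (lt0r_neq0 r0)).
by apply: ler_powR2; rewrite ?powR_ge0 ?invr_ge0// ltW.
Qed.

Lemma inv_le_powR x y r : 0 < r -> 0 <= y -> y `^ r^-1 <= x -> y <= x `^ r.
Proof.
by move=> r0 y0 h; rewrite -[r]invrK; apply: powR_le_inv; rewrite ?invr_gt0.
Qed.

(** The bound [ln u <= u] at [u = y / x]: a multiple of [ln y], however large, is traded for a
    single [y]. *)
Lemma ln_tangent x y : 0 < x -> 0 < y -> x * ln y <= y + x * ln x.
Proof.
move=> x0 y0; have := ltW (ln_sublinear (divr_gt0 y0 x0)).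
rewrite ln_div// lerBlDr -(ler_pM2l x0) mulrDr.
by rewrite mulrCA divff ?mulr1// gt_eqF.
Qed.

Lemma two_sqrt_lt x y : 0 < y -> 4 * x < y ^+ 2 -> 2 * Num.sqrt x < y.
Proof.
move=> y0 h; rewrite mulrC -ltr_pdivlMr// -[X in _ < X]ger0_norm ?divr_ge0 ?(ltW y0)//.
by rewrite -sqrtr_sqr ltr_sqrt ?exprn_gt0 ?divr_gt0// expr_div_n ltr_pdivlMr ?exprn_gt0//; lra.
Qed.

Lemma four_sqrt_lt x y : 0 < y -> 16 * x < y -> 2 * (2 * Num.sqrt x) < Num.sqrt y.
Proof.
move=> y0 h; have e : 16 = (2 * 2) ^+ 2 :> R by ring.
have s16 : Num.sqrt 16 = 2 * 2 :> R by rewrite e sqrtr_sqr ger0_norm// mulr_ge0.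
have p16 : 0 <= 16 :> R by rewrite ler0n.
by rewrite mulrA -s16 -sqrtrM// ltr_sqrt.
Qed.

Lemma ceiln_le x k : 0 <= x -> (ceiln x <= k)%N = (x <= k%:R).
Proof.
move=> x0; have c0 : 0 <= Num.ceil x by rewrite ceil_ge0 (lt_le_trans _ x0)// ltrN10.
by rewrite /ceiln -(ceil_le_int x k) -[X in (X <= _)%R](gez0_abs c0) lez_nat.
Qed.

Lemma ceiln_ge x : x <= (ceiln x)%:R.
Proof.
have [x0|x0] := leP 0 x; last by rewrite (le_trans (ltW x0)).
by rewrite -ceiln_le.
Qed.

Lemma ceiln_lt x : 0 <= x -> (ceiln x)%:R < x + 1.
Proof.
move=> x0; case E : (ceiln x) => [|k]; first by rewrite ltr_wpDl.
by rewrite -natr1 ltrD2r ltNge -ceiln_le// E -ltnNge.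
Qed.

(** Discrete comparison with the integral: by [key], every term after the first is at most an
    increment of [- t ^ (- s) / s]. *)
Lemma sum_powR_le s N : 0 < s -> \sum_(1 <= t < N) (t%:R : R) `^ (- (1 + s)) <= 1 + s^-1.
Proof.
move=> s0.
have key t : (0 < t)%N -> (t.+1%:R : R) `^ (- (1 + s)) <= s^-1 * (t%:R `^ (- s) - t.+1%:R `^ (- s)).
  move=> t0; have t0' : 0 < t%:R :> R by rewrite ltr0n.
  have t1' : 0 < t.+1%:R :> R by rewrite ltr0n.
  rewrite ler_pdivlMl// mulrC opprD powRD; last by rewrite (gt_eqF t1') implybT.
  rewrite powR_inv1// (_ : t%:R `^ (- s) = t.+1%:R `^ (- s) * (t.+1%:R / t%:R) `^ s); last first.
    rewrite powRM ?invr_ge0// mulrA -powRD ?addNr ?powRr0 ?mul1r; last by rewrite (gt_eqF t1') implybT.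
    by rewrite -powR_inv1// -powRrM mulN1r.
  rewrite -[X in _ - X]mulr1 -mulrBr -mulrA mulrCA ler_wpM2l ?powR_ge0//.
  have q0 : 0 < t.+1%:R / t%:R :> R by rewrite divr_gt0.
  rewrite lerBrDl [X in _ <= X]/powR gt_eqF//=; apply: le_trans (expR_ge1Dx _).
  rewrite lerD2l mulrC ler_wpM2l ?(ltW s0)//.
  have h : ln (1 + (- (t.+1%:R)^-1)) <= - (t.+1%:R)^-1 :> R.
    by apply: le_ln1Dx; rewrite ltrN2 invf_lt1// ltr1n ltnS.
  have e : 1 + (- (t.+1%:R)^-1) = (t.+1%:R / t%:R)^-1 :> R.
    by rewrite -natr1; field; rewrite natr1 !gt_eqF.
  by rewrite -lerN2 -lnV ?posrE// -e.
have [N2|N2] := leqP N 1; first by rewrite big_geq// addr_ge0// invr_ge0 ltW.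
rewrite big_ltn// powR1 lerD2l.
suff h M : (1 < M)%N -> \sum_(2 <= t < M) (t%:R : R) `^ (- (1 + s)) <= s^-1 * (1 - (M.-1)%:R `^ (- s)).
  by apply: le_trans (h N N2) _; rewrite -[X in _ <= X]mulr1 ler_wpM2l ?invr_ge0 ?(ltW s0)// gerBl powR_ge0.
elim: M => // M IH; rewrite ltnS leq_eqVlt => /orP[/eqP <-|M1].
  by rewrite big_geq//= powR1 subrr mulr0.
rewrite big_nat_recr//=; apply: le_trans (lerD (IH M1) _) _.
  have := key M.-1; rewrite prednK; last by lia.
  by apply; lia.
by rewrite -mulrDr ler_wpM2l ?invr_ge0 ?(ltW s0)//; lra.
Qed.

(** An explicit solution of [c * z * (1 + ln y) < y], up to the factor [L]: by [ln_tangent] at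
    [2 * c * z], half of [y] pays for [ln y]. The 3 suits [z = S / D ^+ 2], whose logarithm is
    [ln S + 2 * ln D^-1]. *)
Lemma ln_dominated c : 0 < c -> exists2 C, 1 <= C & forall z L y, 1 <= z -> 1 <= L ->
  ln z <= 3 * L -> C * z * L <= y -> c * z * (1 + ln y) < y.
Proof.
move=> c0; pose C := 1 + 2 * c * (1 + (2 * c) + 3) + 2*c.
exists C; first by rewrite /C; nra.
move=> z L y z1 L1 lz h.
have C1 : 1 <= C by rewrite /C; nra.
have zL : 1 <= z * L by nra.
have y0 : 0 < y by apply: lt_le_trans h; rewrite -mulrA; nra.
have cz : 0 < c * z by nra.
have lc : ln (2 * (c * z)) <= 2 * c + 3 * L.
  rewrite mulrA lnM ?posrE ?mulr_gt0//; last by lra.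
  by apply: lerD => //; apply: ltW; apply: ln_sublinear; lra.
have := @ln_tangent (2 * (c * z)) y ltac:(lra) y0 => ht.
have : 2 * (c * z) * ln (2 * (c * z)) <= 2 * (c * z) * (2 * c + 3 * L) by apply: ler_wpM2l; lra.
have cL : c * z <= c * z * L by rewrite ler_peMr// ltW.
have cL2 : c * (c * z) <= c * (c * z * L) by rewrite ler_pM2l.
have : c * z * L * (2 * (1 + 2 * c + 3)) < C * z * L.
  rewrite (_ : c * z * L * _ = 2 * c * (1 + (2 * c) + 3) * (z * L)); last by ring.
  by rewrite -[X in _ < X]mulrA ltr_pM2r; [rewrite /C; lra|lra].
nra.
Qed.

End PowerFacts.

(** * Phase lengths, expiry of bans, and the size a phase must have *)

Section Phases.
Context {R : realType}.
Variable beta : R.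
Hypothesis beta1 : 1 < beta.
Notation A := (phaseA beta).

Let b0 : 0 < beta. Proof. exact: lt_trans beta1. Qed.
Let b10 : 0 <= beta - 1. Proof. by rewrite subr_ge0 ltW. Qed.

Lemma powR_step j : (j%:R : R) `^ beta + j.+1%:R `^ (beta - 1) <= j.+1%:R `^ beta.
Proof.
rewrite -(@mulr_powRB1 _ j%:R beta)// -(@mulr_powRB1 _ j.+1%:R beta)//.
rewrite -[X in _ <= X * _]natr1 [X in _ <= X]mulrDl mul1r lerD2r.
by apply: ler_wpM2l => //; apply: ler_powR2 => //; rewrite ler_nat.
Qed.

Lemma powR_beta0 : (0%:R : R) `^ beta = 0.
Proof. by rewrite powR0// lt0r_neq0. Qed.

Lemma phaseA_ge_pow j : j%:R `^ beta <= (A j)%:R.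
Proof. by case: j => [|j]; [rewrite powR_beta0|exact: ceiln_ge]. Qed.

Lemma phaseA_lt_pow j : (A j)%:R < j%:R `^ beta + 1.
Proof.
case: j => [|j]; first by rewrite powR_beta0 add0r.
by apply: ceiln_lt; exact: powR_ge0.
Qed.

Lemma phaseA_le_pow j : (A j)%:R <= j.+1%:R `^ beta.
Proof.
apply: le_trans (ltW (phaseA_lt_pow j)) _; apply: le_trans (powR_step j).
by rewrite lerD2l powR_ge1 ?ler1n.
Qed.

Lemma phaseA_lt j : (A j < A j.+1)%N.
Proof.
rewrite -(ltr_nat R); have := phaseA_lt_pow j; have := phaseA_ge_pow j.+1.
have := powR_step j; have : 1 <= (j.+1%:R : R) `^ (beta - 1) by rewrite powR_ge1 ?ler1n.
lra.
Qed.

(** Rounding costs less than 1 and a phase has length at least 1, so doubling absorbs the loss. *)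
Lemma phase_len_ge j : (0 < j)%N -> j%:R `^ (beta - 1) <= 2 * (G A j)%:R.
Proof.
case: j => // j _; rewrite /G /= natrB; last exact: ltnW (phaseA_lt j).
have := phaseA_lt_pow j; have := phaseA_ge_pow j.+1; have := powR_step j.
have : (A j)%:R + 1 <= (A j.+1)%:R :> R by rewrite natr1 ler_nat; exact: phaseA_lt.
lra.
Qed.

Lemma ln_phaseA_le j : ln (A j)%:R <= beta * ln j.+1%:R.
Proof.
rewrite -ln_powR; case: (posnP (A j)) => [->|A0].
  by rewrite ln0// ln_ge0// powR_ge1 ?ler1n// (ltW b0).
by rewrite ler_ln ?posrE ?powR_gt0 ?ltr0n// phaseA_le_pow.
Qed.

Lemma ln_phaseA_ge j : beta * ln j%:R <= ln (A j)%:R.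
Proof.
case: j => [|j]; first by rewrite /= ln0// mulr0.
rewrite -ln_powR ler_ln ?posrE ?powR_gt0 ?ltr0n//; first exact: phaseA_ge_pow.
exact: leq_ltn_trans (phaseA_lt j).
Qed.

(** A ban lasting until phase [p.+1 ^ eta] multiplies the logarithm of the phase by [eta]; [p.+1] in
    place of [p] also covers the rounding in [A p]. *)
Lemma phaseA_growth (eta : R) p p' : 1 < eta -> (ceiln (p.+1%:R `^ eta) < p')%N ->
  eta * ln (A p)%:R <= ln (A p')%:R.
Proof.
move=> e1 h; apply: le_trans (ln_phaseA_ge p').
have le1 : p.+1%:R `^ eta <= p'%:R by rewrite -ceiln_le ?powR_ge0//; exact: ltnW.
apply: (@le_trans _ _ (eta * (beta * ln p.+1%:R))).
  by rewrite ler_wpM2l ?ln_phaseA_le//; lra.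
rewrite mulrCA ler_wpM2l ?(ltW b0)// -ln_powR ler_ln ?posrE ?powR_gt0 ?ltr0n//.
exact: leq_ltn_trans h.
Qed.

Variable rho1 : R.
Hypothesis rho0 : 0 < rho1.
Hypothesis rho1_le1 : rho1 < 1.
Definition lob j := maxn 1 (Num.truncn (theta rho1 j)).

Lemma lob_gt0 j : (0 < lob j)%N. Proof. by rewrite leq_maxl. Qed.

Lemma theta_ge0 j : 0 <= theta rho1 j. Proof. exact: powR_ge0. Qed.

Lemma lob_ge j : theta rho1 j <= 2 * (lob j)%:R.
Proof.
apply: (@le_trans _ _ ((Num.truncn (theta rho1 j)).+1%:R)).
  by apply: ltW; exact: truncnS_gt.
by rewrite -natrM ler_nat /lob; move: (Num.truncn _) => q; clear; lia.
Qed.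

Lemma lob_le j : (3 <= j)%N -> (lob j)%:R <= theta rho1 j.
Proof.
move=> j3; have t1 : 1 <= theta rho1 j.
  by apply: powR_ge1; [exact: ltW|rewrite ler_pdivlMr// mul1r ler_nat].
rewrite /lob; case: (leqP (Num.truncn (theta rho1 j)) 1) => _; first by [].
by rewrite truncn_le ?theta_ge0.
Qed.

Lemma lob_mono i j : (i <= j)%N -> (lob i <= lob j)%N.
Proof.
move=> ij; rewrite geq_max !leq_max /=; apply/orP; right; apply: le_truncn; apply: ler_powR2; first exact: ltW.
  by rewrite divr_ge0.
by rewrite ler_pM2r// ler_nat.
Qed.

Lemma theta_le_third j : (3 <= j)%N -> theta rho1 j <= j%:R / 3.
Proof.
by move=> j3; apply: ler1_powR; [rewrite ler_pdivlMr// mul1r ler_nat|exact: ltW].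
Qed.

Lemma lob_le_third j : (3 <= j)%N -> (lob j <= (j + 2) %/ 3)%N.
Proof.
move=> j3; have : (lob j * 3 <= j)%N.
  rewrite -(ler_nat R) natrM -ler_pdivlMr//.
  exact: le_trans (lob_le j3) (theta_le_third j3).
by move: (lob j) => q; clear; lia.
Qed.

(** A ban decided by phase [theta] ends by [theta ^ eta = (j / 3) ^ (rho1 * eta)], at most [j / 3]
    because [rho1 * eta <= 1]. The last two thirds of the phases up to [j] are thus free of old
    bans. *)
Lemma up_le_third (eta : R) j j' : 1 < eta -> rho1 <= eta^-1 -> (3 <= j)%N -> (j' <= lob j)%N ->
  (ceiln ((j'%:R : R) `^ eta) <= (j + 2) %/ 3)%N.
Proof.
move=> e1 re j3 h; rewrite ceiln_le ?powR_ge0//.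
have e0 : 0 < eta by lra.
apply: (@le_trans _ _ (j%:R / 3)); last first.
  by rewrite ler_pdivrMr// -natrM ler_nat; clear; lia.
apply: (@le_trans _ _ (theta rho1 j `^ eta)).
  apply: ler_powR2 => //; first exact: ltW.
  by apply: le_trans (lob_le j3); rewrite ler_nat.
rewrite /theta -powRrM; apply: ler1_powR; first by rewrite ler_pdivlMr// mul1r ler_nat.
by rewrite -ler_pdivlMr// div1r.
Qed.

(* Since [lob j >= (j/3)^rho1 / 2], an upper bound on [lob j] bounds [j] polynomially. *)
Lemma le_of_lob j (y : R) : 0 <= y -> (lob j)%:R <= y -> j%:R <= 3 * (2 * y) `^ rho1^-1.
Proof.
move=> y0 h; have : theta rho1 j <= 2 * y by apply: le_trans (lob_ge j) _; rewrite ler_pM2l.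
move=> /(powR_le_inv rho0 (divr_ge0 _ _)) h1.
by rewrite mulrC -ler_pdivrMr//; apply: h1.
Qed.

(** A failure to hear at [p] spoils only the target phases [j] with [lob j <= p]; this bounds how
    late they end. *)
Lemma phaseA_lob : exists2 C : R, 0 < C & forall j p, (0 < p)%N -> (lob j <= p)%N ->
  (A j.+1)%:R <= C * p%:R `^ (beta / rho1).
Proof.
pose C0 : R := 3 * 2 `^ rho1^-1 + 2.
have C00 : 0 < C0 by rewrite ltr_wpDl// mulr_ge0// powR_ge0.
exists (C0 `^ beta); first exact: powR_gt0.
move=> j p p0 h; apply: le_trans (phaseA_le_pow _) _.
have := @le_of_lob j p%:R (ler0n _ _); rewrite ler_nat => /(_ h); rewrite powRM// => hj.
have p1 : 1 <= (p%:R : R) `^ rho1^-1 by rewrite powR_ge1 ?ler1n// invr_ge0 ltW.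
apply: (@le_trans _ _ ((C0 * p%:R `^ rho1^-1) `^ beta)); last first.
  by rewrite powRM ?powR_ge0 ?(ltW C00)// -powRrM (mulrC _ beta).
apply: ler_powR2; rewrite ?(ltW b0)// /C0 -addn2 natrD mulrDl -mulrA; apply: lerD => //.
by rewrite ler_peMr.
Qed.

(** An inaccurate estimate at [t] spoils only target phases whose window starts before [t].
    Inverting [A] once and [lob] twice, then applying [A], leaves the exponent [1 / rho1 ^ 2]. *)
Lemma phaseA_lob2 : exists2 C : R, 0 < C & forall j t, (A (lob (lob j)).-1 < t)%N ->
  (A j.+1)%:R <= C * t%:R `^ (rho1 ^+ 2)^-1.
Proof.
pose C0 : R := 3 * 2 `^ rho1^-1.
pose a : R := C0 * (2 : R) `^ rho1^-1.
have C00 : 0 < C0 by rewrite mulr_gt0// powR_gt0.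
have a0 : 0 < a by rewrite mulr_gt0// powR_gt0.
pose C1 := C0 * a `^ rho1^-1 + 2.
have C10 : 0 < C1 by rewrite ltr_wpDl// mulr_ge0 ?powR_ge0// ltW.
have ri0 : 0 <= rho1^-1 by rewrite invr_ge0 ltW.
exists (C1 `^ beta); first exact: powR_gt0.
move=> j t h; have t0 : (0 < t)%N by exact: leq_ltn_trans h.
apply: le_trans (phaseA_le_pow _) _.
pose y : R := t%:R `^ beta^-1.
have y1 : 1 <= y by rewrite powR_ge1 ?ler1n// invr_ge0 ltW.
have y0 : 0 <= y by exact: powR_ge0.
have hlo : (lob (lob j))%:R <= 2 * y.
  have : ((lob (lob j)).-1)%:R <= y.
    by apply: powR_le_inv => //; apply: le_trans (phaseA_ge_pow _) _; rewrite ler_nat ltnW.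
  have := lob_gt0 (lob j); case: (lob (lob j)) => // q _ /=; rewrite -natr1; lra.
have h1 : (lob j)%:R <= a * y `^ rho1^-1.
  have := le_of_lob _ hlo; rewrite mulr_ge0// => /(_ isT) /le_trans; apply.
  rewrite !powRM ?mulr_ge0// /a /C0 le_eqVlt; apply/orP; left; apply/eqP; ring.
have h2 : j%:R <= C0 * a `^ rho1^-1 * t%:R `^ (beta^-1 / rho1 / rho1).
  have ay0 : 0 <= a * y `^ rho1^-1 by rewrite mulr_ge0 ?powR_ge0// ltW.
  apply: le_trans (le_of_lob ay0 h1) _.
  rewrite powRM// powRM ?powR_ge0 ?(ltW a0)// !powRrM /C0 -/y le_eqVlt; apply/orP; left; apply/eqP; ring.
set z := t%:R `^ _ in h2.
have z1 : 1 <= z by rewrite powR_ge1 ?ler1n// !mulr_ge0// invr_ge0 ltW.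
apply: (@le_trans _ _ ((C1 * z) `^ beta)).
  apply: ler_powR2; rewrite ?(ltW b0)// /C1 -addn2 natrD mulrDl; apply: lerD => //.
  by rewrite ler_peMr.
rewrite powRM ?powR_ge0 ?(ltW C10)// /z -powRrM ler_wpM2l ?powR_ge0// le_eqVlt; apply/orP; left; apply/eqP.
congr (_ `^ _); field; by rewrite !gt_eqF.
Qed.

Variables (alpha : R).
Hypothesis alpha0 : 0 < alpha.

Notation dlb := (dl A ^~ alpha).

Lemma dl_le S v u w : (0 < w)%N -> (w <= v <= u)%N ->
  dlb S v <= 2 * Num.sqrt ((2 * S.+2)%:R * alpha * (beta * ln u.+1%:R) * 2 / w%:R `^ (beta - 1)).
Proof.
move=> w0 /andP[wv vu]; rewrite /dl ler_pM2l//; apply: ler_wsqrtr.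
have v0 : (0 < v)%N by lia.
have G0 : (0 < G A v)%N by rewrite /G subn_gt0 -[X in (_ < A X)%N](prednK v0); exact: phaseA_lt.
have w0' : 0 < (w%:R : R) `^ (beta - 1) by rewrite powR_gt0// ltr0n.
rewrite ler_pdivrMr ?ltr0n// [X in _ <= X]mulrAC ler_pdivlMr//.
have l1 : ln (A v)%:R <= beta * ln u.+1%:R :> R.
  by apply: le_trans (ln_phaseA_le v) _; rewrite ler_wpM2l ?(ltW b0)// ler_ln ?posrE ?ltr0n// ler_nat ltnS.
have l2 : (w%:R : R) `^ (beta - 1) <= 2 * (G A v)%:R.
  by apply: le_trans (phase_len_ge v0); apply: ler_powR2; rewrite ?ler_nat.
have l0 : 0 <= ln (A v)%:R :> R by rewrite ln_ge0// ler1n (leq_trans _ (leq_subr (A v.-1) (A v)))//.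
rewrite (_ : _ * 2 * (G A v)%:R = ((2 * S.+2)%:R * alpha * (beta * ln u.+1%:R)) * (2 * (G A v)%:R)); last by ring.
apply: ler_pM => //.
- by rewrite mulr_ge0// mulr_ge0// ltW.
- by rewrite ler_pM2l// mulr_gt0// ltr0n.
Qed.

(** With [y = p ^ (beta - 1)] the claim follows from [c * (S / D ^+ 2) * (1 + ln y) < y], which
    [ln_dominated] provides. *)
Lemma dl_lt_gap : exists2 C : R, 1 <= C & forall S p (D L : R), (1 <= S)%N -> 0 < D <= 1 -> 1 <= L ->
  ln S%:R <= L -> ln D^-1 <= L -> C * (S%:R / D ^+ 2 * L) `^ (beta - 1)^-1 <= p%:R ->
  dlb S p < D.
Proof.
have b1 : 0 < beta - 1 by rewrite subr_gt0.
pose c : R := 48 * alpha * beta * (1 + (beta - 1)^-1).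
have bi0 : 0 < (beta - 1)^-1 by rewrite invr_gt0.
have c0 : 0 < c by rewrite !mulr_gt0// addr_gt0.
have [C C1 HC] := ln_dominated c0.
exists (C `^ (beta - 1)^-1); first by rewrite powR_ge1// ltW.
move=> S p D L S1 /andP[D0 D1] L1 lS lD hp.
have S1' : 1 <= S%:R :> R by rewrite ler1n.
have D2 : 1 <= (D ^+ 2)^-1 by rewrite invf_ge1 ?exprn_gt0// expr_le1// ltW.
have z1 : 1 <= S%:R / D ^+ 2 by rewrite mulr_ege1.
have lz : ln (S%:R / D ^+ 2) <= 3 * L.
  rewrite lnM ?posrE ?invr_gt0 ?exprn_gt0// ?ltr0n//.
  rewrite -exprVn lnXn ?invr_gt0// mulr2n; lra.
have zL : 1 <= S%:R / D ^+ 2 * L by rewrite mulr_ege1.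
have p1 : 1 <= p%:R :> R.
  apply: le_trans hp; rewrite mulr_ege1// powR_ge1 ?(ltW bi0)//.
have p0 : (0 < p)%N by rewrite -(ler1n R).
have hy : C * (S%:R / D ^+ 2) * L <= p%:R `^ (beta - 1).
  apply: inv_le_powR => //; first by rewrite !mulr_ge0// ?invr_ge0 ?exprn_ge0//; lra.
  by rewrite -mulrA powRM//; lra.
have := HC _ _ _ z1 L1 lz hy; set y := p%:R `^ _ => hlt.
have y1 : 1 <= y by rewrite powR_ge1.
have hpp : (p <= p <= p)%N by rewrite leqnn.
apply: le_lt_trans (dl_le S p0 hpp) _.
have lp : ln p.+1%:R <= (1 + (beta - 1)^-1) * (1 + ln y).
  have ly : ln p%:R = (beta - 1)^-1 * ln y by rewrite /y ln_powR mulKf// gt_eqF.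
  apply: (@le_trans _ _ (ln (2 * p%:R))).
    by rewrite ler_ln ?posrE ?mulr_gt0 ?ltr0n// -natrM ler_nat mul2n -addnn -add1n leq_add2r.
  rewrite lnM ?posrE ?ltr0n// ly.
  have : ln 2 <= 1 :> R by rewrite (_ : 2 = 1 + 1)//; apply: le_ln1Dx; rewrite (lt_trans _ ltr01)// ltrN10.
  have : 0 <= ln y by rewrite ln_ge0.
  nra.
have y0 : 0 < y by lra.
apply: two_sqrt_lt => //.
have S6 : (2 * S.+2)%:R <= 6 * S%:R :> R by rewrite -natrM ler_nat; clear -S1; lia.
have lp0 : 0 <= ln p.+1%:R :> R by rewrite ln_ge0// ler1n.
have ab : 0 < alpha * beta by rewrite mulr_gt0.
apply: (@le_lt_trans _ _ (48 * (alpha * beta) * (S%:R * ln p.+1%:R) / y)).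
  rewrite mulrA ler_pM2r ?invr_gt0//.
  rewrite (_ : 4 * _ = (2 * S.+2)%:R * (8 * (alpha * beta) * ln p.+1%:R)); last by ring.
  rewrite (_ : 48 * _ * _ = 6 * S%:R * (8 * (alpha * beta) * ln p.+1%:R)); last by ring.
  by apply: ler_wpM2r => //; rewrite !mulr_ge0// ltW.
have D20 : 0 < D ^+ 2 by rewrite exprn_gt0.
rewrite ltr_pdivrMr// -ltr_pdivrMl//; apply: le_lt_trans hlt.
rewrite (_ : c * _ * _ = (D ^+ 2)^-1 * (48 * (alpha * beta) * (S%:R * ((1 + (beta - 1)^-1) * (1 + ln y))))); last first.
  by rewrite /c; ring.
apply: ler_wpM2l; first by rewrite invr_ge0 ltW.
by apply: ler_wpM2l; [rewrite mulr_ge0// ltW|rewrite ler_wpM2l].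
Qed.

Variables (eps rho2 : R).
Hypothesis eps0 : 0 < eps.
Hypothesis rho2_lt : rho2 < rho1 * (beta - 1).

(** Up to constants, the drift [K * d] is [K * sqrt (S * ln j0 / j0 ^ (rho1 * (beta - 1)))] and the
    spare bonus is [K * sqrt (S * ln t / j0 ^ rho2)]. The factor [K ^ 2 * S] in [kappa] makes [K]
    and [S] cancel, and [rho2 < rho1 * (beta - 1)] decides beyond a constant phase. The power of [S]
    in the threshold comes from asking phases of length at least [2 * S.+2]. *)
Lemma block_margin_ok : exists2 C : R, 3 <= C & forall K S j0, (1 <= K)%N -> (1 <= S)%N ->
  C * S%:R `^ (rho1 * (beta - 1))^-1 <= j0%:R -> block_margin A K S alpha eps (kappa rho2 K S) lob j0.
Proof.
have b1 : 0 < beta - 1 by rewrite subr_gt0.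
have [r rE r0] : exists2 r, r = rho1 * (beta - 1) & 0 < r by eexists; [|exact: mulr_gt0 rho0 b1].
have [e eE e0] : exists2 e, e = r - rho2 & 0 < e by eexists; rewrite // subr_gt0 rE.
have [cc ccE cc0] : exists2 cc : R, cc = 2 * 3 `^ rho1 & 0 < cc.
  by exists (2 * 3 `^ rho1).
have [c1 c1E c10] : exists2 c1 : R, c1 = cc `^ (beta - 1) & 0 < c1 by exists (cc `^ (beta - 1)) => //; exact: powR_gt0.
have [k kE] : exists k : R, k = 384 by exists 384.
have [Q Q0 QE] : exists2 Q : R, 0 < Q & k * beta * c1 / eps ^+ 2 < Q.
  move: (k * beta * c1 / eps ^+ 2) => q; exists (`|q| + 1); first by rewrite ltr_wpDl.
  by rewrite (le_lt_trans (ler_norm q))// ltrDl.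
(* The three terms secure [j0 >= 3], long enough phases in the window, and the domination of the
   drift by the spare bonus. *)
have [C CE] : exists C : R, C = 3 + (12 * c1) `^ r^-1 + Q `^ e^-1 by eexists.
have pw1 : 0 <= (12 * c1) `^ r^-1 by exact: powR_ge0.
have pw2 : 0 <= Q `^ e^-1 by exact: powR_ge0.
exists C; first by rewrite CE; lra.
move=> K S j0 K1 S1; rewrite -rE => hj.
have S1' : 1 <= (S%:R : R) by rewrite ler1n.
have Sr : 1 <= (S%:R : R) `^ r^-1 by apply: powR_ge1 => //; rewrite invr_ge0 ltW.
have Cj : C <= j0%:R by apply: le_trans hj; rewrite ler_peMr// CE; lra.
have j3 : (3 <= j0)%N by rewrite -(ler_nat R); apply: le_trans Cj; rewrite CE; lra.
have jQ : Q <= j0%:R `^ e.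
  by apply: inv_le_powR => //; [exact: ltW|apply: le_trans Cj; rewrite CE; lra].
have jS : 12 * c1 * S%:R <= j0%:R `^ r.
  apply: inv_le_powR => //; first by rewrite !mulr_ge0// ltW.
  rewrite powRM ?mulr_ge0 ?(ltW c10)//; apply: le_trans hj; rewrite ler_wpM2r ?powR_ge0// CE; lra.
set x := j0%:R `^ r in jS.
have j0p : (0 < j0)%N by clear -j3; lia.
have x0 : 0 < x by rewrite powR_gt0// ltr0n.
(* [lob j0] is of order [j0 ^ rho1], so phases in the window have length of order at least [x]. *)
have lox : x <= c1 * (lob j0)%:R `^ (beta - 1).
  rewrite /x rE powRrM c1E -powRM ?(ltW cc0)//; apply: ler_powR2 => //.
  have := lob_ge j0; rewrite /theta powRM ?invr_ge0// -powR_inv1// -powRrM mulN1r powRN.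
  by rewrite ler_pdivrMr ?powR_gt0// ccE mulrAC.
pose d : R := 2 * Num.sqrt ((2 * S.+2)%:R * alpha * (beta * ln j0.+1%:R) * 2 / (lob j0)%:R `^ (beta - 1)).
have lo0 := lob_gt0 j0.
have loj : (lob j0 <= j0)%N by apply: leq_trans (lob_le_third j3) _; clear -j3; lia.
have lob0 : 0 < ((lob j0)%:R : R) `^ (beta - 1) by rewrite powR_gt0// ltr0n.
have l0 : 0 < ln j0.+1%:R :> R by rewrite ln_gt0// ltr1n.
exists d; split.
- by rewrite mulr_ge0// sqrtr_ge0.
- move=> v /andP[v1 v2]; split; last by apply: dl_le => //; rewrite v1.
  have v0 : (0 < v)%N by exact: leq_trans v1.
  rewrite -(ler_nat R); have := phase_len_ge v0.
  have : ((lob j0)%:R : R) `^ (beta - 1) <= v%:R `^ (beta - 1) by apply: ler_powR2; rewrite ?ler_nat.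
  have : 12 * S%:R <= ((lob j0)%:R : R) `^ (beta - 1).
    by rewrite -(ler_pM2l c10); apply: le_trans lox; apply: le_trans jS; rewrite mulrA (mulrC c1).
  have : (2 * S.+2)%:R <= 6 * S%:R :> R by rewrite -natrM ler_nat; clear -S1; lia.
  lra.
move=> t /andP[t1 t2].
have tj : (j0 <= t)%N.
  apply: leq_trans t1; rewrite -[X in (X <= _)%N](prednK j0p) ltnS.
  by elim: (j0.-1) => // q IH; exact: leq_ltn_trans IH (phaseA_lt q).
have t0 : (0 < t)%N by exact: leq_trans tj.
(* Since [j0.+1 <= j0 ^ 2], the logarithms on both sides of the margin are comparable. *)
have lt0 : ln j0.+1%:R <= 2 * ln t%:R :> R.
  apply: (@le_trans _ _ (2 * ln j0%:R)); last by rewrite ler_pM2l// ler_ln ?posrE ?ltr0n// ler_nat.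
  rewrite mulrC mulr_natr -lnXn ?ltr0n// ler_ln ?posrE ?exprn_gt0 ?ltr0n// -natrX ler_nat.
  by clear -j3; nia.
have lt1 : ln t%:R <= beta * ln j0.+1%:R :> R.
  apply: le_trans (ln_phaseA_le j0); rewrite ler_ln ?posrE ?ltr0n ?ler_nat//.
  exact: leq_trans t2.
have d2 : 2 * Num.sqrt ((2 * S.+2)%:R * alpha * ln t%:R / (G A j0)%:R) <= d.
  rewrite /d ler_pM2l//; apply: ler_wsqrtr.
  have G0 : (0 < G A j0)%N by rewrite /G subn_gt0 -[X in (_ < A X)%N](prednK j0p); exact: phaseA_lt.
  rewrite ler_pdivrMr ?ltr0n// [X in _ <= X]mulrAC ler_pdivlMr//.
  rewrite (_ : _ * 2 * (G A j0)%:R = ((2 * S.+2)%:R * alpha * (beta * ln j0.+1%:R)) * (2 * (G A j0)%:R)); last by ring.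
  apply: ler_pM => //.
  - by rewrite !mulr_ge0// ?(ltW alpha0)// ln_ge0// ler1n.
  - by rewrite ler_pM2l// mulr_gt0// ltr0n.
  - by apply: le_trans (phase_len_ge j0p); apply: ler_powR2; rewrite ?ler_nat.
have d0 : 0 <= d by rewrite mulr_ge0// sqrtr_ge0.
apply: (@le_lt_trans _ _ (K%:R * (2 * d))).
  have : 1 <= K%:R :> R by rewrite ler1n.
  nra.
have K0 : 0 < K%:R :> R by rewrite ltr0n.
have j0R : 0 < (j0%:R : R) `^ rho2 by rewrite powR_gt0// ltr0n.
have -> : eps * Num.sqrt (alpha * ln t%:R / kappa rho2 K S j0) =
    K%:R * Num.sqrt (eps ^+ 2 * (alpha * ln t%:R * S%:R / j0%:R `^ rho2)).
  rewrite [in RHS]sqrtrM ?exprn_ge0 ?(ltW eps0)// sqrtr_sqr (ger0_norm (ltW eps0)) mulrCA; congr (_ * _).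
  rewrite -[K%:R in RHS](ger0_norm (ltW K0)) -sqrtr_sqr -sqrtrM ?exprn_ge0 ?(ltW K0)//; congr Num.sqrt.
  rewrite /kappa natrM natrX; field; rewrite !gt_eqF//.
  by rewrite ltr0n.
rewrite ltr_pM2l// /d; set l := ln j0.+1%:R in l0 lt0 lt1 *.
have S0 : 0 < S%:R :> R by rewrite ltr0n.
have lt2 : 0 < ln t%:R :> R by move: l0 lt0; lra.
have e20 : 0 < eps ^+ 2 by exact: exprn_gt0.
apply: four_sqrt_lt; first by rewrite mulr_gt0// divr_gt0// !mulr_gt0.
have g0 : 0 < alpha * l * S%:R by rewrite !mulr_gt0.
apply: (@lt_le_trans _ _ (eps ^+ 2 * (alpha * l * S%:R / 2 / j0%:R `^ rho2))); last first.
  rewrite ler_pM2l// ler_pM2r ?invr_gt0// mulrAC ler_pM2r// -mulrA ler_pM2l//.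
  by rewrite ler_pdivrMr// mulrC.
have xe : x = j0%:R `^ e * j0%:R `^ rho2.
  by rewrite -powRD eE ?subrK// gt_eqF ?ltr0n// implybT.
have S6 : (2 * S.+2)%:R <= 6 * S%:R :> R by rewrite -natrM ler_nat; clear -S1; lia.
have ye0 : 0 < (j0%:R : R) `^ e by rewrite powR_gt0// ltr0n.
apply: (@le_lt_trans _ _ ((alpha * l * S%:R) * (192 * beta * c1) / x)).
  rewrite [X in X <= _](mulrA 16) ler_pdivrMr// [X in _ <= X]mulrAC ler_pdivlMr//.
  apply: (@le_trans _ _ (16 * ((2 * S.+2)%:R * alpha * (beta * l) * 2) * (c1 * (lob j0)%:R `^ (beta - 1)))).
    by apply: ler_wpM2l => //; do ?apply: mulr_ge0; rewrite ?ler0n ?(ltW alpha0) ?(ltW b0) ?(ltW l0).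
  rewrite [X in X <= _]mulrA ler_wpM2r ?(ltW lob0)//.
  rewrite (_ : 16 * _ * c1 = (2 * S.+2)%:R * (32 * (alpha * beta * l * c1))); last by ring.
  rewrite (_ : alpha * l * _ * _ = (6 * S%:R) * (32 * (alpha * beta * l * c1))); last by ring.
  by apply: ler_wpM2r => //; apply: mulr_ge0; [rewrite ler0n|rewrite !mulr_ge0// ltW].
rewrite xe ltr_pdivrMr ?mulr_gt0//.
rewrite (_ : eps ^+ 2 * _ * _ = (alpha * l * S%:R) * (eps ^+ 2 / 2 * j0%:R `^ e)); last first.
  by field; rewrite gt_eqF.
rewrite ltr_pM2l//.
have : k * beta * c1 / eps ^+ 2 < j0%:R `^ e by exact: lt_le_trans jQ.
rewrite ltr_pdivrMr// => h.
rewrite (_ : eps ^+ 2 / 2 * _ = j0%:R `^ e * eps ^+ 2 / 2); last by rewrite mulrAC (mulrC (eps ^+ 2)).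
rewrite ltr_pdivlMr//; apply: le_lt_trans h.
by rewrite le_eqVlt kE; apply/orP; left; apply/eqP; ring.
Qed.

End Phases.

Lemma ln2_le1 (R : realType) : ln 2 <= 1 :> R.
Proof. by rewrite (_ : 2 = 1 + 1)//; apply: le_ln1Dx; rewrite (lt_trans _ ltr01)// ltrN10. Qed.

(** The power is at most [exp (- p / (2 * d))], its exponent being at least [p / 2]. Once [p / d]
    exceeds a large multiple of [L], this beats both [p ^ M] and the prefactor
    [n * d <= exp (2 * L)]. *)
Lemma hear_decay (R : realType) (M : R) : 0 <= M -> exists2 C : R, 1 <= C &
  forall (n d p : nat) (L : R), (0 < n)%N -> (0 < d)%N -> 1 <= L -> ln n%:R <= L -> ln d%:R <= L ->
  C * d%:R * L <= p%:R ->
  (n * d)%:R * (1 - d%:R^-1) ^+ (p - 2 - (p + 2) %/ 3) <= p%:R `^ (- M).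
Proof.
move=> M0; have c0 : 0 < 4 * (M + 1) by lra.
have [C0 C01 HC] := ln_dominated c0.
exists (C0 + 4 * (2 + M) + 16); first by lra.
move=> n d p L n0 d0 L1 ln ld hp.
have d1 : 1 <= d%:R :> R by rewrite ler1n.
have d0' : 0 < d%:R :> R by lra.
pose x : R := p%:R / d%:R.
have hx : (C0 + 4 * (2 + M) + 16) * L <= x by rewrite ler_pdivlMr// mulrAC.
have hx1 : C0 * 1 * L <= x by apply: le_trans hx; nra.
have hx2 : 4 * ((2 + M) * L) <= x by apply: le_trans hx; nra.
have hx3 : 16 <= x by apply: le_trans hx; nra.
have := HC 1 L x (lexx _) L1; rewrite ln1 => /(_ ltac:(lra) hx1); rewrite mulr1 => hlx.
have p16 : (16 <= p)%N.
  rewrite -(ler_nat R); apply: le_trans hx3 _; rewrite /x ler_pdivrMr// ler_peMr//.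
have p0 : 0 < p%:R :> R by rewrite ltr0n; clear -p16; lia.
set k := (p - 2 - _)%N.
have pk : p%:R <= 2 * k%:R :> R by rewrite -natrM ler_nat /k; clear -p16; lia.
have lx0 : 0 <= exp.ln x by rewrite ln_ge0//; lra.
have lp : exp.ln p%:R <= exp.ln x + L.
  rewrite -[X in exp.ln X <= _](_ : x * d%:R = p%:R); last by rewrite /x divfK// gt_eqF.
  by rewrite lnM ?posrE//; lra.
have e1 : (1 - d%:R^-1 : R) ^+ k <= expR (- (x / 2)).
  apply: (@le_trans _ _ (expR (- d%:R^-1) ^+ k)).
    apply: lerXn2r; rewrite ?nnegrE ?expR_ge0//; first by rewrite subr_ge0 invf_le1.
    exact: expR_ge1Dx.
  rewrite -expRM_natl ler_expR mulrN lerN2 /x -mulrA (mulrC d%:R^-1) mulrA ler_pM2r ?invr_gt0//.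
  by rewrite ler_pdivrMr// mulrC.
have e2 : (n * d)%:R <= expR (2 * L) :> R.
  rewrite natrM -[n%:R]lnK ?posrE ?ltr0n// -[d%:R]lnK ?posrE// -expRD ler_expR; lra.
apply: (@le_trans _ _ (expR (2 * L) * expR (- (x / 2)))).
  by apply: ler_pM => //; rewrite exprn_ge0// subr_ge0 invf_le1.
rewrite -expRD /powR gt_eqF// ler_expR.
have : M * exp.ln p%:R <= M * (exp.ln x + L) by rewrite ler_wpM2l.
nra.
Qed.

Lemma poly_combine (R : realType) (a b q e : R) : q <= e * b -> 1 <= b -> 1 <= a -> 0 <= e ->
  3 * a + q + 2 <= (5 + e) * (a * b).
Proof.
move=> q1 b1 a1 e0; have h1 : a <= a * b by rewrite ler_peMr//; lra.
have h2 : b <= a * b by rewrite ler_peMl//; lra.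
have h3 : e * b <= e * (a * b) by rewrite ler_wpM2l.
by rewrite [X in _ <= X]mulrDl; lra.
Qed.

Lemma log_sum3 (R : realType) (a b c L : R) : 1 <= L -> b <= L -> c <= L -> 1 + a + b + c <= a + 3 * L.
Proof. lra. Qed.

Lemma log_sum2 (R : realType) (a a' b c L : R) : a <= a' -> b <= L -> c <= L -> a + (b + c) <= a' + 2 * L.
Proof. lra. Qed.

Lemma log_combine (R : realType) (w1 w2 w3 w4 r g b : R) :
  0 <= w1 -> 0 <= w2 -> 0 <= w3 -> 0 <= w4 -> 0 <= r -> 0 <= g -> 0 <= b ->
  w1 + (r * w2 + g * (w3 *+ 3 + b * w2 + w4 *+ 2)) <= (w1 + r + g * (3 + b)) * (1 + w2 + w3 + w4).
Proof.
move=> h1 h2 h3 h4 hr hg hb; rewrite -subr_ge0.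
rewrite (_ : _ - _ = w1 * (w2 + w3 + w4) + r * (1 + w3 + w4) +
  g * (3 + 3 * w2 + w4 + b + b * w3 + b * w4)); last by ring.
by rewrite !addr_ge0// mulr_ge0// !addr_ge0// mulr_ge0.
Qed.

Lemma absorb_combine (R : realType) (K a L y l Aj t : R) : 1 <= y -> 1 <= L -> 0 < a -> K <= y ->
  t <= a * y * (l + 3 * L) -> a * y * l <= Aj + a * y * (a + 2 * L) ->
  K + t <= Aj + (1 + 5 * a + a * a) * L * y ^+ 2.
Proof.
move=> y1 L1 a0 Ky t1 t2; have yy : y <= L * y ^+ 2 by rewrite expr2; nra.
have yy2 : y * L <= L * y ^+ 2 by rewrite expr2; nra.
have b1 : a * (y * L) <= a * (L * y ^+ 2) by rewrite ler_pM2l.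
have b2 : a * a * y <= a * a * (L * y ^+ 2) by rewrite ler_pM2l// mulr_gt0.
rewrite (_ : _ * L * _ = L * y ^+ 2 + 5 * (a * (L * y ^+ 2)) + a * a * (L * y ^+ 2)); last by ring.
have e1 : a * y * (l + 3 * L) = a * y * l + 3 * (a * (y * L)) by ring.
have e2 : a * y * (a + 2 * L) = a * a * y + 2 * (a * (y * L)) by ring.
rewrite e1 in t1; rewrite e2 in t2; lra.
Qed.

(** * The initial phase [J] and the phase from which blocking is certain *)

Section Thresholds.
Context {R : realType}.
Variables beta rho1 : R.
Hypothesis beta1 : 1 < beta.
Hypothesis rho0 : 0 < rho1.
Hypothesis rho1_le1 : rho1 < 1.
Notation A := (phaseA beta).
Notation lo := (lob rho1).
Let b0 : 0 < beta. Proof. exact: lt_trans beta1. Qed.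

Lemma phaseA_ge_id j : (j <= A j)%N.
Proof. by elim: j => // j IH; exact: leq_ltn_trans IH (phaseA_lt beta1 j). Qed.

Lemma lob_large (y : R) j : 0 <= y -> 3 * (2 * y) `^ rho1^-1 <= j%:R -> y <= (lo j)%:R.
Proof.
move=> y0 h; have : 2 * y <= theta rho1 j.
  rewrite /theta; apply: inv_le_powR => //; first by rewrite mulr_ge0.
  by rewrite ler_pdivlMr// mulrC.
by move=> /le_trans /(_ (lob_ge rho1 j)); rewrite ler_pM2l.
Qed.

(** Each requirement is inverted into a lower bound on [J], and [A J] is about [J ^ beta]. The
    blocking margin yields [S ^ (beta / (rho1 ^ 2 * (beta - 1)))], hearing yields
    [d ^ (beta / rho1)], and the gap condition, used with [z = S / Delta_2 ^ 2], yields
    [z ^ (beta / (beta - 1))]: three of the terms in the maximum defining the constant. Powers of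
    [L] are collected separately. *)
Lemma threshold (Cb Cd Ch : R) : 0 <= Cb -> 0 <= Cd -> 0 <= Ch -> exists2 C : R, 0 < C &
  exists p : nat, forall (S d : nat) (z L W : R), 1 <= L -> 0 <= z -> 1 <= W ->
  S%:R `^ (beta / (rho1 ^+ 2 * (beta - 1))) <= W -> z `^ (beta / (beta - 1)) <= W ->
  d%:R `^ (beta / rho1) <= W ->
  exists J : nat, [/\ (5 <= J)%N, Cb * S%:R `^ (rho1 * (beta - 1))^-1 <= (lo J)%:R,
    Ch * d%:R * L <= (lo J)%:R, Cd * (z * L) `^ (beta - 1)^-1 <= (J - J %/ 2)%:R
    & (A J)%:R <= C * L ^+ p * W].
Proof.
move=> Cb0 Cd0 Ch0.
have b1 : 0 < beta - 1 by rewrite subr_gt0.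
pose c1 : R := 3 * (2 * Cb) `^ rho1^-1.
pose c2 : R := 3 * (2 * Ch) `^ rho1^-1.
pose c3 : R := 2 * Cd.
have c10 : 0 <= c1 by rewrite mulr_ge0 ?powR_ge0.
have c20 : 0 <= c2 by rewrite mulr_ge0 ?powR_ge0.
have c30 : 0 <= c3 by rewrite mulr_ge0.
pose q := rho1^-1 + (beta - 1)^-1.
have ri0 : 0 <= rho1^-1 by rewrite invr_ge0 ltW.
have bi0 : 0 <= (beta - 1)^-1 by rewrite invr_ge0 ltW.
pose c := c1 + c2 + c3 + 7; have c0 : 0 < c by rewrite /c; clearbody c1 c2 c3; lra.
exists (c `^ beta); first exact: powR_gt0.
exists (Num.truncn (q * beta)).+1 => S d z L W L1 z0 W1 hS hz hd.
pose V := W `^ beta^-1; pose Lq := L `^ q.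
have V1 : 1 <= V by rewrite powR_ge1// invr_ge0 ltW.
have Lq1 : 1 <= Lq by rewrite powR_ge1// addr_ge0.
have L0 : 0 <= L by lra.
have [u1 u1E] : exists u, u = S%:R `^ (rho1 * (beta - 1))^-1 :> R by eexists.
have u10 : 0 <= u1 by rewrite u1E powR_ge0.
have hu1 : u1 `^ rho1^-1 <= V.
  have := powR_le_inv b0 (powR_ge0 u1 rho1^-1) (y := W); apply; rewrite u1E -!powRrM.
  apply: le_trans hS; rewrite le_eqVlt; apply/orP; left; apply/eqP; congr (_ `^ _).
  by field; rewrite !gt_eqF.
have hu2 : (d%:R * L) `^ rho1^-1 <= V * Lq.
  rewrite powRM//; apply: ler_pM; rewrite ?powR_ge0//.
    by apply: powR_le_inv; rewrite ?powR_ge0// -powRrM (mulrC rho1^-1).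
  by apply: ler_powR => //; rewrite lerDl.
have hu3 : (z * L) `^ (beta - 1)^-1 <= V * Lq.
  rewrite powRM//; apply: ler_pM; rewrite ?powR_ge0//.
    by apply: powR_le_inv; rewrite ?powR_ge0// -powRrM (mulrC (beta - 1)^-1).
  by apply: ler_powR => //; rewrite lerDr.
have VL : V <= V * Lq by rewrite ler_peMr//; lra.
have VL1 : 1 <= V * Lq by apply: le_trans VL.
pose Z := c1 * u1 `^ rho1^-1 + c2 * (d%:R * L) `^ rho1^-1 + c3 * (z * L) `^ (beta - 1)^-1 + 5.
have [p1 p2 p3] : [/\ 0 <= c1 * u1 `^ rho1^-1, 0 <= c2 * (d%:R * L) `^ rho1^-1 &
    0 <= c3 * (z * L) `^ (beta - 1)^-1] by split; rewrite mulr_ge0 ?powR_ge0.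
have Z5 : 5 <= Z by rewrite /Z; move: p1 p2 p3; clear; lra.
have Z0 : 0 <= Z by apply: le_trans Z5; rewrite ler0n.
pose J := (Num.truncn Z).+1.
have ZJ : Z <= J%:R by apply: ltW; exact: truncnS_gt.
have JZ : J%:R <= Z + 1 by rewrite /J -natr1 lerD2r truncn_le.
exists J; split.
- by rewrite -(ler_nat R); apply: le_trans ZJ.
- rewrite -u1E; apply: lob_large; first by rewrite mulr_ge0.
  rewrite mulrA powRM ?mulr_ge0// mulrA -/c1; apply: le_trans ZJ; rewrite /Z; move: p1 p2 p3; clear; lra.
- rewrite -mulrA; apply: lob_large; first by rewrite !mulr_ge0.
  rewrite mulrA powRM ?mulr_ge0// mulrA -/c2; apply: le_trans ZJ; rewrite /Z; move: p1 p2 p3; clear; lra.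
- have hJ : J%:R <= 2 * (J - J %/ 2)%:R :> R by rewrite -natrM ler_nat; clear; lia.
  rewrite -(ler_pM2l (ltr0Sn R 1)); apply: le_trans hJ; rewrite mulrA -/c3.
  apply: le_trans ZJ; rewrite /Z; move: p1 p2 p3; clear; lra.
apply: le_trans (phaseA_le_pow beta1 J) _.
apply: (@le_trans _ _ ((c * (V * Lq)) `^ beta)).
  apply: ler_powR2; rewrite ?(ltW b0)// -natr1; apply: (@le_trans _ _ (Z + 2)).
    by move: JZ; clear; lra.
  have g1 : c1 * u1 `^ rho1^-1 <= c1 * (V * Lq) by rewrite ler_wpM2l// (le_trans hu1).
  have g2 : c2 * (d%:R * L) `^ rho1^-1 <= c2 * (V * Lq) by rewrite ler_wpM2l.
  have g3 : c3 * (z * L) `^ (beta - 1)^-1 <= c3 * (V * Lq) by rewrite ler_wpM2l.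
  rewrite /c /Z; clear -g1 g2 g3 VL1; lra.
have V0 : 0 <= V by lra.
have Lq0 : 0 <= Lq by lra.
rewrite powRM ?(ltW c0) ?mulr_ge0// powRM// -mulrA ler_wpM2l ?powR_ge0// mulrC.
apply: ler_pM; rewrite ?powR_ge0//.
  rewrite -powRrM -powR_mulrn//; apply: ler_powR => //; apply: ltW; exact: truncnS_gt.
by rewrite /V -powRrM mulVf ?gt_eqF// powRr1//; lra.
Qed.

Variables alpha rho2 : R.
Hypothesis alpha0 : 0 < alpha.
Hypothesis rho20 : 0 < rho2.

(** With [v = p.+1 ^ (rho2 / 2)] the threshold is [v ^ 2 / (K ^ 2 * S)]. One factor [v] exceeds [Q],
    the other pays for [ln (A p.+1)]. *)
Lemma kappa_reaches (K S j p : nat) (x g c : R) : (1 <= K)%N -> (1 <= S)%N -> 1 <= x ->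
  g = 2 / rho2 -> c = 4 * alpha * beta * (1 + g) ->
  ((K ^ 2 * S)%:R * ((A j)%:R + 1 + c * x ^+ 2)) `^ g <= p.+1%:R ->
  (A j)%:R + 1 + 4 * alpha * ln (A p.+1)%:R * x ^+ 2 <= kappa rho2 K S p.+1.
Proof.
move=> K1 S1 x1 gE cE; set Q := _ * _ => hQ.
have g0 : 0 < g by rewrite gE divr_gt0.
have a4 : 0 < 4 * alpha by rewrite mulr_gt0.
have c0 : 0 < c by rewrite cE mulr_gt0 ?addr_gt0// mulr_gt0.
have x20 : 0 <= x ^+ 2 by exact: sqr_ge0.
have KS0 : 0 < (K ^ 2 * S)%:R :> R by rewrite ltr0n muln_gt0 expn_gt0 K1 S1.
have Q0 : 0 <= Q by rewrite mulr_ge0// addr_ge0// mulr_ge0// ltW.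
have [v vE] : exists v, v = p.+1%:R `^ g^-1 :> R by eexists.
have v1 : 1 <= v by rewrite vE powR_ge1 ?ler1n// invr_ge0 ltW.
have v0 : 0 < v by exact: lt_le_trans v1.
have vv : p.+1%:R `^ rho2 = v ^+ 2.
  by rewrite vE -powR_mulrn ?powR_ge0// -powRrM gE; congr (_ `^ _); field; rewrite gt_eqF.
have Qv : Q <= v.
  rewrite vE -[Q](@powRK _ Q g)// ?gt_eqF//; apply: ler_powR2; rewrite ?invr_ge0 ?(ltW g0)//.
  exact: powR_ge0.
have lA : 4 * alpha * ln (A p.+1)%:R <= c * v.
  have lu : ln p.+1%:R <= g * v.
    have := ltW (ln_sublinear v0); rewrite {1}vE ln_powR => h.
    by rewrite -ler_pdivrMl.
  have l2u : ln p.+2%:R <= 1 + ln p.+1%:R :> R.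
    apply: (@le_trans _ _ (ln (2 * p.+1%:R))).
      by rewrite ler_ln ?posrE ?mulr_gt0 ?ltr0n// -natrM ler_nat; clear; lia.
    by rewrite lnM ?posrE ?ltr0n// lerD2r ln2_le1.
  have : ln (A p.+1)%:R <= beta * ((1 + g) * v).
    apply: le_trans (ln_phaseA_le beta1 _) _; rewrite ler_pM2l//; apply: le_trans l2u _.
    by rewrite mulrDl mul1r lerD.
  by move=> /(ler_wpM2l (ltW a4)) /le_trans; apply; rewrite cE !mulrA.
rewrite /kappa ler_pdivlMr// vv mulrC.
apply: (@le_trans _ _ (Q * v)); last by rewrite expr2 ler_wpM2r// ltW.
rewrite /Q -[X in _ <= X]mulrA ler_pM2l// [X in _ <= X]mulrDl; apply: lerD.
  by rewrite ler_peMr// addr_ge0.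
by rewrite [X in _ <= X]mulrAC ler_wpM2r.
Qed.

(** The phase from which blocking is certain is polynomial in [j], [K] and [x], so its logarithm is
    linear in theirs. *)
Lemma ln_late (K S j : nat) (x g c c' c'' y : R) : (1 <= S <= K)%N -> (1 <= j)%N -> 1 <= x ->
  0 < g -> 0 < c -> c' = 2 `^ beta + 1 + c -> c'' = 5 + c' `^ g ->
  0 < y -> y <= 3 * j%:R `^ rho1^-1 + ((K ^ 2 * S)%:R * ((A j)%:R + 1 + c * x ^+ 2)) `^ g + 2 ->
  ln y <= (ln c'' + rho1^-1 + g * (3 + beta)) * (1 + ln j%:R + ln K%:R + ln x).
Proof.
move=> /andP[S1 SK] j1 x1 g0 c0 c'E c''E y0; set Q := (K ^ 2 * S)%:R * _ => hy.
have K1' : 1 <= K%:R :> R by rewrite ler1n; exact: leq_trans SK.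
have j1' : 1 <= j%:R :> R by rewrite ler1n.
have x21 : 1 <= x ^+ 2 by rewrite expr_ge1//; apply: le_trans x1.
have ri0 : 0 <= rho1^-1 by rewrite invr_ge0 ltW.
have c'1 : 1 <= c' by rewrite c'E addrAC lerDr addr_ge0 ?powR_ge0// ltW.
have c'0 : 0 <= c' by apply: le_trans c'1.
have cg0 : 0 <= c' `^ g by exact: powR_ge0.
have c''1 : 1 <= c'' by rewrite c''E; apply: ler_wpDr => //; rewrite ler1n.
have x20 : 0 <= x ^+ 2 by exact: sqr_ge0.
have Q0 : 0 <= Q by rewrite mulr_ge0// addr_ge0// mulr_ge0// ltW.
have jb : 1 <= j%:R `^ beta :> R by rewrite powR_ge1// ltW.
have Qb : Q <= c' * (K%:R ^+ 3 * j%:R `^ beta * x ^+ 2).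
  have h1 : (K ^ 2 * S)%:R <= K%:R ^+ 3 :> R by rewrite -natrX ler_nat (expnSr K 2) leq_mul2l SK orbT.
  have h2 : (A j)%:R + 1 + c * x ^+ 2 <= c' * (j%:R `^ beta * x ^+ 2).
    have hA : (A j)%:R <= 2 `^ beta * j%:R `^ beta :> R.
      apply: le_trans (phaseA_le_pow beta1 j) _; rewrite -powRM//; apply: ler_powR2; rewrite ?(ltW b0)//.
      by rewrite -natrM ler_nat; move: j1; clear; lia.
    have jb0 : 0 <= j%:R `^ beta :> R by exact: powR_ge0.
    rewrite c'E !mulrDl mul1r; apply: lerD; first apply: lerD.
    - by apply: le_trans hA _; rewrite ler_wpM2l ?powR_ge0// ler_peMr.
    - exact: mulr_ege1.
    - by rewrite ler_pM2l// ler_peMl.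
  rewrite /Q (_ : c' * _ = K%:R ^+ 3 * (c' * (j%:R `^ beta * x ^+ 2))); last by ring.
  by apply: ler_pM => //; rewrite addr_ge0// mulr_ge0// ltW.
have [B BE] : exists B, B = K%:R ^+ 3 * j%:R `^ beta * x ^+ 2 by eexists.
rewrite -BE in Qb.
have B1 : 1 <= B by rewrite BE !mulr_ege1// expr_ge1//; apply: le_trans K1'.
have B0 : 0 <= B by apply: le_trans B1.
have Bg : 1 <= B `^ g by rewrite powR_ge1// ltW.
have jr1 : 1 <= j%:R `^ rho1^-1 :> R by rewrite powR_ge1.
have hy2 : y <= c'' * (j%:R `^ rho1^-1 * B `^ g).
  have q1 : Q `^ g <= c' `^ g * B `^ g by rewrite -powRM//; apply: ler_powR2; rewrite ?(ltW g0).
  apply: le_trans hy _; move: q1 Bg jr1 cg0; rewrite c''E.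
  exact: poly_combine.
apply: le_trans (_ : ln (c'' * (j%:R `^ rho1^-1 * B `^ g)) <= _).
  by rewrite ler_ln ?posrE//; apply: lt_le_trans hy2.
have [k0 x0 jp] : [/\ 0 < K%:R :> R, 0 < x & 0 < j%:R :> R].
  by split; [exact: lt_le_trans K1'|exact: lt_le_trans x1|exact: lt_le_trans j1'].
have Bp : 0 < B by exact: lt_le_trans B1.
rewrite lnM ?posrE ?mulr_gt0 ?powR_gt0//; last exact: lt_le_trans c''1.
rewrite lnM ?posrE ?powR_gt0// !ln_powR BE lnM ?posrE ?mulr_gt0 ?exprn_gt0 ?powR_gt0//.
rewrite lnM ?posrE ?exprn_gt0 ?powR_gt0// !lnXn// ln_powR.
by apply: log_combine; rewrite ?ln_ge0// ltW.
Qed.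

(** The cost of the phases up to [j1] contains [K * x * ln j], where [j] will be random.
    [ln_tangent] trades it for one copy of [A j] and a term quadratic in [K * x]: the origin of
    [(K / Delta_2) ^ 2] in the constant and of the factor 2 before the expected spreading time. *)
Lemma blocking_phase : exists2 C : R, 0 < C & forall (K S j : nat) (x L : R), (1 <= K)%N ->
  (1 <= S <= K)%N -> (1 <= j)%N -> 1 <= x -> 1 <= L -> ln K%:R <= L -> ln x <= L ->
  exists j1 : nat, [/\ (j <= j1)%N,
    forall p, (j1 < p)%N -> (j <= lo p.+1)%N /\
      (A j)%:R + 1 + 4 * alpha * ln (A p.+1)%:R * x ^+ 2 <= kappa rho2 K S p.+1 &
    K%:R + 4 * alpha * (K%:R * (x * ln (A j1)%:R)) <= (A j)%:R + C * L * (K%:R * x) ^+ 2].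
Proof.
have al0 := alpha0.
have [g gE g0] : exists2 g, g = 2 / rho2 & 0 < g by exists (2 / rho2) => //; rewrite divr_gt0.
have [c cE c0] : exists2 c, c = 4 * alpha * beta * (1 + g) & 0 < c.
  by eexists; [reflexivity|rewrite !mulr_gt0// addr_gt0].
have [c' c'E] : exists c', c' = 2 `^ beta + 1 + c by eexists.
have [c'' c''E c''1] : exists2 c'', c'' = 5 + c' `^ g & 1 <= c''.
  by eexists; [reflexivity|have := powR_ge0 c' g; lra].
have ri1 : 1 <= rho1^-1 by rewrite invf_ge1// ltW.
have [C0 C0E C00] : exists2 C0, C0 = beta * (ln c'' + rho1^-1 + g * (3 + beta)) & 0 < C0.
  eexists; first reflexivity; apply: mulr_gt0 => //.
  apply: addr_gt0; last by rewrite mulr_gt0 ?addr_gt0.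
  by rewrite ltr_wpDl ?ln_ge0// invr_gt0.
have [a aE a0] : exists2 a, a = 4 * alpha * C0 & 0 < a by eexists; [reflexivity|rewrite !mulr_gt0].
have C0_pos : 0 < 1 + 5 * a + a * a by rewrite !addr_gt0 ?mulr_gt0.
exists (1 + 5 * a + a * a) => // K S j x L K1 hS j1 x1 L1 lK lx.
have /andP[S1 SK] := hS.
have K1' : 1 <= K%:R :> R by rewrite ler1n.
have j1' : 1 <= j%:R :> R by rewrite ler1n.
have [Z ZE] : exists Z, Z = 3 * j%:R `^ rho1^-1 +
  ((K ^ 2 * S)%:R * ((A j)%:R + 1 + c * x ^+ 2)) `^ g by eexists.
have jr : j%:R <= j%:R `^ rho1^-1 :> R by apply: le1r_powR.
have jr0 : 0 <= j%:R `^ rho1^-1 :> R by exact: powR_ge0.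
have Qg := powR_ge0 ((K ^ 2 * S)%:R * ((A j)%:R + 1 + c * x ^+ 2)) g.
have Z1 : 3 * j%:R `^ rho1^-1 <= Z by rewrite ZE lerDl.
have Z2 : ((K ^ 2 * S)%:R * ((A j)%:R + 1 + c * x ^+ 2)) `^ g <= Z by rewrite ZE lerDr mulr_ge0.
have Z0 : 0 <= Z by apply: le_trans Z2.
have [j2 j2E] : exists j2, j2 = (Num.truncn Z).+1 by eexists.
have Zj : Z <= j2%:R by rewrite j2E; apply: ltW; exact: truncnS_gt.
have jZ : j2.+1%:R <= Z + 2 by rewrite j2E -[_.+2]addn2 natrD lerD2r truncn_le.
exists j2; split.
- rewrite -(ler_nat R); apply: le_trans Zj; apply: le_trans Z1; apply: le_trans jr _.
  by rewrite ler_peMl// ler1n.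
- move=> p hp; have up : Z <= p.+1%:R.
    by apply: le_trans Zj _; rewrite ler_nat; move: hp; clear; lia.
  split; last by apply: (kappa_reaches K1 S1 x1 gE cE); apply: le_trans up.
  rewrite /lob leq_max; apply/orP; right; rewrite truncn_ge_nat ?theta_ge0//.
  rewrite /theta; apply: inv_le_powR => //; rewrite ler_pdivlMr// mulrC.
  exact: le_trans up.
have lAj : ln (A j2)%:R <= C0 * (1 + ln j%:R + ln K%:R + ln x).
  apply: le_trans (ln_phaseA_le beta1 _) _; rewrite C0E -mulrA ler_pM2l//.
  by apply: (ln_late hS j1 x1 g0 c0 c'E c''E) => //; rewrite -ZE.
have y1 : 1 <= K%:R * x by rewrite mulr_ege1.
have t1 : 4 * alpha * (K%:R * (x * ln (A j2)%:R)) <= a * (K%:R * x) * (ln j%:R + 3 * L).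
  rewrite aE (_ : 4 * alpha * C0 * _ * _ = 4 * alpha * (K%:R * x) * (C0 * (ln j%:R + 3 * L))); last by ring.
  rewrite (_ : _ * (x * _)  = K%:R * x * ln (A j2)%:R); last by rewrite mulrA.
  rewrite mulrA ler_wpM2l//; first by apply: mulr_ge0; [rewrite mulr_ge0// ltW|exact: le_trans y1].
  by apply: le_trans lAj _; rewrite ler_pM2l//; exact: log_sum3.
have ay0 : 0 < a * (K%:R * x) by rewrite mulr_gt0// (lt_le_trans _ y1).
have t2 : a * (K%:R * x) * ln j%:R <= (A j)%:R + a * (K%:R * x) * (a + 2 * L).
  have jp : 0 < j%:R :> R by exact: lt_le_trans j1'.
  apply: le_trans (ln_tangent ay0 jp) _.
  apply: lerD; first by rewrite ler_nat phaseA_ge_id.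
  rewrite ler_pM2l// lnM ?posrE//; last exact: lt_le_trans y1.
  rewrite lnM ?posrE; [|exact: lt_le_trans K1'|exact: lt_le_trans x1].
  exact: log_sum2 (ltW (ln_sublinear a0)) lK lx.
have Ky : K%:R <= K%:R * x by rewrite ler_peMr.
by apply: (absorb_combine y1 L1 a0 Ky t1 t2).
Qed.

End Thresholds.

Local Open Scope classical_set_scope.
Local Open Scope ring_scope.

(** * Measurability *)

Section Discrete.
Context (d : measure_display) (O : measurableType d).

(** Measurability for the power-set sigma-algebra on [T], so that options, sequences and finite sets
    are treated alike. *)
Definition dmeas (T : Type) (f : O -> T) := forall B : set T, measurable (f @^-1` B).

Lemma dmeas_cst T (x : T) : dmeas (fun=> x).
Proof.
move=> B; have [Bx|Bx] := pselect (B x).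
  by rewrite (_ : _ @^-1` _ = setT)//; apply/seteqP; split.
by rewrite (_ : _ @^-1` _ = set0)//; apply/seteqP; split.
Qed.

Lemma dmeas_comp T T' (h : T -> T') (f : O -> T) : dmeas f -> dmeas (fun w => h (f w)).
Proof. by move=> hf B; exact: (hf (h @^-1` B)). Qed.

(** A split over the countably many values of [f]. Asking only about attained values lets invariants
    of the simulator be used on [v]. *)
Lemma dmeas_bind (T : countType) T' (f : O -> T) (g : T -> O -> T') : dmeas f ->
  (forall v, (exists w, f w = v) -> dmeas (g v)) -> dmeas (fun w => g (f w) w).
Proof.
move=> hf hg B.
rewrite (_ : _ @^-1` _ = \bigcup_n (if unpickle n is Some v then f @^-1` [set v] `&` g v @^-1` B else set0)).
  apply: bigcupT_measurable => n; case: unpickle => // v.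
  have [h|h] := pselect (exists w, f w = v); first by apply: measurableI; [exact: hf|exact: hg].
  by rewrite (_ : _ `&` _ = set0)//; apply/seteqP; split=> // w [/= hw _]; apply: h; exists w.
apply/seteqP; split=> w /=.
  by move=> Bw; exists (pickle (f w)) => //; rewrite pickleK.
by case=> n _; case: unpickle => // v [/= <-].
Qed.

Lemma dmeas_comp2 (T : countType) T1 T' (h : T -> T1 -> T') (f : O -> T) (g : O -> T1) :
  dmeas f -> dmeas g -> dmeas (fun w => h (f w) (g w)).
Proof. by move=> hf hg; apply: (@dmeas_bind T T' f (fun v w => h v (g w))) => // v _; exact: dmeas_comp. Qed.

Lemma dmeas_comp3 (T T1 : countType) T2 T' (h : T -> T1 -> T2 -> T') (f : O -> T) (g : O -> T1) (l : O -> T2) :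
  dmeas f -> dmeas g -> dmeas l -> dmeas (fun w => h (f w) (g w) (l w)).
Proof.
by move=> hf hg hl; apply: (@dmeas_bind T T' f (fun v w => h v (g w) (l w))) => // v _; exact: dmeas_comp2.
Qed.

Lemma dmeas_bool (b : O -> bool) : measurable [set w | b w] -> dmeas b.
Proof.
move=> mb B; rewrite (_ : _ @^-1` _ = ([set w | b w] `&` [set w | B true]) `|` (~` [set w | b w] `&` [set w | B false])).
  apply: measurableU; apply: measurableI => //; [|exact: measurableC|].
    exact: (@dmeas_cst _ true B).
  exact: (@dmeas_cst _ false B).
apply/seteqP; split=> w /=.
  by case E : (b w) => /= h; [left|right].
by case=> -[]; case: (b w).
Qed.

Lemma dmeas_asbool (b : O -> Prop) : measurable [set w | b w] -> dmeas (fun w => `[< b w >]).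
Proof. by move=> mb; apply: dmeas_bool; rewrite (_ : [set w | _] = [set w | b w])//; apply/seteqP; split=> w /= /asboolP. Qed.

Lemma dmeas_filter (T : countType) (a : O -> T -> bool) (s : seq T) :
  (forall k, k \in s -> dmeas (a ^~ k)) -> dmeas (fun w => seq.filter (a w) s).
Proof.
elim: s => [_|x s IH h]; first exact: dmeas_cst.
apply: (@dmeas_comp2 _ _ _ (fun (b : bool) l => if b then x :: l else l) (a ^~ x) (fun w => seq.filter (a w) s)).
  by apply: h; rewrite inE eqxx.
by apply: IH => k hk; apply: h; rewrite inE hk orbT.
Qed.

Lemma dmeas_all (T : countType) (a : O -> T -> bool) (s : seq T) :
  (forall k, k \in s -> dmeas (a ^~ k)) -> dmeas (fun w => all (a w) s).
Proof.
elim: s => [_|x s IH h]; first exact: dmeas_cst.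
apply: (@dmeas_comp2 _ _ _ andb (a ^~ x) (fun w => all (a w) s)).
  by apply: h; rewrite inE eqxx.
by apply: IH => k hk; apply: h; rewrite inE hk orbT.
Qed.

Lemma dmeas_argmax (R : realType) (f : O -> nat -> R) (s : seq nat) :
  (forall k, k \in s -> measurable_fun setT (f ^~ k)) -> dmeas (fun w => argmax_seq (f w) s).
Proof.
move=> hf; apply: dmeas_filter => k hk; apply: dmeas_all => k' hk'; apply: dmeas_bool.
rewrite (_ : [set w | _] = (fun w => f w k' - f w k) @^-1` `]-oo, 0]%classic).
  rewrite -[X in measurable X]setTI; exact: (measurable_funB (hf k' hk') (hf k hk)).
by apply/seteqP; split=> w /=; rewrite in_itv /= subr_le0.
Qed.

Lemma dmeas_fun_nat (R : realType) (h : nat -> R) (f : O -> nat) : dmeas f -> measurable_fun setT (fun w => h (f w)).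
Proof. by move=> hf _ B mB; rewrite setTI; exact: (hf (h @^-1` B)). Qed.

End Discrete.

(** * The filtration generated by rewards and orderings *)

Section Filtration.
Context {R : realType} {d : measure_display} {Omega : measurableType d} {n m : nat}.
Variables (K : nat) (X : 'I_n -> nat -> nat -> Omega -> R)
  (sg : 'I_n -> nat -> Omega -> {perm 'I_(n+m)}).

(** The sample space with the sigma-algebra of the past: being adapted becomes measurability from
    this type. *)
Definition pastT (t : nat) (pj : nat -> bool) : measurableType _ :=
  g_sigma_algebraType (past_gen K X sg t pj).

Lemma past_sub t t' (pj pj' : nat -> bool) : (t <= t')%N -> (forall j, pj j -> pj' j) ->
  past_gen K X sg t pj `<=` past_gen K X sg t' pj'.
Proof.
move=> tt' h A [[i [s [k [B [h1 h2 h3 h4]]]]]|[i [j [s [h1 h2 h3]]]]]; [left|right].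
  exists i, s, k, B; split=> //; lia.
by exists i, j, s; split=> //; exact: h.
Qed.

Lemma past_meas_sub t t' (pj pj' : nat -> bool) : (t <= t')%N -> (forall j, pj j -> pj' j) ->
  forall A, measurable (A : set (pastT t pj)) -> measurable (A : set (pastT t' pj')).
Proof. by move=> tt' h A; apply: sub_sigma_algebra2; exact: past_sub. Qed.

Lemma past_dmeas_sub t t' (pj pj' : nat -> bool) T (f : Omega -> T) : (t <= t')%N -> (forall j, pj j -> pj' j) ->
  dmeas (f : pastT t pj -> T) -> dmeas (f : pastT t' pj' -> T).
Proof. by move=> tt' h hf B; apply: (past_meas_sub tt' h); exact: hf. Qed.

Lemma past_measurable_dmeas t pj (f : Omega -> nat) : past_measurable K X sg t pj f ->
  dmeas (f : pastT t pj -> nat).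
Proof.
move=> hf B; rewrite (_ : _ @^-1` _ = \bigcup_(z in B) (f @^-1` [set z])).
  by apply: bigcup_measurable => z _; exact: hf.
by apply/seteqP; split=> w /=; [exists (f w)|case=> z hz ->].
Qed.

Lemma past_sg t (pj : nat -> bool) i j : (1 <= j)%N -> pj j -> dmeas (sg i j : pastT t pj -> _).
Proof.
move=> j1 pjj B; rewrite (_ : _ @^-1` _ = \bigcup_(s in B) (sg i j @^-1` [set s])).
  apply: fin_bigcup_measurable; first exact: finite_finset.
  by move=> s _; apply: sub_sigma_algebra; right; exists i, j, s.
by apply/seteqP; split=> w /=; [exists (sg i j w)|case=> z hz ->].
Qed.

Lemma past_X t pj i s k : (1 <= s <= t)%N -> (1 <= k <= K)%N ->
  measurable_fun setT (X i s k : pastT t pj -> R).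
Proof.
move=> hs hk _ B mB; rewrite setTI; apply: sub_sigma_algebra; left.
by exists i, s, k, B.
Qed.

Lemma past_measurable_all t pj : (forall i t k, measurable_fun setT (X i t k)) ->
  (forall i j s, measurable (sg i j @^-1` [set s])) ->
  forall A, measurable (A : set (pastT t pj)) -> measurable (A : set Omega).
Proof.
move=> mX msg; apply: smallest_sub; first exact: sigma_algebra_measurable.
move=> A [[i [s [k [B [h1 h2 h3 ->]]]]]|[i [j [s [h1 h2 ->]]]]].
  by rewrite -[X in measurable X]setTI; exact: mX.
exact: msg.
Qed.

End Filtration.

(** * Adaptedness of the simulated run *)

Section SimMeasurable.
Context {R : realType} {d : measure_display} {Omega : measurableType d} {n m : nat}.
Variables (c : config R n m) (X : 'I_n -> nat -> nat -> Omega -> R)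
  (sg : 'I_n -> nat -> Omega -> {perm 'I_(n+m)}) (tbI tbB tbU adv : 'I_n -> nat -> Omega -> nat).
Let K := c_K c.
Let A := phaseA (c_beta c).
Hypothesis A_lt : forall j, (A j < A j.+1)%N.
Definition rz (w : Omega) : realiz R n m :=
  Realiz (fun i t k => X i t k w) (fun i j => sg i j w)
         (fun i t => tbI i t w) (fun i j => tbB i j w)
         (fun i j => tbU i j w) (fun i j => adv i j w).

Definition trw (w : Omega) := sim_trace c (rz w).

Notation pT := (pastT K X sg).
(** Information at three moments: the choice of the arm at time [t] ([FI]), the end of phase [j]
    before its orderings are drawn ([FB]), and after they are drawn ([FE]). *)
Definition FI t := pT t.-1 (fun j' => (A j' < t)%N).
Definition FB j := pT (A j) (fun j' => (j' < j)%N).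
Definition FE j := pT (A j) (fun j' => (j' <= j)%N).

Lemma A_le_lt j j' : (A j' < A j)%N -> (j' < j)%N.
Proof. by move=> h; rewrite ltnNge; apply/negP => /(phaseA_le A_lt); rewrite leqNgt h. Qed.

(** The arm of time [t] is chosen before its reward is seen, so counts up to [t] use rewards up to
    [t.-1] only, one step fewer than sums of rewards. *)
Lemma cnt_dmeas i t k t' (pj : nat -> bool) : (forall s, (1 <= s <= t)%N -> dmeas (fun w : FI s => arm_at c (rz w) i s)) ->
  (t.-1 <= t')%N -> (forall j', (A j' < t)%N -> pj j') ->
  dmeas (fun w : pT t' pj => cnt (trw w) i t k).
Proof.
elim: t => [|t IH] hs ht hpj; first exact: dmeas_cst.
rewrite (_ : (fun w => _) = (fun w : pT t' pj => cnt (trw w) i t k + (arm_at c (rz w) i t.+1 == k))%N); last first.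
  by apply: funext => w; rewrite cntS'.
apply: (@dmeas_comp2 _ (pT t' pj) _ _ _ addn (fun w => cnt (trw w) i t k) (fun w => nat_of_bool (arm_at c (rz w) i t.+1 == k))).
  by apply: IH; [move=> s h; apply: hs; lia|move: ht => /=; lia|move=> j' h; apply: hpj; lia].
apply: (@dmeas_comp _ (pT t' pj) _ _ (fun x : nat => nat_of_bool (x == k))).
apply: (past_dmeas_sub _ _ (hs t.+1 _)) => //=.
Qed.

Lemma tsum_meas i t k t' (pj : nat -> bool) : (1 <= k <= K)%N -> (forall s, (1 <= s <= t)%N -> dmeas (fun w : FI s => arm_at c (rz w) i s)) ->
  (t <= t')%N -> (forall j', (A j' < t)%N -> pj j') ->
  measurable_fun setT (fun w : pT t' pj => tsum c (rz w) i t k).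
Proof.
move=> hk; elim: t => [|t IH] hs ht hpj.
  rewrite (_ : (fun w => _) = cst 0)//; apply: funext => w; by rewrite /tsum big_geq.
rewrite (_ : (fun w => _) = (fun w : pT t' pj => tsum c (rz w) i t k + (arm_at c (rz w) i t.+1 == k)%:R * X i t.+1 k w)); last first.
  by apply: funext => w; rewrite tsumS.
apply: measurable_funD.
  by apply: IH; [move=> s h; apply: hs; lia|lia|move=> j' h; apply: hpj; lia].
apply: measurable_funM; last by apply: past_X => //; rewrite ht.
apply: (@dmeas_fun_nat _ (pT t' pj) R (fun x : nat => (x == k)%:R)).
by apply: (past_dmeas_sub _ _ (hs t.+1 _)) => //=; lia.
Qed.

Record sim_meas j i : Prop := {
  sm_U : dmeas (fun w : FE j => a_U (sim c (rz w) j i));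
  sm_L : dmeas (fun w : FE j => a_L (sim c (rz w) j i));
  sm_B : forall p, dmeas (fun w : FE j => a_B (sim c (rz w) j i) p);
  sm_H : forall p, dmeas (fun w : FE j => a_H (sim c (rz w) j i) p);
  sm_R : forall p, dmeas (fun w : FE j => a_R (sim c (rz w) j i) p);
  sm_blk : forall p, dmeas (fun w : FE j => a_blk (sim c (rz w) j i) p)
}.

Lemma active_dmeas i j t (pj : nat -> bool) : sim_meas j i -> (A j <= t)%N -> (forall j', (j' <= j)%N -> pj j') ->
  dmeas (fun w : pT t pj => active c i (sim c (rz w) j i)).
Proof.
move=> [hU hL _ _ _ _] ht hpj; rewrite /active.
apply: (@dmeas_comp2 _ (pT t pj) _ _ _ (fun u l => c_sticky c i ++ [:: u; l])).
  exact: past_dmeas_sub hU.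
exact: past_dmeas_sub hL.
Qed.

Hypothesis K1 : (1 <= c_K c)%N.
Hypothesis Hsticky : forall i, size (c_sticky c i) = c_S c /\
  all (fun k => (1 <= k <= c_K c)%N) (c_sticky c i).
Hypothesis HUL : forall i, (1 <= c_U1 c i <= c_K c)%N /\ (1 <= c_L1 c i <= c_K c)%N.
Hypothesis HtbI : forall i t, past_measurable K X sg t.-1 (fun j' => (A j' < t)%N) (tbI i t).
Hypothesis HtbB : forall i j, past_measurable K X sg (A j) (fun j' => (j' < j)%N) (tbB i j).
Hypothesis HtbU : forall i j, past_measurable K X sg (A j) (fun j' => (j' <= j)%N) (tbU i j).
Hypothesis Hadv : forall i j, past_measurable K X sg (A j) (fun j' => (j' <= j)%N) (adv i j).

Lemma arm_step i j t : sim_meas j i -> (A j < t <= A j.+1)%N ->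
  (forall s, (1 <= s < t)%N -> dmeas (fun w : FI s => arm_at c (rz w) i s)) ->
  dmeas (fun w : FI t => arm_at c (rz w) i t).
Proof.
move=> hm ht hs; rewrite (_ : (fun w => _) = (fun w : FI t => pick_arm c (rz w) i (stp c (rz w) i j (t - (A j).+1)) t)); last first.
  by apply: funext => w; rewrite (@arm_atE _ _ _ c (rz w) A_lt i j).
have hsl : (t - (A j).+1 <= A j.+1 - A j)%N by lia.
have tE : (A j + (t - (A j).+1) = t.-1)%N by lia.
have cE w k : a_cnt (stp c (rz w) i j (t - (A j).+1)) k = cnt (trw w) i t.-1 k.
  by have [h _] := stp_cnt (rz w) A_lt i hsl; rewrite h tE.
have sE w k : a_sum (stp c (rz w) i j (t - (A j).+1)) k = tsum c (rz w) i t.-1 k.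
  by have [_ h] := stp_cnt (rz w) A_lt i hsl; rewrite h tE.
have hs' s : (1 <= s <= t.-1)%N -> dmeas (fun w : FI s => arm_at c (rz w) i s) by move=> h; apply: hs; lia.
have mc k : dmeas (fun w : FI t => cnt (trw w) i t.-1 k).
  by apply: cnt_dmeas; [exact: hs'|lia|move=> j'; lia].
have act : dmeas (fun w : FI t => active c i (sim c (rz w) j i)).
  apply: active_dmeas => // [|j' hj']; first by lia.
  by have : (A j' <= A j)%N := phaseA_le A_lt hj'; lia.
rewrite /pick_arm.
pose g (v : seq nat) (w : Omega) :=
  choose_tb (tbI i t w) (if [seq k <- v | cnt (trw w) i t.-1 k == 0%N] is [::] then
   argmax_seq (fun k => tsum c (rz w) i t.-1 k / (cnt (trw w) i t.-1 k)%:R +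
       Num.sqrt (c_alpha c * ln t%:R / (cnt (trw w) i t.-1 k)%:R)) v
   else [seq k <- v | cnt (trw w) i t.-1 k == 0%N]).
rewrite (_ : (fun w => _) = (fun w : FI t => g (active c i (sim c (rz w) j i)) w)); last first.
  apply: funext => w; rewrite (active_stp c (rz w)).
  have -> : [seq k <- active c i (sim c (rz w) j i) | a_cnt (stp c (rz w) i j (t - (A j).+1)) k == 0%N] =
     [seq k <- active c i (sim c (rz w) j i) | cnt (trw w) i t.-1 k == 0%N].
    by apply: eq_filter => k; rewrite cE.
  have -> : ucb (c_alpha c) (stp c (rz w) i j (t - (A j).+1)) t = (fun k => tsum c (rz w) i t.-1 k / (cnt (trw w) i t.-1 k)%:R + 
       Num.sqrt (c_alpha c * ln t%:R / (cnt (trw w) i t.-1 k)%:R)).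
    by apply: funext => k; rewrite /ucb cE sE.
  by [].
apply: (@dmeas_bind _ (FI t) _ _ _ g act) => v [w0 hv].
(* Rewards are adapted only for the arms [1..K]; an attained active set contains no others. *)
have hval k : k \in v -> (1 <= k <= K)%N.
  rewrite -hv => hk; have hk' : k \in tact (sim_trace c (rz w0)) i j.+1 by [].
  by have := sim_valid K1 Hsticky HUL hk'.
apply: (@dmeas_comp3 _ (FI t) _ _ _ _ (fun (tb : nat) (unp am : seq nat) => choose_tb tb (if unp is [::] then am else unp))
  (tbI i t) (fun w => [seq k <- v | cnt (trw w) i t.-1 k == 0%N])).
- exact: past_measurable_dmeas.
- apply: dmeas_filter => k _; exact: (dmeas_comp (fun x : nat => x == 0%N) (mc k)).
- apply: dmeas_argmax => k hk; apply: measurable_funD.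
    apply: measurable_funM; last exact: (dmeas_fun_nat (fun x : nat => x%:R^-1) (mc k)).
    by apply: tsum_meas => //; [exact: hval|lia].
  exact: (dmeas_fun_nat (fun x : nat => Num.sqrt (c_alpha c * ln t%:R / x%:R)) (mc k)).
Qed.

Section PhaseEnd.
Variable j : nat.
Hypothesis hm : forall i, sim_meas j i.
Hypothesis harm : forall i s, (1 <= s <= A j.+1)%N -> dmeas (fun w : FI s => arm_at c (rz w) i s).

Lemma B_dmeas i : dmeas (fun w : FB j.+1 => tB (trw w) i j.+1).
Proof.
have act : dmeas (fun w : FB j.+1 => active c i (sim c (rz w) j i)).
  by apply: active_dmeas => //; rewrite ltnW.
pose g (v : seq nat) (w : Omega) :=
  choose_tb (tbB i j.+1 w) (argmax_seq (fun k => (pp A (trw w) i j.+1 k)%:R : R) v).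
rewrite (_ : (fun w => _) = (fun w : FB j.+1 => g (active c i (sim c (rz w) j i)) w)); last first.
  apply: funext => w; rewrite tBE /compB (active_stp c (rz w)).
  by congr (choose_tb _ (argmax_seq _ _)); apply: funext => k; rewrite (phase_pullsE (rz w) A_lt).
apply: (@dmeas_bind _ (FB j.+1) _ _ _ g act) => v _.
apply: (@dmeas_comp2 _ (FB j.+1) _ _ _ choose_tb (tbB i j.+1)); first exact: past_measurable_dmeas.
apply: dmeas_argmax => k _.
apply: (@dmeas_fun_nat _ (FB j.+1) R (fun x : nat => x%:R)); rewrite /pp.
apply: (@dmeas_comp2 _ (FB j.+1) _ _ _ subn); apply: cnt_dmeas.
- exact: harm.
- by rewrite leq_pred.
- by move=> j' /A_le_lt.
- by move=> s hs; apply: harm; have := A_lt j; rewrite /= in hs; lia.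
- by have := A_lt j; rewrite /=; lia.
- by move=> j' /A_le_lt /= h; lia.
Qed.

(** The lists consulted when the contact of phase [j.+1] is drawn are known before the ordering of
    that phase, hence independent of it. *)
Lemma blk_dmeas i p : dmeas (fun w : FB j.+1 => a_blk (sim c (rz w) j.+1 i) p).
Proof.
have [_ _ hB hH hR hblk] := hm i.
have up T (f : Omega -> T) : dmeas (f : FE j -> T) -> dmeas (f : FB j.+1 -> T).
  by apply: past_dmeas_sub => //; rewrite ltnW.
have mc r : dmeas (fun w : FB j.+1 => cnt (trw w) i (A j.+1) r).
  by apply: cnt_dmeas; [exact: harm|rewrite leq_pred|move=> j' /A_le_lt].
pose lo := maxn 1 (Num.truncn (theta (c_rho1 c) j.+1)).
pose cond r w := [&& (1 < j.+1)%N, (cnt (trw w) i (A j.+1) r)%:R <= kappa (c_rho2 c) (c_K c) (c_S c) j.+1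
           & all (fun j' => a_B (sim c (rz w) j i) j' == tB (trw w) i j.+1) (iota lo (j.+1 - lo))].
pose res (r : option nat) (h : option 'I_(n+m)) w := match r, h with
  | Some r, Some h => if cond r w then
       (if (j.+1 <= p <= ceiln (j.+1%:R `^ c_eta c))%N
                     then h |: a_blk (sim c (rz w) j i) p else a_blk (sim c (rz w) j i) p) else a_blk (sim c (rz w) j i) p
  | _, _ => a_blk (sim c (rz w) j i) p end.
rewrite (_ : (fun w => _) = (fun w : FB j.+1 => res (a_R (sim c (rz w) j i) j) (a_H (sim c (rz w) j i) j) w)); last first.
  apply: funext => w; rewrite simS /= /new_blk.
  have [_ _ hB' hH' [hR' hblk' _]] := stp_same c (rz w) i j (A j.+1 - A j).
  rewrite -/A hR' hH' hblk' /res /=.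
  case: (a_R _ j) => [r|]//; case: (a_H _ j) => [h|]//.
  rewrite /cond -(tBE c (rz w)) hB'.
  have [hc _] := stp_cnt (rz w) A_lt i (leqnn (A j.+1 - A j)).
  rewrite hc (phase_gap A_lt) -/lo -/(trw w).
  case: ifP => // _; by case: ifP.
apply: (@dmeas_bind _ (FB j.+1) _ _ _ (fun r w => res r (a_H (sim c (rz w) j i) j) w) (up _ _ (hR j))) => r _.
apply: (@dmeas_bind _ (FB j.+1) _ _ _ (res r) (up _ _ (hH j))) => h _.
case: r h => [r|] [h|]; rewrite /res; try exact: (up _ _ (hblk p)).
apply: (@dmeas_comp2 _ (FB j.+1) _ _ _ (fun (b : bool) (s : {set 'I_(n+m)}) =>
   if b then if (j.+1 <= p <= ceiln (j.+1%:R `^ c_eta c))%N then h |: s else s else s) (cond r)); last exact: (up _ _ (hblk p)).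
rewrite /cond; apply: (@dmeas_comp2 _ (FB j.+1) _ _ _ (fun (a b : bool) => [&& (1 < j.+1)%N, a & b])
  (fun w => (cnt (trw w) i (A j.+1) r)%:R <= kappa (c_rho2 c) (c_K c) (c_S c) j.+1)).
  exact: (@dmeas_comp _ (FB j.+1) _ _ (fun x : nat => x%:R <= kappa (c_rho2 c) (c_K c) (c_S c) j.+1) _ (mc r)).
apply: dmeas_all => j' _; apply: (@dmeas_comp2 _ (FB j.+1) _ _ _ (fun a b : nat => a == b)).
  exact: (up _ _ (hB j')).
exact: B_dmeas.
Qed.

Lemma sim_measS i : sim_meas j.+1 i.
Proof.
have [hU hL hB hH hR hblk] := hm i.
have up T (f : Omega -> T) : dmeas (f : FE j -> T) -> dmeas (f : FE j.+1 -> T).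
  by apply: past_dmeas_sub => [|j' h]; [rewrite ltnW|lia].
have upB T (f : Omega -> T) : dmeas (f : FB j.+1 -> T) -> dmeas (f : FE j.+1 -> T).
  by apply: past_dmeas_sub => // j' h; lia.
have sameB w p : p != j.+1 -> a_B (sim c (rz w) j.+1 i) p = a_B (sim c (rz w) j i) p.
  move=> /negbTE pj; rewrite simS /= /upd pj.
  by have [_ _ -> _ _] := stp_same c (rz w) i j (A j.+1 - A j).
have sameH w p : p != j.+1 -> a_H (sim c (rz w) j.+1 i) p = a_H (sim c (rz w) j i) p.
  move=> /negbTE pj; rewrite simS /= /upd pj.
  by have [_ _ _ -> _] := stp_same c (rz w) i j (A j.+1 - A j).
have sameR w p : p != j.+1 -> a_R (sim c (rz w) j.+1 i) p = a_R (sim c (rz w) j i) p.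
  move=> /negbTE pj; rewrite simS /= /upd pj.
  by have [_ _ _ _ [-> _ _]] := stp_same c (rz w) i j (A j.+1 - A j).
have mH : dmeas (fun w : FE j.+1 => tH (trw w) i j.+1).
  pose pickH (s : {perm 'I_(n+m)}) (b : {set 'I_(n+m)}) :=
    ohead [seq h <- [seq s p | p <- enum 'I_(n+m)] | h \in [set h | c_adj c (lshift m i) h & h \notin b]%SET].
  rewrite (_ : (fun w => _) = (fun w : FE j.+1 => pickH (sg i j.+1 w) (a_blk (sim c (rz w) j.+1 i) j.+1))); last first.
    by apply: funext => w; rewrite tHE.
  apply: (@dmeas_comp2 _ (FE j.+1) _ _ _ pickH (sg i j.+1)); last exact: (upB _ _ (blk_dmeas i j.+1)).
  by apply: past_sg; rewrite ?leqnn.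
have mR : dmeas (fun w : FE j.+1 => tR (trw w) i j.+1).
  pose g (H : option 'I_(n+m)) (w : Omega) := match H with
  | None => None
  | Some h => Some (match @insub nat (fun x => (x < n)%N) 'I_n (val h) with
                              | Some h' => tB (trw w) h' j.+1
                              | None => let r := adv i j.+1 w in
                                        if (1 <= r <= c_K c)%N then r else 1%N
                              end) end.
  rewrite (_ : (fun w => _) = (fun w : FE j.+1 => g (tH (trw w) i j.+1) w)); last first.
    by apply: funext => w; rewrite tRE.
  apply: (@dmeas_bind _ (FE j.+1) _ _ _ g mH) => -[h|] _; last exact: dmeas_cst.
  rewrite /g.
  apply: (dmeas_comp Some).
  case: insub => [h'|]; first exact: (upB _ _ (B_dmeas h')).
  apply: (@dmeas_comp _ (FE j.+1) _ _ (fun r : nat => if (1 <= r <= c_K c)%N then r else 1%N)).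
  exact: past_measurable_dmeas.
have mUL : dmeas (fun w : FE j.+1 => (a_U (sim c (rz w) j.+1 i), a_L (sim c (rz w) j.+1 i))).
  pose g (r : option nat) (ul : nat * nat) w := match r with
      | Some r => if r \in c_sticky c i ++ [:: ul.1; ul.2] then ul else
        (choose_tb (tbU i j.+1 w) (argmax_seq (fun k => (pp A (trw w) i j.+1 k)%:R : R) [:: ul.1; ul.2]), r)
      | None => ul end.
  rewrite (_ : (fun w => _) = (fun w : FE j.+1 => g (tR (trw w) i j.+1) (a_U (sim c (rz w) j i), a_L (sim c (rz w) j i)) w)); last first.
    apply: funext => w.
    have -> : tR (trw w) i j.+1 = a_R (sim c (rz w) j.+1 i) j.+1 by [].
    rewrite simS /= /upd eqxx /active.
    have [hU' hL' _ _ _] := stp_same c (rz w) i j (A j.+1 - A j).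
    rewrite -/A hU' hL'.
    have -> : phase_pulls (stp c (rz w) i j (A j.+1 - A j)) = (fun k => (pp A (trw w) i j.+1 k)%:R : R).
      by apply: funext => k; rewrite (phase_pullsE (rz w) A_lt).
    case: (match ohead _ with Some _ => _ | None => _ end) => [r|] //.
    by rewrite /g; case: ifP.
  apply: (@dmeas_bind _ (FE j.+1) _ _ _ (fun r w => g r (a_U (sim c (rz w) j i), a_L (sim c (rz w) j i)) w) mR) => r _.
  have mul : dmeas (fun w : FE j.+1 => (a_U (sim c (rz w) j i), a_L (sim c (rz w) j i))).
    by apply: (@dmeas_comp2 _ (FE j.+1) _ _ _ (fun a b : nat => (a, b))); exact: up.
  apply: (@dmeas_bind _ (FE j.+1) _ _ _ (g r) mul) => ul _.
  rewrite /g.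
  case: r => [r|]; last exact: dmeas_cst.
  case: (r \in c_sticky c i ++ [:: ul.1; ul.2]); first exact: dmeas_cst.
  apply: (@dmeas_comp2 _ (FE j.+1) _ _ _ (fun tb am => (choose_tb tb am, r)) (tbU i j.+1)); first exact: past_measurable_dmeas.
  apply: dmeas_argmax => k _.
  apply: (@dmeas_fun_nat _ (FE j.+1) R (fun x : nat => x%:R)); rewrite /pp.
  apply: (@dmeas_comp2 _ (FE j.+1) _ _ _ subn); apply: cnt_dmeas.
  - exact: harm.
  - by rewrite leq_pred.
  - by move=> j' /A_le_lt /ltnW.
  - by move=> s hs; apply: harm; have := A_lt j; rewrite /= in hs; lia.
  - by have := A_lt j; rewrite /=; lia.
  - by move=> j' /A_le_lt /= h; lia.
split=> [||p|p|p|p].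
- exact: (@dmeas_comp _ (FE j.+1) _ _ fst _ mUL).
- exact: (@dmeas_comp _ (FE j.+1) _ _ snd _ mUL).
- have [->|pj] := eqVneq p j.+1; first exact: (upB _ _ (B_dmeas i)).
  by rewrite (_ : (fun w => _) = (fun w : FE j.+1 => a_B (sim c (rz w) j i) p)); [exact: up|apply: funext => w; exact: sameB].
- have [->|pj] := eqVneq p j.+1; first exact: mH.
  by rewrite (_ : (fun w => _) = (fun w : FE j.+1 => a_H (sim c (rz w) j i) p)); [exact: up|apply: funext => w; exact: sameH].
- have [->|pj] := eqVneq p j.+1; first exact: mR.
  by rewrite (_ : (fun w => _) = (fun w : FE j.+1 => a_R (sim c (rz w) j i) p)); [exact: up|apply: funext => w; exact: sameR].
- exact: (upB _ _ (blk_dmeas i p)).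
Qed.
End PhaseEnd.

Lemma sim_measurable j : (forall i, sim_meas j i) /\
  (forall i s, (1 <= s <= A j)%N -> dmeas (fun w : FI s => arm_at c (rz w) i s)).
Proof.
elim: j => [|j [IH1 IH2]].
  split=> [i|i s]; last by rewrite /A /=; lia.
  by split=> *; exact: dmeas_cst.
have harm i s : (1 <= s <= A j.+1)%N -> dmeas (fun w : FI s => arm_at c (rz w) i s).
  have [t] := ubnP s; elim: t s => // t IHt s; rewrite ltnS => st hs.
  have [sA|sA] := leqP s (A j); first by apply: IH2; lia.
  apply: (@arm_step i j) => //; first by lia.
  by move=> s' hs'; apply: IHt; lia.
by split=> // i; exact: sim_measS.
Qed.

Lemma arm_dmeas i t : (1 <= t)%N -> dmeas (fun w : FI t => arm_at c (rz w) i t).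
Proof.
by move=> t1; apply: (sim_measurable t).2; rewrite t1 (phaseA_ge A_lt).
Qed.

End SimMeasurable.

(** * Hoeffding bounds and independence *)

Lemma ge0_of_derive (R : realType) (f df : R -> R) : (forall x : R, is_derive x (1:R) f (df x)) ->
  (forall x, 0 <= x -> 0 <= df x) -> f 0 = 0 -> forall y, 0 <= y -> 0 <= f y.
Proof.
move=> hf hdf f0 y y0; rewrite -f0.
apply: (@ger0_derive1_le_cc _ f 0 y) => //.
- move=> x; rewrite in_itv /= => /andP[x0 _]; rewrite derive1E; have [_ ->] := hf x.
  by apply: hdf; exact: ltW.
- by apply: derivable_within_continuous => x _; case: (hf x).
- by rewrite in_itv /= lexx.
- by rewrite in_itv /= lexx y0.
Qed.

(** The function [f], exponent on the right minus logarithm of the left, vanishes at 0 together with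
    its derivative [u], and [u' = 1/4 - q * (1 - q)] for the tilted probability
    [q = p * exp x / D x]. *)
Lemma hoeffding_mgf_ge0 (R : realType) (p l : R) : 0 <= p <= 1 -> 0 <= l ->
  1 - p + p * expR l <= expR (l * p + l ^+ 2 / 8).
Proof.
move=> /andP[p0 p1] l0.
pose D x : R := 1 - p + p * expR x.
have D0 x : 0 < D x.
  rewrite /D; have := expR_gt0 x; have [->|pn] := eqVneq p 0; first by rewrite mul0r; lra.
  have : 0 < p by rewrite lt_neqAle eq_sym pn.
  nra.
have dD (x : R) : is_derive x (1:R) D (p * expR x).
  rewrite (_ : D = cst (1 - p) + p \*: expR); last by apply: funext.
  by apply: is_derive_eq; rewrite add0r.
have dlnD (x : R) : is_derive x (1:R) (fun x => ln (D x)) ((D x)^-1 * (p * expR x)).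
  pose proof (@is_derive1_comp R (@ln R) D x _ _ (is_derive1_ln (D0 x)) (dD x)) as H1; exact H1.
have dinv (x : R) : is_derive x (1:R) (fun x => expR (- ln (D x))) (expR (- ln (D x)) * - ((D x)^-1 * (p * expR x))).
  pose proof (@is_derive1_comp R (@expR R) (fun x => - ln (D x)) x _ _ (is_derive_expR _) (is_deriveN (dlnD x))) as H1; exact H1.
have invE x : expR (- ln (D x)) = (D x)^-1 by rewrite expRN lnK// posrE.
(* The inverse of [D x] is written as an exponential, to which the chain rules above apply. *)
pose u x : R := p + x / 4 - 1 + (1 - p) * expR (- ln (D x)).
have du (x : R) : is_derive x (1:R) u (4^-1 - (1 - p) * (p * expR x) / (D x) ^+ 2).
  rewrite (_ : u = cst (p - 1) + 4^-1 \*: id + (1 - p) \*: (fun x => expR (- ln (D x)))); last first.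
    by apply: funext => y; transitivity (p - 1 + 4^-1 * y + (1 - p) * expR (- ln (D y))); [rewrite /u; ring|].
  apply: is_derive_eq; rewrite invE /GRing.scale /=; field; exact: lt0r_neq0.
have u0 : forall y, 0 <= y -> 0 <= u y.
  apply: (ge0_of_derive du); last by rewrite /u invE /D expR0; field; lra.
  move=> x _; rewrite subr_ge0 ler_pdivrMr ?exprn_gt0//.
  have : 0 <= ((1 - p) - p * expR x) ^+ 2 by exact: sqr_ge0.
  rewrite /D; nra.
pose f x : R := x * p + x ^+ 2 / 8 - ln (D x).
have df (x : R) : is_derive x (1:R) f (u x).
  rewrite (_ : f = p \*: id + 8^-1 \*: (id ^+ 2) - (fun x => ln (D x))); last first.
    by apply: funext => y; transitivity (p * y + 8^-1 * (y ^+ 2) - ln (D y)); [rewrite /f; ring|].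
  apply: is_derive_eq; rewrite /u invE /GRing.scale /=.
  have := D0 x; rewrite /D => hD; field; exact: lt0r_neq0.
have := @ge0_of_derive _ f u df u0 _ l l0; rewrite /f => /(_ _)h.
have {}h : 0 <= l * p + l ^+ 2 / 8 - ln (D l).
  by apply: h; rewrite /D expR0 mulr1 subrK ln1; ring.
rewrite -[X in X <= _](@lnK _ (D l)) ?posrE// ler_expR; lra.
Qed.

(** A negative [l] is reflected to [- l] by exchanging [p] and [1 - p]. *)
Lemma hoeffding_mgf (R : realType) (p l : R) : 0 <= p <= 1 ->
  1 - p + p * expR l <= expR (l * p + l ^+ 2 / 8).
Proof.
move=> hp; have [l0|l0] := leP 0 l; first exact: hoeffding_mgf_ge0.
have hp' : 0 <= 1 - p <= 1 by lra.
have := @hoeffding_mgf_ge0 _ (1 - p) (- l) hp' _.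
rewrite oppr_ge0 => /(_ (ltW l0)) h.
have := ler_wpM2l (expR_ge0 l) h.
rewrite -expRD mulrDr mulrCA -expRD subrr expR0 mulr1 => h2.
rewrite (_ : l * p + l ^+ 2 / 8 = l + (- l * (1 - p) + (- l) ^+ 2 / 8)); last by field.
by apply: le_trans h2; rewrite le_eqVlt; apply/orP; left; apply/eqP; ring.
Qed.

(** The tangent at [l * x] is evaluated at 0 and [l]; averaging with weights [1 - x] and [x] cancels
    the slopes. *)
Lemma expR_convex01 (R : realType) (x l : R) : 0 <= x <= 1 ->
  expR (l * x) <= 1 - x + x * expR l.
Proof.
move=> /andP[x0 x1].
have h a b : expR b + (a - b) * expR b <= expR a :> R.
  have {2}-> : a = (a - b) + b by ring.
  rewrite expRD.
  have := expR_ge1Dx (a - b); have := expR_gt0 b; nra.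
have h1 := h 0 (l * x); have h2 := h l (l * x); rewrite expR0 in h1.
have : (1 - x) * (expR (l * x) + (0 - l * x) * expR (l * x)) +
   x * (expR (l * x) + (l - l * x) * expR (l * x)) <= (1 - x) * 1 + x * expR l.
  by apply: lerD; apply: ler_wpM2l => //; lra.
rewrite mulr1; apply: le_trans; rewrite le_eqVlt; apply/orP; left; apply/eqP; ring.
Qed.

(** * Independence of fresh variables from the past *)

Section Independence.
Context {R : realType} {d : measure_display} {Omega : measurableType d} {n m : nat}.
Variables (P : probability Omega R) (K : nat) (X : 'I_n -> nat -> nat -> Omega -> R)
  (sg : 'I_n -> nat -> Omega -> {perm 'I_(n+m)}).
Hypothesis mX : forall i t k, measurable_fun setT (X i t k).
Hypothesis msg : forall i j s, measurable (sg i j @^-1` [set s]).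
Hypothesis Hind : mutually_indep P K X sg.

Notation pev := (pevent X sg).

Lemma sg_dmeas i j : dmeas (sg i j).
Proof.
move=> B; rewrite (_ : _ @^-1` _ = \bigcup_(s in B) (sg i j @^-1` [set s])).
  by apply: fin_bigcup_measurable; first exact: finite_finset.
by apply/seteqP; split=> w /=; [exists (sg i j w)|case=> z hz ->].
Qed.

Lemma pevent_measurable Ex Ev p : measurable Ex -> measurable (pev Ex Ev p).
Proof.
case: p => [i t k|i j] mE /=; last exact: sg_dmeas.
by rewrite -[X in measurable X]setTI; exact: mX.
Qed.

Lemma indep_fin (J : finType) (f : J -> pidx n) (Ex : J -> set R) (Ev : J -> set {perm 'I_(n+m)}) :
  injective f -> (forall x, pvalid K (f x)) -> (forall x, measurable (Ex x)) ->
  P (\bigcap_(x in [set: J]) pev (Ex x) (Ev x) (f x)) =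
  (\prod_(x : J) P (pev (Ex x) (Ev x) (f x)))%E.
Proof.
move=> finj fv mE.
have := @Hind #|J| (fun r => f (enum_val r)) (fun r => Ex (enum_val r)) (fun r => Ev (enum_val r)).
move=> /(_ _ (fun r => fv _) (fun r => mE _)) H.
rewrite [RHS]big_enum_val /= -H; last by move=> x y /finj/enum_val_inj.
congr (P _); apply/seteqP; split=> w /= h.
  by move=> r _; exact: h.
by move=> x _; have := h (enum_rank x) I; rewrite enum_rankK; exact.
Qed.

Section Past.
Variables (t Jb : nat) (pj : nat -> bool).
Hypothesis hJ : forall j, pj j -> (j <= Jb)%N.

(** A finite index type for the past, possible because [Jb] bounds the phases allowed by [pj]; [vp]
    selects the indices that really belong to it. *)
Definition PI := ('I_n * 'I_t.+1 * 'I_K.+1 + 'I_n * 'I_Jb.+1)%type.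
Definition vp (x : PI) := match x with inl (i, s, k) => (1 <= s)%N && (1 <= k)%N
  | inr (i, j) => (1 <= j)%N && pj j end.
Definition PItr (x : PI) : pidx n := match x with inl (i, s, k) => PX i s k | inr (i, j) => PV i j end.
Definition PIv := {x : PI | vp x}.

Lemma PItr_inj : injective PItr.
Proof.
move=> [[[i s] k]|[i j]] [[[i' s'] k']|[i' j']] //= [].
  by move=> -> /val_inj -> /val_inj ->.
by move=> -> /val_inj ->.
Qed.

Definition rect (Ex : PIv -> set R) (Ev : PIv -> set {perm 'I_(n+m)}) : set Omega :=
  \bigcap_(x in [set: PIv]) pev (Ex x) (Ev x) (PItr (val x)).

Definition rects : set (set Omega) :=
  [set A | exists Ex Ev, (forall x, measurable (Ex x)) /\ A = rect Ex Ev].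

Lemma rect_setI Ex Ev Ex' Ev' :
  rect Ex Ev `&` rect Ex' Ev' = rect (fun x => Ex x `&` Ex' x) (fun x => Ev x `&` Ev' x).
Proof.
apply/seteqP; split=> w /=.
  move=> [h1 h2] x _; have := h1 x I; have := h2 x I.
  by case: (PItr _) => /=.
by move=> h; split=> x _; have := h x I; case: (PItr _) => /= ? ? => [? []|[]].
Qed.

Lemma past_rects : past_gen K X sg t pj `<=` rects.
Proof.
move=> A [[i [s [k [B [/andP[s1 s2] /andP[k1 k2] mB ->]]]]]|[i [j [s [j1 pjj ->]]]]].
  have v : vp (inl (i, Ordinal (s2 : (s < t.+1)%N), Ordinal (k2 : (k < K.+1)%N))) by rewrite /= s1 k1.
  pose x0 : PIv := exist (fun x => is_true (vp x)) _ v.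
  exists (fun x => if x == x0 then B else setT), (fun=> setT); split.
    by move=> x; case: ifP.
  apply/seteqP; split=> w /=.
    move=> Bw x _; case: (eqVneq x x0) => [->//|_]; by case: (PItr _).
  by move=> /(_ x0 I); rewrite eqxx.
have v : vp (inr (i, Ordinal (hJ pjj : (j < Jb.+1)%N))) by rewrite /= j1 pjj.
pose x0 : PIv := exist (fun x => is_true (vp x)) _ v.
exists (fun=> setT), (fun x => if x == x0 then [set s] else setT); split=> //.
apply/seteqP; split=> w /=.
  move=> Bw x _; case: (eqVneq x x0) => [->//|_]; by case: (PItr _).
by move=> /(_ x0 I); rewrite eqxx.
Qed.

Lemma rect_measurable Ex Ev : (forall x, measurable (Ex x)) -> measurable (rect Ex Ev).
Proof.
move=> mE; apply: fin_bigcap_measurable; first exact: finite_finset.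
by move=> x _; exact: pevent_measurable.
Qed.

Variables (N : finType) (fn : N -> pidx n) (Nx : N -> set R) (Nv : N -> set {perm 'I_(n+m)}).
Hypothesis fn_inj : injective fn.
Hypothesis fn_valid : forall y, pvalid K (fn y).
Hypothesis fn_new : forall y (x : PIv), fn y <> PItr (val x).
Hypothesis mNx : forall y, measurable (Nx y).
Let New := \bigcap_(y in [set: N]) pev (Nx y) (Nv y) (fn y).

Lemma New_measurable : measurable New.
Proof.
apply: fin_bigcap_measurable; first exact: finite_finset.
by move=> x _; exact: pevent_measurable.
Qed.

Lemma rect_indep Ex Ev : (forall x, measurable (Ex x)) ->
  P (rect Ex Ev `&` New) = (P (rect Ex Ev) * P New)%E.
Proof.
move=> mE.
have val_ok (x : PIv) : pvalid K (PItr (val x)).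
  case: x => -[[[i s] k]|[i j]] /= => [/andP[-> ->]|/andP[-> //]].
  by have := ltn_ord k; rewrite ltnS.
have E1 := @indep_fin PIv (fun x => PItr (val x)) Ex Ev _ val_ok mE.
have E2 := @indep_fin N fn Nx Nv fn_inj fn_valid mNx.
pose f (z : PIv + N) := match z with inl x => PItr (val x) | inr y => fn y end.
pose Fx (z : PIv + N) := match z with inl x => Ex x | inr y => Nx y end.
pose Fv (z : PIv + N) := match z with inl x => Ev x | inr y => Nv y end.
have finj : injective f.
  move=> [x|y] [x'|y'] //=.
  - by move=> /PItr_inj/val_inj ->.
  - by move=> h; case: (@fn_new y' x).
  - by move=> h; case: (@fn_new y x').
  - by move=> /fn_inj ->.
have E3 := @indep_fin (PIv + N)%type f Fx Fv finj _ _.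
rewrite /rect {}E1 ?{}E2; last by move=> x y /PItr_inj/val_inj.
rewrite big_sumType /= in E3.
rewrite -E3; last 2 first.
- by case.
- by case.
congr (P _); apply/seteqP; split=> w /=.
  by move=> [h1 h2] [x|y] _; [exact: h1|exact: h2].
by move=> h; split=> [x|y] _; [exact: (h (inl x))|exact: (h (inr y))].
Qed.

(** Uniqueness of measures: [P] restricted to [New] and [P New] times [P] are finite and agree on
    the pi-system [rects], whose sigma-algebra contains the past. *)
Lemma past_indep A : <<s past_gen K X sg t pj >> A -> P (A `&` New) = (P A * P New)%E.
Proof.
move=> hA; have hA' : <<s rects >> A by apply: (sub_sigma_algebra2 past_rects).
have mN := New_measurable.
have r0 : (0 <= fine (P New))%R by rewrite fine_ge0// measure_ge0.
pose r := NngNum r0.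
have rE : (r%:num%:E = P New)%E.
  by rewrite /= fineK// fin_num_measure.
have setTr : rects setT.
  exists (fun=> setT), (fun=> setT); split=> //; apply/seteqP; split=> // w _ x _.
  by case: (PItr _).
have E : mrestr P mN A = mscale r P A.
  apply: (@g_sigma_algebra_measure_unique _ R Omega rects _ (fun=> setT)) hA' => //.
  - by move=> B [Ex [Ev [mE ->]]]; exact: rect_measurable.
  - by apply/seteqP; split=> // w _; exists 0%N.
  - move=> B C [Ex [Ev [mE ->]]] [Ex' [Ev' [mE' ->]]]; rewrite rect_setI.
    by eexists; eexists; split; last reflexivity; move=> x /=; exact: measurableI.
  - move=> B [Ex [Ev [mE ->]]].
    transitivity (P (rect Ex Ev `&` New)); first by [].
    transitivity (r%:num%:E * P (rect Ex Ev))%E; last by [].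
    by rewrite rect_indep// rE muleC.
  - move=> k; apply: (@le_lt_trans _ _ (P (setT `&` New))); first by [].
    by rewrite setTI ltey_eq fin_num_measure.
have -> : P (A `&` New) = mrestr P mN A by [].
rewrite E; have -> : mscale r P A = (r%:num%:E * P A)%E by [].
by rewrite rE muleC.
Qed.

End Past.
End Independence.

(** The joint law of [U] and [V] is a product, because it is one on rectangles; Tonelli then splits
    the integral. *)
Lemma indep_integral (R : realType) d d1 (Omega : measurableType d) (T1 : measurableType d1)
  (P : probability Omega R) (U : {mfun Omega >-> T1}) (V : {mfun Omega >-> R})
  (nuk : probability R R) (D : T1 -> R) (h : R -> R) :
  measurable_fun setT D -> (forall x, 0 <= D x) -> measurable_fun setT h -> (forall x, 0 <= h x) ->
  (forall A B, measurable A -> measurable B ->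
     P (U @^-1` A `&` V @^-1` B) = (P (U @^-1` A) * nuk B)%E) ->
  (\int[P]_w (D (U w) * h (V w))%:E = \int[P]_w (D (U w))%:E * \int[nuk]_x (h x)%:E)%E.
Proof.
move=> mD D0 mh h0 ind.
have mW : measurable_fun setT (fun w => (U w, V w)).
  by apply: measurable_fun_pair; exact: measurable_funPT.
pose Wt : {mfun Omega >-> (T1 * R)%type} := HB.pack_for {mfun Omega >-> (T1 * R)%type} (fun w => (U w, V w))
  (isMeasurableFun.Build _ _ _ _ (fun w => (U w, V w)) mW).
have E : forall Z, measurable Z -> (distribution P U \x nuk)%E Z = distribution P Wt Z.
  apply: product_measure_unique => A B mA mB.
  by rewrite -ind.
pose F (z : T1 * R) : \bar R := (D z.1 * h z.2)%:E.
have F0 z : (0 <= F z)%E by rewrite lee_fin mulr_ge0.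
have mF : measurable_fun setT F.
  apply/measurable_EFinP; apply: measurable_funM.
    exact: (measurableT_comp mD (@measurable_fst _ _ _ _)).
  exact: (measurableT_comp mh (@measurable_snd _ _ _ _)).
transitivity (\int[distribution P Wt]_z F z)%E.
  by rewrite ge0_integral_pushforward//.
transitivity (\int[distribution P U \x nuk]_z F z)%E.
  by apply: eq_measure_integral => A mA _; exact: (esym (E A mA)).
rewrite fubini_tonelli1//.
transitivity (\int[distribution P U]_x ((D x)%:E * \int[nuk]_y (h y)%:E))%E.
  apply: eq_integral => x _; rewrite /fubini_F /F /=.
  under eq_integral do rewrite EFinM.
  rewrite ge0_integralZl//; first exact/measurable_EFinP.
  - by move=> y _; rewrite lee_fin.
  - by rewrite lee_fin.
rewrite ge0_integralZr//; last 3 first.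
- exact/measurable_EFinP.
- by move=> x _; rewrite lee_fin.
- by apply: integral_ge0 => y _; rewrite lee_fin.
congr (_ * _)%E; rewrite ge0_integral_pushforward//; first exact/measurable_EFinP.
by move=> x _; rewrite lee_fin.
Qed.

(** * Hoeffding's lemma for a law carried by the unit interval *)

Section HoeffdingLemma.
Context {R : realType} (nuk : probability R R).
Hypothesis nu01 : nuk `[0%R, 1%R]%classic = 1%E.
Let mu := fine (\int[nuk]_x x%:E)%E.
(** The law charges [[0, 1]] only almost surely; clipping changes no integral and makes the bounds
    pointwise. *)
Let clip (x : R) := Num.max 0 (Num.min x 1).

Lemma clip01 x : 0 <= clip x <= 1.
Proof. by rewrite /clip le_max lexx /= ge_max ler01 ge_min lexx orbT. Qed.

Lemma clip_ae : {ae nuk, forall x, setT x -> x = clip x}.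
Proof.
exists (~` `[0%R, 1%R]); split; first exact: measurableC.
  by rewrite probability_setC// nu01 subee.
move=> x /=; apply: contra_not; rewrite in_itv /= => /andP[x0 x1] _.
by rewrite /clip; case: (leP x 1) x1 => // _ _; case: (leP 0 x) x0.
Qed.

Lemma measurable_clip : measurable_fun setT clip.
Proof.
apply: measurable_maxr => //; apply: measurable_minr => //.
Qed.

Lemma mean_clip : (\int[nuk]_x (clip x)%:E = mu%:E)%E /\ 0 <= mu <= 1.
Proof.
have E : (\int[nuk]_x x%:E = \int[nuk]_x (clip x)%:E)%E.
  apply: (@ae_eq_integral _ _ _ nuk setT (fun x => (clip x)%:E) (fun x : R => x%:E)); [exact: measurableT| |by apply/measurable_EFinP; exact: measurable_clip|].
    by apply/(@measurable_EFinP _ _ _ _ id); exact: measurable_id.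
  by apply: filterS clip_ae => x /[apply] <-.
have h0 : (0 <= \int[nuk]_x (clip x)%:E)%E.
  by apply: integral_ge0 => x _; rewrite lee_fin; case/andP: (clip01 x).
have h1 : (\int[nuk]_x (clip x)%:E <= 1)%E.
  apply: (@le_trans _ _ (\int[nuk]_x (cst 1 x))%E); last by rewrite integral_cst// mul1e; exact: probability_le1.
  apply: ge0_le_integral; first by [].
  - by move=> x _; rewrite lee_fin; case/andP: (clip01 x).
  - by apply/measurable_EFinP; exact: measurable_clip.
  - by [].
  - by move=> x _; rewrite lee_fin; case/andP: (clip01 x).
have fin : (\int[nuk]_x (clip x)%:E)%E \is a fin_num.
  by rewrite ge0_fin_numE// (le_lt_trans h1)// ltry.
by rewrite /mu E fineK//; split=> //; rewrite -!lee_fin fineK// h0 h1.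
Qed.

(** The exponential lies below its chord on [[0, 1]]; integrating the chord leaves the Bernoulli
    case with [p = mu]. *)
Lemma hoeffding_lemma (l : R) : (\int[nuk]_x (expR (l * (x - mu) - l ^+ 2 / 8))%:E <= 1)%E.
Proof.
have [Em hm] := mean_clip.
pose c := expR (- (l * mu + l ^+ 2 / 8)).
have c0 : 0 < c by exact: expR_gt0.
have mc := measurable_clip.
have mexp : measurable_fun setT (fun x : R => expR (l * (x - mu) - l ^+ 2 / 8)).
  apply: (measurableT_comp (@measurable_expR R)); apply: measurable_funB => //.
  apply: measurable_funM => //; exact: measurable_funB.
have -> : (\int[nuk]_x (expR (l * (x - mu) - l ^+ 2 / 8))%:E =
   \int[nuk]_x (expR (l * (clip x - mu) - l ^+ 2 / 8))%:E)%E.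
  apply: ae_eq_integral; [by []|exact/measurable_EFinP| |].
    by apply/measurable_EFinP; exact: (measurableT_comp mexp mc).
  by apply: filterS clip_ae => x /[apply] <-.
pose g x : \bar R := ((c * (1 - clip x))%:E + (c * expR l * clip x)%:E)%E.
apply: (@le_trans _ _ (\int[nuk]_x g x)%E).
  apply: ge0_le_integral; first by [].
  - by move=> x _; rewrite lee_fin expR_ge0.
  - by apply/measurable_EFinP; exact: (measurableT_comp mexp mc).
  - rewrite /g; apply: emeasurable_funD; apply/measurable_EFinP; apply: measurable_funM => //.
    exact: measurable_funB.
  - move=> x _; rewrite /g -EFinD lee_fin.
    have -> : l * (clip x - mu) - l ^+ 2 / 8 = l * clip x + - (l * mu + l ^+ 2 / 8) by ring.
    rewrite expRD -/c mulrC -mulrA -mulrDr ler_pM2l// [X in _ <= _ + X]mulrC.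
    exact: expR_convex01 (clip01 x).
have cl0 x : 0 <= 1 - clip x by have := clip01 x; lra.
have cl1 x : 0 <= clip x by have := clip01 x; lra.
have mcl : measurable_fun setT (fun x => (1 - clip x)%:E : \bar R).
  by apply/measurable_EFinP; exact: measurable_funB.
have mcl2 : measurable_fun setT (fun x => (clip x)%:E : \bar R) by apply/measurable_EFinP.
have E1 : (\int[nuk]_x (1 - clip x)%:E = (1 - mu)%:E)%E.
  have : (\int[nuk]_x ((1 - clip x)%:E + (clip x)%:E) = 1)%E.
    rewrite (_ : (fun x => _) = cst 1%E); last by apply: funext => x; rewrite -EFinD subrK.
    by rewrite integral_cst// mul1e; exact: probability_setT.
  rewrite ge0_integralD//; try by move=> x _; rewrite lee_fin.
  by rewrite Em => h; rewrite EFinB -[X in (X - _)%E]h addeK.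
rewrite /g ge0_integralD//; last 4 first.
- by move=> x _; rewrite lee_fin mulr_ge0// ltW.
- by apply/measurable_EFinP; apply: measurable_funM => //; exact: measurable_funB.
- by move=> x _; rewrite lee_fin !mulr_ge0// ?expR_ge0// ltW.
- by apply/measurable_EFinP; apply: measurable_funM.
under eq_integral do rewrite EFinM.
under [X in (_ + X)%E]eq_integral do rewrite EFinM.
rewrite !ge0_integralZl//; try by move=> x _; rewrite lee_fin.
- rewrite E1 Em -!EFinM -EFinD lee_fin -mulrA -mulrDr.
  have := hoeffding_mgf l hm; rewrite [expR l * mu]mulrC => h.
  have := ler_wpM2l (ltW c0) h; rewrite -expRD addNr expR0; exact.
- by rewrite lee_fin mulr_ge0 ?expR_ge0// ltW.
- by rewrite lee_fin ltW.
Qed.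
End HoeffdingLemma.

(** * Concentration of adaptively sampled means *)

Section Concentration.
Context {R : realType} {d : measure_display} {Omega : measurableType d} {n m : nat}.
Variables (P : probability Omega R) (nu : nat -> probability R R).
Variables (c : config R n m) (X : 'I_n -> nat -> nat -> Omega -> R)
  (sg : 'I_n -> nat -> Omega -> {perm 'I_(n+m)}) (tbI tbB tbU adv : 'I_n -> nat -> Omega -> nat).
Let K := c_K c.
Let A := phaseA (c_beta c).
Hypothesis A_lt : forall j, (A j < A j.+1)%N.
Hypothesis K1 : (1 <= c_K c)%N.
Hypothesis Hsticky : forall i, size (c_sticky c i) = c_S c /\
  all (fun k => (1 <= k <= c_K c)%N) (c_sticky c i).
Hypothesis HUL : forall i, (1 <= c_U1 c i <= c_K c)%N /\ (1 <= c_L1 c i <= c_K c)%N.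
Hypothesis HtbI : forall i t, past_measurable K X sg t.-1 (fun j' => (A j' < t)%N) (tbI i t).
Hypothesis HtbB : forall i j, past_measurable K X sg (A j) (fun j' => (j' < j)%N) (tbB i j).
Hypothesis HtbU : forall i j, past_measurable K X sg (A j) (fun j' => (j' <= j)%N) (tbU i j).
Hypothesis Hadv : forall i j, past_measurable K X sg (A j) (fun j' => (j' <= j)%N) (adv i j).
Hypothesis nu01 : forall k, (1 <= k <= K)%N -> nu k `[0%R, 1%R]%classic = 1%E.
Hypothesis mX : forall i t k, measurable_fun setT (X i t k).
Hypothesis lawX : forall i t k, (1 <= t)%N -> (1 <= k <= K)%N -> forall B : set R, measurable B ->
        P (X i t k @^-1` B) = nu k B.
Hypothesis msg : forall i j s, measurable (sg i j @^-1` [set s]).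
Hypothesis Hind : mutually_indep P K X sg.

Notation rzw := (rz X sg tbI tbB tbU adv).
Notation trr := (trw c X sg tbI tbB tbU adv).
Notation FIt := (FI c X sg).
Let armd := arm_dmeas A_lt K1 Hsticky HUL HtbI HtbB HtbU Hadv.

Definition dev i k t w : R := tsum c (rzw w) i t k - mean nu k * (cnt (trr w) i t k)%:R.
(** The compensator [l ^+ 2 / 8] is paid only when [k] is pulled, so sampling may be adaptive. *)
Definition Zt l i k t w : R := expR (l * dev i k t w - l ^+ 2 / 8 * (cnt (trr w) i t k)%:R).

Lemma past_measurable_fun t pj (f : Omega -> R) : measurable_fun setT (f : pastT K X sg t pj -> R) ->
  measurable_fun setT f.
Proof.
move=> hf _ B mB; have := hf measurableT B mB; rewrite !setTI.
exact: (past_measurable_all mX msg).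
Qed.

Lemma Zt_past l i k t : (1 <= k <= K)%N -> measurable_fun setT (Zt l i k t : FIt t.+1 -> R).
Proof.
move=> hk.
have mt : measurable_fun setT (fun w : FIt t.+1 => tsum c (rzw w) i t k).
  by apply: tsum_meas; [exact: hk|move=> s /andP[s1 _]; exact: armd|rewrite /=; lia|move=> j' /=; lia].
have mc : dmeas (fun w : FIt t.+1 => cnt (trr w) i t k).
  by apply: cnt_dmeas; [move=> s /andP[s1 _]; exact: armd|rewrite /=; lia|move=> j' /=; lia].
apply: (measurableT_comp (@measurable_expR R)); apply: measurable_funB.
  apply: measurable_funM => //; apply: measurable_funB => //.
  apply: measurable_funM => //; exact: (dmeas_fun_nat (fun x : nat => x%:R) mc).
apply: measurable_funM => //; exact: (dmeas_fun_nat (fun x : nat => x%:R) mc).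
Qed.

(** [Zt] at [t] and the event that [k] is pulled next belong to the past, while the reward is fresh:
    on that event the new factor has mean at most 1, elsewhere nothing changes. *)
Lemma Zt_step l i k t : (1 <= k <= K)%N ->
  (\int[P]_w (Zt l i k t.+1 w)%:E <= \int[P]_w (Zt l i k t w)%:E)%E.
Proof.
move=> hk; pose b w := arm_at c (rzw w) i t.+1 == k.
have mb : dmeas (b : FIt t.+1 -> bool).
  by apply: (@dmeas_comp _ (FIt t.+1) _ _ (fun x : nat => x == k)); exact: armd.
pose D1 w := (b w)%:R * Zt l i k t w; pose D2 w := (~~ b w)%:R * Zt l i k t w.
have mD1 : measurable_fun setT (D1 : FIt t.+1 -> R).
  apply: measurable_funM; last exact: Zt_past.
  exact: (dmeas_fun_nat (fun x : nat => x%:R) (dmeas_comp nat_of_bool mb)).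
have mD2 : measurable_fun setT (D2 : FIt t.+1 -> R).
  apply: measurable_funM; last exact: Zt_past.
  exact: (dmeas_fun_nat (fun x : nat => x%:R) (dmeas_comp (fun b : bool => nat_of_bool (~~ b)) mb)).
have mZ := past_measurable_fun (Zt_past l i (t := t) hk).
have mD1' := past_measurable_fun mD1; have mD2' := past_measurable_fun mD2.
have D10 w : 0 <= D1 w by rewrite mulr_ge0// expR_ge0.
have D20 w : 0 <= D2 w by rewrite mulr_ge0// expR_ge0.
pose h (x : R) := expR (l * (x - mean nu k) - l ^+ 2 / 8).
have mh : measurable_fun setT h.
  apply: (measurableT_comp (@measurable_expR R)); apply: measurable_funB => //.
  apply: measurable_funM => //; exact: measurable_funB.
have E1 : (\int[P]_w (Zt l i k t.+1 w)%:E = \int[P]_w ((D2 w)%:E + (D1 w * h (X i t.+1 k w))%:E))%E.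
  apply: eq_integral => w _; rewrite -EFinD; congr EFin.
  rewrite /Zt /dev tsumS /trw cntS' /D1 /D2 -/(b w); case: (b w) => /=.
    rewrite mul0r add0r !mul1r /h -expRD; congr expR; rewrite addn1 -natr1.
    rewrite /rz /= /dev /trw; ring.
  by rewrite !mul0r addr0 mul1r addr0 addn0.
have E2 : (\int[P]_w (D1 w * h (X i t.+1 k w))%:E = \int[P]_w (D1 w)%:E * \int[nu k]_x (h x)%:E)%E.
  have mid : measurable_fun setT (id : Omega -> FIt t.+1).
    by move=> _ B mB; rewrite setTI preimage_id; exact: (past_measurable_all mX msg mB).
  pose U : {mfun Omega >-> FIt t.+1} := HB.pack_for {mfun Omega >-> FIt t.+1} (id : Omega -> FIt t.+1)
     (isMeasurableFun.Build _ _ _ _ (id : Omega -> FIt t.+1) mid).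
  pose V : {mfun Omega >-> R} := HB.pack_for {mfun Omega >-> R} (X i t.+1 k)
     (isMeasurableFun.Build _ _ _ _ (X i t.+1 k) (mX i t.+1 k)).
  apply: (@indep_integral R _ _ Omega (FIt t.+1) P U V (nu k) D1 h mD1 D10 mh (fun=> expR_ge0 _)) => B C mB mC /=.
  have hJ j : (A j < t.+1)%N -> (j <= t)%N by rewrite ltnS; apply: leq_trans; exact: phaseA_ge.
  have := @past_indep _ _ _ _ _ P K X sg mX msg Hind t t _ hJ unit (fun=> PX i t.+1 k) (fun=> C) (fun=> setT).
  rewrite (_ : \bigcap_(y in _) _ = X i t.+1 k @^-1` C); last first.
    by apply/seteqP; split=> w /= h0; [exact: (h0 tt Logic.I)|move=> [] _].
  move=> ->//.
  - by rewrite lawX.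
  - by case=> -[].
  - by move=> [] [[[[i' s] k']|[i' j']] ?] //= [_ h1 _]; have := ltn_ord s; rewrite -h1 ltnn.
rewrite E1 ge0_integralD//; last 4 first.
- by move=> w _; rewrite lee_fin.
- exact/measurable_EFinP.
- by move=> w _; rewrite lee_fin mulr_ge0// expR_ge0.
- by apply/measurable_EFinP; apply: measurable_funM => //; exact: (measurableT_comp mh (mX _ _ _)).
rewrite E2.
have -> : (\int[P]_w (Zt l i k t w)%:E = \int[P]_w (D2 w)%:E + \int[P]_w (D1 w)%:E)%E.
  rewrite -ge0_integralD//; last 4 first.
  - by move=> w _; rewrite lee_fin.
  - exact/measurable_EFinP.
  - by move=> w _; rewrite lee_fin.
  - exact/measurable_EFinP.
  apply: eq_integral => w _; rewrite -EFinD; congr EFin; rewrite /D1 /D2.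
  by case: (b w); rewrite /= ?mul0r ?mul1r ?add0r ?addr0.
apply: leeD2l; rewrite -[leRHS]mule1; apply: lee_wpmul2l.
  by apply: integral_ge0 => w _; rewrite lee_fin.
exact: (hoeffding_lemma (nu01 hk) l).
Qed.

Lemma Zt_le1 l i k t : (1 <= k <= K)%N -> (\int[P]_w (Zt l i k t w)%:E <= 1)%E.
Proof.
move=> hk; elim: t => [|t IH]; last exact: le_trans (Zt_step _ _ _ hk) IH.
have -> : (\int[P]_w (Zt l i k 0 w)%:E = \int[P]_w (cst 1 w))%E; last first.
  by rewrite integral_cst// mul1e; exact: probability_le1.
apply: eq_integral => w _; rewrite /Zt /dev /tsum big_geq// /cnt /= !mulr0 subrr mulr0 subr0.
by rewrite expR0.
Qed.

(** The count is frozen at [q] so that the optimal tilt is deterministic; [s] is the side of the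
    deviation. *)
Definition tail (s : R) i k t q (y : R) : set Omega :=
  [set w | (cnt (trr w) i t k == q) && (y <= s * dev i k t w)].

Lemma dev_meas i k t : (1 <= k <= K)%N -> measurable_fun setT (dev i k t) /\
  dmeas (fun w => cnt (trr w) i t k).
Proof.
move=> hk.
have mc : dmeas (fun w : FIt t.+1 => cnt (trr w) i t k).
  by apply: cnt_dmeas; [move=> s /andP[s1 _]; exact: armd|rewrite /=; lia|move=> j' /=; lia].
split; last by move=> B; apply: (past_measurable_all mX msg); exact: mc.
apply: (@past_measurable_fun t (fun j' => (A j' < t.+1)%N)).
apply: measurable_funB.
  by apply: tsum_meas; [exact: hk|move=> s /andP[s1 _]; exact: armd|rewrite /=; lia|move=> j' /=; exact: ltnW].
apply: measurable_funM => //; exact: (dmeas_fun_nat (fun x : nat => x%:R) mc).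
Qed.

Lemma tail_measurable s i k t q y : (1 <= k <= K)%N -> measurable (tail s i k t q y).
Proof.
move=> hk; have [md mc] := dev_meas i t hk.
rewrite (_ : tail _ _ _ _ _ _ = (fun w => cnt (trr w) i t k) @^-1` [set q] `&` (fun w => s * dev i k t w) @^-1` `[y, +oo[%classic).
  apply: measurableI; first exact: mc.
  rewrite -[X in measurable X]setTI; have : measurable_fun setT (fun w => s * dev i k t w).
    by apply: measurable_funM.
  by apply => //; exact: measurable_itv.
apply/seteqP; split=> w /=; rewrite in_itv /= andbT.
  by move=> /andP[/eqP -> ->].
by move=> [h1 h2]; rewrite /tail /= h1 h2 eqxx.
Qed.

(** Chernoff bound with the tilt [4 * y / q], the minimiser of [l ^ 2 * q / 8 - l * y]. *)
Lemma tail_bound s i k t q y : (s = 1 \/ s = -1) -> (1 <= k <= K)%N -> (0 < q)%N -> 0 <= y ->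
  (P (tail s i k t q y) <= (expR (- (2 * y ^+ 2 / q%:R)))%:E)%E.
Proof.
move=> hs hk q0 y0; have q0' : 0 < q%:R :> R by rewrite ltr0n.
pose l := s * (4 * y / q%:R).
have l2 : l ^+ 2 = (4 * y / q%:R) ^+ 2 by rewrite /l exprMn; case: hs => ->; rewrite ?sqrrN expr1n mul1r.
pose e := expR (2 * y ^+ 2 / q%:R).
have e0 : 0 < e by exact: expR_gt0.
have mT := tail_measurable s i t q y hk.
have mZ := past_measurable_fun (Zt_past l i (t := t) hk).
suff : (e%:E * P (tail s i k t q y) <= 1)%E.
  have <- : (fine (P (tail s i k t q y)))%:E = P (tail s i k t q y) by rewrite fineK// fin_num_measure.
  rewrite -EFinM !lee_fin expRN -/e => h.
  by rewrite -[e^-1]mul1r ler_pdivlMr// mulrC.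
rewrite -[tail _ _ _ _ _ _]setIT -integral_indic// -ge0_integralZl//; last 2 first.
- by apply/measurable_EFinP; exact: measurable_indic.
- by rewrite lee_fin ltW.
apply: le_trans (Zt_le1 l i t hk); apply: ge0_le_integral => //.
- by move=> w _; rewrite -EFinM lee_fin mulr_ge0// ltW.
- by apply: measurable_funeM; apply/measurable_EFinP; exact: measurable_indic.
- exact/measurable_EFinP.
move=> w _; rewrite -EFinM lee_fin indicE; case: (boolP (w \in _)) => [|_]; last by rewrite mulr0 expR_ge0.
rewrite inE /tail /= mulr1 => /andP[/eqP hq hy]; rewrite /Zt hq l2 ler_expR /l.
have -> : s * (4 * y / q%:R) * dev i k t w = (4 * y / q%:R) * (s * dev i k t w) by ring.
have h : 4 * y / q%:R * y <= 4 * y / q%:R * (s * dev i k t w).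
  by rewrite ler_wpM2l// divr_ge0// mulr_ge0.
apply: le_trans (lerB h (lexx _)); rewrite le_eqVlt; apply/orP; left; apply/eqP; field.
by rewrite gt_eqF.
Qed.

End Concentration.

Lemma prob_bigU_const (R : realType) d (Omega : measurableType d) (P : probability Omega R)
  N (F : 'I_N -> set Omega) (B : R) : (forall i, measurable (F i)) ->
  (forall i, (P (F i) <= B%:E)%E) -> (P (\big[setU/set0]_(i < N) F i) <= (N%:R * B)%:E)%E.
Proof.
move=> mF hF; elim: N F mF hF => [|N IH] F mF hF; first by rewrite big_ord0 measure0 mul0r.
rewrite big_ord_recr /=; set U := \big[_/_]_(_ < _) _.
have mU : measurable U by exact: bigsetU_measurable.
apply: (@le_trans _ _ (P U + P (F ord_max))%E); first exact: measureU2.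
by rewrite -natr1 mulrDl mul1r EFinD leeD// IH.
Qed.

(** * Union bound for inaccurate estimates *)

Section BadEvents.
Context {R : realType} {d : measure_display} {Omega : measurableType d} {n m : nat}.
Variables (P : probability Omega R) (nu : nat -> probability R R).
Variables (c : config R n m) (X : 'I_n -> nat -> nat -> Omega -> R)
  (sg : 'I_n -> nat -> Omega -> {perm 'I_(n+m)}) (tbI tbB tbU adv : 'I_n -> nat -> Omega -> nat).
Notation trr := (trw c X sg tbI tbB tbU adv).
Variable eps : R.
Hypothesis eps01 : 0 <= eps <= 1.
Hypothesis alpha0 : 0 < c_alpha c.

Hypothesis tail_meas : forall s i k t q y, (1 <= k <= c_K c)%N ->
  measurable (tail nu c X sg tbI tbB tbU adv s i k t q y).
Hypothesis tail_bd : forall s i k t q y, (s = 1 \/ s = -1) -> (1 <= k <= c_K c)%N -> (0 < q)%N -> 0 <= y ->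
  (P (tail nu c X sg tbI tbB tbU adv s i k t q y) <= (expR (- (2 * y ^+ 2 / q%:R)))%:E)%E.

Definition bad t : set Omega := [set w | ~ clean_at (c_K c) (c_alpha c) eps (trr w) (mean nu) t].

(** The radius of [clean_at] times the number [q] of samples, as [dev] is not normalised. *)
Definition ytail t q : R := (1 - eps) * Num.sqrt (c_alpha c * ln t%:R * q%:R).

Let tl (b : bool) := tail nu c X sg tbI tbB tbU adv (if b then 1 else -1).

(** A finite union covering [bad], over agents, arms and possible counts; the latter two start at 1,
    hence the shifts. *)
Definition badU t : set Omega :=
  \big[setU/set0]_(i < n) \big[setU/set0]_(k < c_K c) \big[setU/set0]_(q < t.-1)
    (tl true i k.+1 t.-1 q.+1 (ytail t q.+1) `|` tl false i k.+1 t.-1 q.+1 (ytail t q.+1)).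

Lemma bad_sub t : (0 < t)%N -> bad t `<=` badU t.
Proof.
move=> t0 w /= hbad; apply: contrapT => hno; apply: hbad => i k hk c0.
rewrite leNgt; apply/negP => hlt; apply: hno.
set q := cnt _ _ _ _ in c0 hlt.
have qt : (q < t)%N.
  by rewrite -(prednK t0) ltnS; exact: cnt_le_time.
have kK : (k < (c_K c).+1)%N by lia.
have q0 : 0 < q%:R :> R by rewrite ltr0n.
have devE : dev nu c X sg tbI tbB tbU adv i k t.-1 w = (tmh (trr w) i t.-1 k - mean nu k) * q%:R.
  by rewrite /dev mulrBl /= divfK ?gt_eqF.
have yE : ytail t q = (1 - eps) * bonus (c_alpha c) t q * q%:R.
  have l0 : 0 <= c_alpha c * ln t%:R by rewrite mulr_ge0 ?ln_ge0 ?ler1n// ltW.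
  rewrite /ytail /bonus -[RHS]mulrA; congr (_ * _).
  rewrite -[X in _ = _ * X]ger0_norm// -sqrtr_sqr -sqrtrM ?divr_ge0//; congr Num.sqrt.
  by field; rewrite gt_eqF.
have mem : tl true i k t.-1 q (ytail t q) w \/ tl false i k t.-1 q (ytail t q) w -> badU t w.
  move=> hb; rewrite /badU -bigcup_seq; exists i; first exact: mem_index_enum.
  have k1 : (k.-1 < c_K c)%N by lia.
  rewrite -bigcup_seq; exists (Ordinal k1); first exact: mem_index_enum.
  have q1 : (q.-1 < t.-1)%N by lia.
  rewrite -bigcup_seq; exists (Ordinal q1); first exact: mem_index_enum.
  rewrite /=.
  by rewrite !prednK//; lia.
have [h|h] := leP 0 (tmh (trr w) i t.-1 k - mean nu k).
  apply: mem; left; rewrite /tl /tail /= eqxx /= mul1r devE yE ler_pM2r//; apply: ltW.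
  by rewrite ger0_norm in hlt.
apply: mem; right; rewrite /tl /tail /= eqxx /= mulN1r devE yE -mulNr ler_pM2r//; apply: ltW.
by rewrite ltr0_norm in hlt.
Qed.

Lemma badU_measurable t : measurable (badU t).
Proof.
apply: bigsetU_measurable => i _; apply: bigsetU_measurable => k _.
by apply: bigsetU_measurable => q _; apply: measurableU; apply: tail_meas => /=; rewrite ltn_ord.
Qed.

(** The union over counts costs a factor [t], which is the 1 in the exponent. *)
Lemma badU_prob t : (0 < t)%N ->
  (P (badU t) <= (2 * n%:R * (c_K c)%:R * t%:R `^ (1 - 2 * c_alpha c * (1 - eps) ^+ 2))%:E)%E.
Proof.
move=> t0; have t0' : 0 < t%:R :> R by rewrite ltr0n.
have l0 : 0 <= ln t%:R :> R by rewrite ln_ge0// ler1n.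
have a0 := ltW alpha0.
pose B := t%:R `^ (- (2 * c_alpha c * (1 - eps) ^+ 2)).
have B0 : 0 <= B by exact: powR_ge0.
have hx b i k q : (k < c_K c)%N -> (P (tl b i k.+1 t.-1 q.+1 (ytail t q.+1)) <= B%:E)%E.
  move=> kv; have q0' : 0 < q.+1%:R :> R by rewrite ltr0n.
  have y0 : 0 <= ytail t q.+1.
    by rewrite /ytail mulr_ge0 ?sqrtr_ge0// subr_ge0; case/andP: eps01.
  rewrite /tl; apply: (le_trans (tail_bd _ _ _ _ _ y0)) => //; first by case: (b); [left|right].
  rewrite lee_fin /B /powR gt_eqF//= ler_expR /ytail exprMn sqr_sqrtr ?mulr_ge0//.
  rewrite mulNr lerN2 le_eqVlt; apply/orP; left; apply/eqP; field; by rewrite gt_eqF.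
have mU k q b i : (k < c_K c)%N -> measurable (tl b i k.+1 t.-1 q.+1 (ytail t q.+1)).
  by move=> kv; apply: tail_meas.
apply: le_trans (_ : (n%:R * ((c_K c)%:R * ((t.-1)%:R * (B + B))))%:E <= _)%E.
  apply: prob_bigU_const => [i|i].
    by apply: bigsetU_measurable => k _; apply: bigsetU_measurable => q _; apply: measurableU; exact: mU.
  apply: prob_bigU_const => [k|k].
    by apply: bigsetU_measurable => q _; apply: measurableU; exact: mU.
  apply: prob_bigU_const => [q|q]; first by apply: measurableU; exact: mU.
  set U1 := tl true _ _ _ _ _; set U2 := tl false _ _ _ _ _.
  apply: (@le_trans _ _ (P U1 + P U2)%E); first by apply: measureU2; exact: mU.
  by rewrite EFinD leeD// hx.
rewrite lee_fin.
have -> : t%:R `^ (1 - 2 * c_alpha c * (1 - eps) ^+ 2) = t%:R * B.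
  by rewrite powRD ?powRr1//; apply/implyP => _; rewrite gt_eqF.
have -> : 2 * n%:R * (c_K c)%:R * (t%:R * B) = n%:R * ((c_K c)%:R * (t%:R * (B + B))) by ring.
rewrite !ler_wpM2l// ler_wpM2r ?addr_ge0// ler_nat; exact: leq_pred.
Qed.

End BadEvents.

(** * Communication *)

Lemma disc_integral (R : realType) d (Omega : measurableType d) (P : probability Omega R)
  (T : finType) (Y : Omega -> T) (phi : T -> R) : dmeas Y -> (forall y, 0 <= phi y) ->
  (\int[P]_w (phi (Y w))%:E = \sum_(y : T) (phi y)%:E * P (Y @^-1` [set y]))%E.
Proof.
move=> mY p0.
transitivity (\int[P]_w (\sum_(y : T) (phi y)%:E * (\1_(Y @^-1` [set y]) w)%:E))%E.
  apply: eq_integral => w _; rewrite (bigD1 (Y w))//= big1 ?adde0.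
    by rewrite indicE mem_set// mule1.
  by move=> y yw; rewrite indicE memNset ?mule0// => /= h; rewrite h eqxx in yw.
rewrite ge0_integral_sum//; last 2 first.
- by move=> y; apply: measurable_funeM; apply/measurable_EFinP; apply: measurable_indic; exact: mY.
- by move=> y w _; rewrite -EFinM lee_fin mulr_ge0.
apply: eq_bigr => y _; rewrite ge0_integralZl//.
- by rewrite integral_indic ?setIT//; exact: mY.
- by apply/measurable_EFinP; apply: measurable_indic; exact: mY.
- by rewrite lee_fin.
Qed.

Lemma dmeas_ffun d (O : measurableType d) (J : finType) (T : finType) (f : O -> J -> T) :
  (forall i, dmeas (f ^~ i)) -> dmeas (fun w => [ffun i => f w i] : {ffun J -> T}).
Proof.
move=> hf B; rewrite (_ : _ @^-1` _ = \bigcup_(g in B) \bigcap_(i in [set: J]) ((f ^~ i) @^-1` [set g i])).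
  apply: fin_bigcup_measurable; first exact: finite_finset.
  by move=> g _; apply: fin_bigcap_measurable; [exact: finite_finset|move=> i _; exact: hf].
apply/seteqP; split=> w /=.
  by move=> h; exists [ffun i => f w i] => // i _ /=; rewrite ffunE.
case=> g Bg hg; suff -> : [ffun i => f w i] = g by [].
by apply/ffunP => i; rewrite ffunE; exact: (hg i Logic.I).
Qed.

Lemma dmeas_pair d (O : measurableType d) (T T' : finType) (f : O -> T) (g : O -> T') :
  dmeas f -> dmeas g -> dmeas (fun w => (f w, g w)).
Proof. exact: (@dmeas_comp2 _ O _ _ _ (fun a b => (a, b)) f g). Qed.

Section Communication.
Context {R : realType} {d : measure_display} {Omega : measurableType d} {n m : nat}.
Variables (P : probability Omega R).
Variables (c : config R n m) (X : 'I_n -> nat -> nat -> Omega -> R)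
  (sg : 'I_n -> nat -> Omega -> {perm 'I_(n+m)}) (tbI tbB tbU adv : 'I_n -> nat -> Omega -> nat).
Let K := c_K c.
Let A := phaseA (c_beta c).
Let adj := c_adj c.
Hypothesis A_lt : forall j, (A j < A j.+1)%N.
Hypothesis K1 : (1 <= c_K c)%N.
Hypothesis Hsticky : forall i, size (c_sticky c i) = c_S c /\
  all (fun k => (1 <= k <= c_K c)%N) (c_sticky c i).
Hypothesis HUL : forall i, (1 <= c_U1 c i <= c_K c)%N /\ (1 <= c_L1 c i <= c_K c)%N.
Hypothesis HtbI : forall i t, past_measurable K X sg t.-1 (fun j' => (A j' < t)%N) (tbI i t).
Hypothesis HtbB : forall i j, past_measurable K X sg (A j) (fun j' => (j' < j)%N) (tbB i j).
Hypothesis HtbU : forall i j, past_measurable K X sg (A j) (fun j' => (j' <= j)%N) (tbU i j).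
Hypothesis Hadv : forall i j, past_measurable K X sg (A j) (fun j' => (j' <= j)%N) (adv i j).
Hypothesis mX : forall i t k, measurable_fun setT (X i t k).
Hypothesis msg : forall i j s, measurable (sg i j @^-1` [set s]).
Hypothesis Hind : mutually_indep P K X sg.
Hypothesis Hsg : forall i j s, (1 <= j)%N -> P (sg i j @^-1` [set s]) = (((n + m)`!)%:R^-1)%:E.

Notation rzw := (rz X sg tbI tbB tbU adv).
Notation trr := (trw c X sg tbI tbB tbU adv).
Notation FBj := (FB c X sg).
Notation FEj := (FE c X sg).
Notation perms := ({ffun 'I_n -> {perm 'I_(n+m)}}).
Let fi : R := (((n + m)`!)%:R^-1).

Lemma fi_ge0 : 0 <= fi. Proof. by rewrite invr_ge0. Qed.

Lemma fi_sum : \sum_(s : {perm 'I_(n+m)}) fi = 1.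
Proof.
rewrite sumr_const -mulr_natl (_ : #|_| = (n+m)`!); last by rewrite -(card_Sn (n+m)).
by rewrite divff// pnatr_eq0 -lt0n fact_gt0.
Qed.

Lemma sgvec_dmeas j : dmeas (fun w => [ffun i => sg i j w] : perms).
Proof. by apply: dmeas_ffun => i; exact: (sg_dmeas msg). Qed.

Lemma sgvec_indep j B (s : perms) : measurable (B : set (FBj j.+1)) ->
  P (B `&` (fun w => [ffun i => sg i j.+1 w] : perms) @^-1` [set s]) = (P B * (\prod_(i < n) fi)%:E)%E.
Proof.
move=> mB.
have hJ j' : (j' < j.+1)%N -> (j' <= j.+1)%N by exact: ltnW.
pose fn (i : 'I_n) : pidx n := PV i j.+1.
have fn_inj : injective fn by move=> i i' [].
have E : (fun w => [ffun i => sg i j.+1 w] : perms) @^-1` [set s] =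
    \bigcap_(i in [set: 'I_n]) pevent X sg setT [set s i] (fn i).
  apply/seteqP; split=> w /=; first by move=> <- i _ /=; rewrite ffunE.
  by move=> h; apply/ffunP => i; rewrite ffunE; exact: (h i Logic.I).
rewrite E (@past_indep _ _ _ _ _ P K X sg mX msg Hind (A j.+1) j.+1 _ hJ 'I_n fn (fun=> setT) (fun i => [set s i]))//; last first.
  by move=> i [[[[i' s'] k]|[i' j']] /= hv] //= [_ h]; move: hv; rewrite -h ltnn andbF.
congr (_ * _)%E; rewrite (@indep_fin _ _ _ _ _ P K X sg Hind 'I_n fn (fun=> setT) (fun i => [set s i]))//.
rewrite (eq_bigr (fun=> fi%:E)); last by move=> i _; rewrite /= Hsg.
by elim/big_rec2: _ => // i x y _ ->; rewrite EFinM.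
Qed.

Lemma FB_measurable j B : measurable (B : set (FBj j)) -> measurable (B : set Omega).
Proof. exact: (past_measurable_all mX msg). Qed.

Lemma FB_dmeas T j (f : Omega -> T) : dmeas (f : FBj j -> T) -> dmeas f.
Proof. by move=> h B; apply: FB_measurable; exact: h. Qed.

(** Integrates out the uniform orderings of phase [j.+1], independent of [FB j.+1]; it stands in for
    conditional expectation. *)
Lemma step_integral j (T : finType) (Y : Omega -> T) (phi : T -> perms -> R) :
  dmeas (Y : FBj j.+1 -> T) -> (forall y s, 0 <= phi y s) ->
  (\int[P]_w (phi (Y w) [ffun i => sg i j.+1 w])%:E =
   \int[P]_w (\sum_(s : perms) (\prod_(i < n) fi) * phi (Y w) s)%:E)%E.
Proof.
move=> mY p0; have mY' := FB_dmeas mY.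
have w0 : 0 <= \prod_(i < n) fi by apply: prodr_ge0 => i _; exact: fi_ge0.
rewrite (@disc_integral _ _ _ P _ (fun w => (Y w, [ffun i => sg i j.+1 w] : perms)) (fun z => phi z.1 z.2))//; last first.
  by apply: dmeas_pair => //; exact: sgvec_dmeas.
rewrite (@disc_integral _ _ _ P _ Y (fun y => \sum_(s : perms) (\prod_(i < n) fi) * phi y s))//; last first.
  by move=> y; apply: sumr_ge0 => s _; rewrite mulr_ge0.
transitivity (\sum_(y : T) \sum_(s : perms) (phi y s)%:E * P ((fun w => (Y w, [ffun i => sg i j.+1 w] : perms)) @^-1` [set (y, s)]))%E.
  by rewrite pair_bigA /=; apply: eq_bigr => -[].
apply: eq_bigr => y _; rewrite -sumEFin ge0_sume_distrl; last first.
  by move=> s _; rewrite lee_fin mulr_ge0.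
apply: eq_bigr => s _.
rewrite (_ : _ @^-1` _ = Y @^-1` [set y] `&` (fun w => [ffun i => sg i j.+1 w] : perms) @^-1` [set s]); last first.
  by apply/seteqP; split=> w /=; [move=> [-> ->]|move=> [-> ->]].
rewrite sgvec_indep; last exact: mY.
by rewrite [in RHS]EFinM (muleC (P _)) muleA (muleC (phi y s)%:E).
Qed.

Lemma marginal (a : 'I_n) (F : {perm 'I_(n+m)} -> R) :
  \sum_(s : perms) (\prod_(i < n) fi) * F (s a) = \sum_(x : {perm 'I_(n+m)}) fi * F x.
Proof.
transitivity (\sum_(s : perms) \prod_(i < n) (fi * (if i == a then F (s i) else 1))).
  apply: eq_bigr => s _; rewrite big_split /=; congr (_ * _).
  by rewrite (bigD1 a)//= eqxx big1 ?mulr1// => i /negbTE ->.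
rewrite -(bigA_distr_bigA (fun i x => fi * (if i == a then F x else 1))) /= (bigD1 a)//=.
rewrite [X in _ * X]big1 ?mulr1; first by apply: eq_bigr => x _; rewrite eqxx.
by move=> i /negbTE ia; under eq_bigr do rewrite ia mulr1; exact: fi_sum.
Qed.

Let simm j := sim_measurable A_lt K1 Hsticky HUL HtbI HtbB HtbU Hadv j.

Lemma blkB_dmeas i j : dmeas (fun w : FBj j.+1 => tblk (trr w) i j.+1).
Proof.
have [h1 h2] := simm j; have [_ h3] := simm j.+1.
exact: (blk_dmeas A_lt K1 HtbB h1 h3 i j.+1).
Qed.

Lemma tH_dmeas i p j : (p <= j)%N -> dmeas (fun w : FEj j => tH (trr w) i p).
Proof.
move=> pj; have [h1 _] := simm p; have hH := sm_H (h1 i) p.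
apply: (past_dmeas_sub _ _ hH); first exact: (phaseA_le A_lt).
by move=> j'; lia.
Qed.

Lemma tblk_dmeas i p j : (p <= j)%N -> dmeas (fun w : FEj j => tblk (trr w) i p).
Proof.
move=> pj; have [h1 _] := simm p; have hH := sm_blk (h1 i) p.
apply: (past_dmeas_sub _ _ hH); first exact: (phaseA_le A_lt).
by move=> j'; lia.
Qed.

Lemma FE_FB T j (f : Omega -> T) : dmeas (f : FEj j -> T) -> dmeas (f : FBj j.+1 -> T).
Proof. by apply: past_dmeas_sub => //; rewrite ltnW. Qed.

Definition hfail a q (i' i : 'I_n) w : bool :=
  all (fun q' => (lshift m i \notin tblk (trr w) i' q') && (tH (trr w) i' q' != Some (lshift m i)))
    (iota a.+1 (q - a)).

Lemma hfail_dmeas a q j i' i : (q <= j)%N -> dmeas (hfail a q i' i : FEj j -> bool).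
Proof.
move=> qj; apply: dmeas_all => p; rewrite mem_iota => hp.
have pj : (p <= j)%N by lia.
apply: (@dmeas_comp2 _ (FEj j) _ _ _ (fun (B : {set 'I_(n+m)}) (H : option 'I_(n+m)) =>
  (lshift m i \notin B) && (H != Some (lshift m i)))); first exact: tblk_dmeas.
exact: tH_dmeas.
Qed.

Lemma choose_HE i j w : tH (trr w) i j.+1 =
  first_in [set h | adj (lshift m i) h & h \notin tblk (trr w) i j.+1]%SET ([ffun i0 => sg i0 j.+1 w] i).
Proof. by rewrite /trw tHE /choose_H /first_in ffunE. Qed.

Lemma avail_le i (B : {set 'I_(n+m)}) :
  (#|[set h | adj (lshift m i) h & h \notin B]%SET| <= deg adj i)%N.
Proof. by apply: subset_leq_card; apply/fintype.subsetP => h; rewrite !inE => /andP[]. Qed.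

(** Given the past, either [i] is blocked, which ends the failure, or [i] is one of at most [deg]
    available neighbours and is drawn with probability at least [1 / deg]. Counting a block as
    hearing makes the bound valid whatever the block lists are. *)
Lemma hfail_prob a q i' i : adj (lshift m i') (lshift m i) -> (a <= q)%N ->
  (\int[P]_w ((hfail a q i' i w)%:R)%:E <= ((1 - (deg adj i')%:R^-1) ^+ (q - a))%:E)%E.
Proof.
move=> hadj; elim: q => [|q IH].
  rewrite leqn0 => /eqP ->; rewrite subnn expr0.
  apply: (@le_trans _ _ (\int[P]_w (cst 1%E w))%E); last by rewrite integral_cst// mul1e probability_le1.
  apply: ge0_le_integral; first by [].
  - by move=> w _; rewrite lee_fin.
  - apply/measurable_EFinP; apply: (dmeas_fun_nat (fun x : nat => x%:R)).
    by apply: (dmeas_comp nat_of_bool); apply: (@FB_dmeas _ 1); apply: FE_FB; exact: hfail_dmeas.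
  - by apply/measurable_EFinP.
  - by move=> w _; rewrite lee_fin; case: hfail.
have dg0 : (0 < deg adj i')%N by apply/card_gt0P; exists (lshift m i); rewrite inE.
have dgi : 0 <= (1 - (deg adj i')%:R^-1) :> R.
  by rewrite subr_ge0 invf_le1 ?ltr0n// ler1n.
rewrite leq_eqVlt => /orP[/eqP <-|].
  rewrite subnn expr0; apply: (@le_trans _ _ (\int[P]_w (cst 1%E w))%E); last by rewrite integral_cst// mul1e probability_le1.
  apply: ge0_le_integral; first by [].
  - by move=> w _; rewrite lee_fin.
  - apply/measurable_EFinP; apply: (dmeas_fun_nat (fun x : nat => x%:R)).
    by apply: (dmeas_comp nat_of_bool); apply: (@FB_dmeas _ a.+1); apply: FE_FB; exact: hfail_dmeas.
  - by apply/measurable_EFinP.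
  - by move=> w _; rewrite lee_fin; case: hfail.
rewrite ltnS => aq; rewrite subSn// exprSr.
pose h := lshift m i.
pose V (B : {set 'I_(n+m)}) := [set x | adj (lshift m i') x & x \notin B]%SET.
pose Y w := (hfail a q i' i w, tblk (trr w) i' q.+1).
have mY : dmeas (Y : FBj q.+1 -> _).
  apply: dmeas_pair; last exact: blkB_dmeas.
  by apply: FE_FB; exact: hfail_dmeas.
pose phi (y : bool * {set 'I_(n+m)}) (s : perms) : R := ([&& y.1, h \notin y.2 & first_in (V y.2) (s i') != Some h])%:R.
have E w : ((hfail a q.+1 i' i w)%:R : R) = phi (Y w) [ffun i => sg i q.+1 w].
  rewrite /phi /Y /hfail subSn// -(addn1 (q - a)) iotaD all_cat (_ : iota _ 1 = [:: (a.+1 + (q - a))%N])//.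
  by rewrite all_seq1 addSn subnKC// (choose_HE i' q w).
under eq_integral do rewrite E.
rewrite step_integral//.
apply: (@le_trans _ _ (\int[P]_w ((1 - (deg adj i')%:R^-1)%:E * ((hfail a q i' i w)%:R)%:E))%E); last first.
  rewrite ge0_integralZl//.
  - by rewrite [X in (_ <= X)%E]EFinM muleC; apply: lee_wpmul2r; [rewrite lee_fin|exact: IH].
  - apply/measurable_EFinP; apply: (dmeas_fun_nat (fun x : nat => x%:R)).
    by apply: (dmeas_comp nat_of_bool); apply: (@FB_dmeas _ q.+1); apply: FE_FB; exact: hfail_dmeas.
have S0 w : 0 <= \sum_(s : perms) (\prod_(i0 < n) fi) * phi (Y w) s.
  by apply: sumr_ge0 => s _; rewrite mulr_ge0//; apply: prodr_ge0 => i0 _; exact: fi_ge0.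
apply: ge0_le_integral; first by [].
- by move=> w _; rewrite lee_fin.
- apply/measurable_EFinP.
  have mY' := FB_dmeas mY.
  by move=> _ B mB; rewrite setTI; exact: (mY' ((fun y => \sum_(s : perms) (\prod_(i0 < n) fi) * phi y s) @^-1` B)).
- apply: measurable_funeM; apply/measurable_EFinP; apply: (dmeas_fun_nat (fun x : nat => x%:R)).
  by apply: (dmeas_comp nat_of_bool); apply: (@FB_dmeas _ q.+1); apply: FE_FB; exact: hfail_dmeas.
move=> w _; rewrite -EFinM lee_fin /phi.
rewrite (marginal i' (fun x => ([&& (Y w).1, h \notin (Y w).2 & first_in (V (Y w).2) x != Some h])%:R)).
rewrite /Y; move: (tblk _ _ _) => B /=; case: (hfail a q i' i w) => /=; last first.
  by rewrite mulr0 big1// => x _; rewrite mulr0.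
rewrite mulr1; case: (boolP (h \notin B)) => hB /=; last first.
  by rewrite big1// => x _; rewrite mulr0.
have hV : h \in V B by rewrite inE hB andbT.
apply: (@le_trans _ _ (1 - (#|V B|%:R)^-1)).
  rewrite -(prob_first_in R hV) -[X in X - _]fi_sum -sumrB; apply: ler_sum => x _.
  by rewrite -/fi; case: eqP => _; rewrite /= ?mulr0 ?mulr1 ?subr0 ?subrr.
have V0 : (0 < #|V B|)%N by apply/card_gt0P; exists h.
rewrite lerD2l lerN2 lef_pV2 ?posrE ?ltr0n// ler_nat; exact: avail_le.
Qed.

Definition informed w q : {set 'I_n} := [set i | 1%N \in tact (trr w) i q]%SET.

Lemma tact_dmeas i j : dmeas (fun w : FEj j => tact (trr w) i j.+1).
Proof.
have [h1 _] := simm j.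
exact: (active_dmeas (h1 i)).
Qed.

Lemma informed_dmeas j : dmeas (fun w : FBj j.+1 => informed w j.+1).
Proof.
apply: FE_FB; pose F w : {ffun 'I_n -> bool} := [ffun i => 1%N \in tact (trr w) i j.+1].
rewrite (_ : (fun w => _) = (fun w : FEj j => [set i | F w i]%SET)); last first.
  by apply: funext => w; apply/setP => i; rewrite !inE ffunE.
apply: (@dmeas_comp _ (FEj j) _ _ (fun f : {ffun 'I_n -> bool} => [set i | f i]%SET) F).
apply: dmeas_ffun => i.
by move=> B; exact: (@tact_dmeas i j ((fun s : seq nat => 1%N \in s) @^-1` B)).
Qed.

Variable istar : 'I_n.
Notation rumg := (rum adj istar).

Lemma rumM_decr (g : {set 'I_n} -> R) : (forall B B' : {set 'I_n}, B \subset B' -> g B' <= g B) ->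
  forall B B' : {set 'I_n}, B \subset B' -> rumM adj g B' <= rumM adj g B.
Proof.
move=> gd B B' BB'; apply: ler_sum => o _; apply: ler_wpM2l.
  by apply: prodr_ge0 => i _; exact: owt_ge0.
apply: gd; apply/fintype.subsetP => i; rewrite !inE => /orP[/(fintype.subsetP BB') ->//|].
by case/and3P=> _ -> /(fintype.subsetP BB') ->; rewrite andbT; case: (i \in B').
Qed.

Lemma rumM_bern (g : {set 'I_n} -> R) I : rumM adj g I =
  bern (fun i => \sum_(o : bool * 'I_n | [&& i \notin I, o.1 & o.2 \in I]) owt adj i o) (fun B => g (I :|: B)).
Proof.
exact: (product_bern (fun i (o : bool * 'I_n) => [&& i \notin I, o.1 & o.2 \in I])
  (fun B => g (I :|: B)) (owt_sum (R := R) adj)).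
Qed.

(** An available honest neighbour is drawn with probability [1 / #|V|], at least [1 / deg]; this is
    [deg_hon / deg] times [1 / deg_hon], hence at least [Upsilon] times its weight in the rumor
    process. *)
Lemma hear_weight (I : {set 'I_n}) (V : {set 'I_(n+m)}) i :
  (forall h : 'I_n, adj (lshift m i) (lshift m h) -> lshift m h \in V) ->
  (#|V| <= deg adj i)%N ->
  \sum_(o : bool * 'I_n | [&& i \notin I, o.1 & o.2 \in I]) owt adj i o <=
  \sum_(x | [exists h in I, first_in V x == Some (lshift m h)]) fi :> R.
Proof.
move=> hV Vd; have /andP[U0 U1] := Upsilon01 (R := R) adj.
have R0 : 0 <= \sum_(x | [exists h in I, first_in V x == Some (lshift m h)]) fi.
  by apply: sumr_ge0 => x _; exact: fi_ge0.
case: (boolP (i \in I)) => iI; first by rewrite big_pred0.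
have -> : \sum_(x | [exists h in I, first_in V x == Some (lshift m h)]) fi =
    \sum_(h in I) \sum_(x : {perm 'I_(n+m)}) fi * (first_in V x == Some (lshift m h))%:R.
  rewrite exchange_big /= big_mkcond /=; apply: eq_bigr => x _.
  case: (boolP [exists h in I, _]) => [/existsP[h /andP[hI /eqP hx]]|/existsPn hn].
    rewrite (bigD1 h)//= hx eqxx mulr1 big1 ?addr0// => h' /andP[_ hh].
    by case: eqP => [[] /ord_inj e|]; rewrite ?mulr0//; rewrite e eqxx in hh.
  by rewrite big1// => h hI; have := hn h; rewrite hI /= => /negbTE ->; rewrite mulr0.
have -> : \sum_(o : bool * 'I_n | [&& true, o.1 & o.2 \in I]) owt adj i o =
    \sum_(h in I) Upsilon R adj * hbar_w R adj i h.
  transitivity (\sum_(b : bool | b) \sum_(h < n | h \in I) (owt adj i (b, h) : R)).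
    by rewrite pair_big_dep /=; apply: eq_bigr => -[].
  by rewrite big_mkcond big_bool /= addr0.
apply: ler_sum => h hI.
have S0 : 0 <= \sum_(x : {perm 'I_(n+m)}) fi * (first_in V x == Some (lshift m h))%:R.
  by apply: sumr_ge0 => x _; rewrite mulr_ge0// fi_ge0.
rewrite /hbar_w; case: (eqVneq (deg_hon adj i) 0%N) => [_|d0].
  by case: eqP => [e|_]; rewrite ?mulr0//; rewrite -e hI in iI.
case: (boolP (adj_hon adj i h)) => [ah|_]; last by rewrite mul0r mulr0.
have hv := hV h ah; rewrite (prob_first_in R hv) mul1r.
have V0 : (0 < #|V|)%N by apply/card_gt0P; exists (lshift m h).
apply: (@le_trans _ _ ((deg adj i)%:R^-1)); last first.
  by rewrite lef_pV2 ?posrE ?ltr0n ?ler_nat//; lia.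
rewrite ler_pdivrMr ?ltr0n ?lt0n// mulrC; exact: Upsilon_le.
Qed.

(** Induction on [r] for all decreasing [g] at once. The orderings of the latest phase are
    integrated out given its past; the agents contacting an informed neighbour then form a Bernoulli
    set whose parameters, on [E], dominate those of [rumM]. By [bern_mono] one may pass to
    [rumM adj g], which is again decreasing, so no coupling has to be built. *)
Lemma rumor_domination (E : nat -> Omega -> bool) s0 : (0 < s0)%N ->
  (forall q, dmeas (E q.+1 : FBj q.+1 -> bool)) ->
  (forall q w, (s0 <= q)%N -> E q.+1 w -> E q w) ->
  (forall q w i, (s0 <= q)%N -> E q w -> i \in informed w q -> i \in informed w q.+1) ->
  (forall q w i h, (s0 <= q)%N -> E q w -> tH (trr w) i q = Some (lshift m h) ->
     h \in informed w q -> i \in informed w q.+1) ->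
  (forall q w i h, (s0 <= q)%N -> E q w -> lshift m h \notin tblk (trr w) i q) ->
  (forall w, istar \in informed w s0) ->
  forall r (g : {set 'I_n} -> R), (forall B, 0 <= g B) ->
  (forall B B' : {set 'I_n}, B \subset B' -> g B' <= g B) ->
  (\int[P]_w ((E (s0 + r)%N w)%:R * g (informed w (s0 + r)))%:E <= (rumg r g)%:E)%E.
Proof.
move=> s00 mE ES stay spread nb hstar.
have mEg q (g : {set 'I_n} -> R) : measurable_fun setT (fun w => (E q.+1 w)%:R * g (informed w q.+1)).
  have mY := dmeas_pair (FB_dmeas (mE q)) (FB_dmeas (@informed_dmeas q)).
  by move=> _ B mB; rewrite setTI; exact: (mY ((fun y : bool * {set 'I_n} => (y.1)%:R * g y.2) @^-1` B)).
elim=> [|r IH] g g0 gd.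
  rewrite addn0 rum0; case: s0 s00 hstar {ES stay spread nb} => // s1 _ hstar.
  apply: (@le_trans _ _ (\int[P]_w (cst (g [set istar]%SET)%:E w))%E); last first.
    rewrite integral_cst//; apply: (@le_trans _ _ ((g [set istar]%SET)%:E * 1)%E); last by rewrite mule1.
    by apply: lee_wpmul2l; [rewrite lee_fin|exact: probability_le1].
  apply: ge0_le_integral; first by [].
  - by move=> w _; rewrite lee_fin mulr_ge0.
  - by apply/measurable_EFinP.
  - by apply/measurable_EFinP.
  move=> w _; rewrite lee_fin; apply: (@le_trans _ _ (1 * g (informed w s1.+1))).
    by apply: ler_wpM2r => //; case: (E _ _).
  by rewrite mul1r; apply: gd; rewrite finset.sub1set.
rewrite rum_S addnS; set q := (s0 + r)%N in IH *.
have sq : (s0 <= q)%N by rewrite leq_addr.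
have [q' q'E] : exists q', q = q'.+1 by exists q.-1; rewrite prednK//; lia.
apply: (@le_trans _ _ (\int[P]_w ((E q w)%:R * rumM adj g (informed w q))%:E)%E); last first.
  apply: IH; first by move=> B; apply: sumr_ge0 => o _; rewrite mulr_ge0//; apply: prodr_ge0 => i _; exact: owt_ge0.
  exact: rumM_decr.
pose V (i : 'I_n) (B : {set 'I_(n+m)}) := [set x | adj (lshift m i) x & x \notin B]%SET.
pose Y w := (E q w, (informed w q, [ffun i => tblk (trr w) i q] : {ffun 'I_n -> {set 'I_(n+m)}})).
have mY : dmeas (Y : FBj q -> _).
  rewrite /Y q'E; apply: dmeas_pair; first exact: mE.
  by apply: dmeas_pair; [exact: informed_dmeas|apply: dmeas_ffun => i; exact: blkB_dmeas].
pose be (I : {set 'I_n}) (b : {ffun 'I_n -> {set 'I_(n+m)}}) i (x : {perm 'I_(n+m)}) :=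
  [exists h in I, first_in (V i (b i)) x == Some (lshift m h)].
pose phi (y : bool * ({set 'I_n} * {ffun 'I_n -> {set 'I_(n+m)}})) (s : perms) : R :=
  (y.1)%:R * g (y.2.1 :|: [set i | be y.2.1 y.2.2 i (s i)]).
have phi0 y s : 0 <= phi y s by rewrite mulr_ge0.
(* [E q.+1] is relaxed to [E q], which is known before the orderings of phase [q] are drawn. *)
apply: (@le_trans _ _ (\int[P]_w (phi (Y w) [ffun i => sg i q w])%:E)%E).
  apply: ge0_le_integral; first by [].
  - by move=> w _; rewrite lee_fin mulr_ge0.
  - by apply/measurable_EFinP.
  - apply/measurable_EFinP.
    have mZ := dmeas_pair (FB_dmeas (j := q) mY) (sgvec_dmeas q).
    by move=> _ B mB; rewrite setTI; exact: (mZ ((fun z => phi z.1 z.2) @^-1` B)).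
  move=> w _; rewrite lee_fin /phi /Y /=.
  case Eq1 : (E q.+1 w); last by rewrite mul0r mulr_ge0.
  have Eq := ES q w sq Eq1; rewrite Eq; apply: ler_wpM2l => //; apply: gd.
  apply/fintype.subsetP => i; rewrite finset.in_setU => /orP[|]; first exact: stay.
  rewrite finset.in_set => /existsP[h /andP[hI /eqP hx]].
  apply: (spread q w i h) => //; rewrite q'E choose_HE -q'E.
  by rewrite -hx; congr first_in; apply/setP => x; rewrite !inE ffunE.
rewrite q'E in mY *; rewrite step_integral//.
apply: ge0_le_integral; first by [].
- move=> w _; rewrite lee_fin; apply: sumr_ge0 => s _; rewrite mulr_ge0//.
  by apply: prodr_ge0 => i0 _; exact: fi_ge0.
- apply/measurable_EFinP; have mY' := FB_dmeas mY.
  by move=> _ B mB; rewrite setTI; exact: (mY' ((fun y => \sum_(s : perms) (\prod_(i0 < n) fi) * phi y s) @^-1` B)).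
- by apply/measurable_EFinP.
move=> w _; rewrite lee_fin /phi /Y -q'E; set b := [ffun i => _]; rewrite /=.
case Eq : (E q w); last by rewrite mul0r big1// => s _; rewrite mul0r mulr0.
have t1 : (nat_of_bool true)%:R = 1 :> R by [].
set I := informed w q; rewrite t1 mul1r rumM_bern.
rewrite (eq_bigr (fun s : perms => (\prod_(i < n) fi) * g (I :|: [set i | be I b i (s i)]))); last first.
  by move=> s _; rewrite mul1r.
rewrite (product_bern (om := fun _ _ => fi) (be I b) (fun B => g (I :|: B))); last by move=> i; exact: fi_sum.
apply: bern_mono.
- move=> i; rewrite -fi_sum [X in _ <= X](bigID (be I b i)) /= lerDl.
  by apply: sumr_ge0 => x _; exact: fi_ge0.
- move=> i; apply/andP; split; first by apply: sumr_ge0 => o _; exact: owt_ge0.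
  apply: hear_weight; last by rewrite ffunE; exact: avail_le.
  by move=> h ah; rewrite ffunE inE ah /=; exact: (nb q w i h).
- by move=> B B' BB'; apply: gd; exact: finset.setUS.
Qed.

End Communication.

(** * Expected regret *)

Section ExpectationBound.
Context {R : realType} {d : measure_display} {Omega : measurableType d}.
Variable P : probability Omega R.

Definition ebd (f : Omega -> R) (b : R) : Prop :=
  [/\ measurable_fun setT f, (forall w, 0 <= f w) & (\int[P]_w (f w)%:E <= b%:E)%E].

Lemma ebd_cst b : 0 <= b -> ebd (fun=> b) b.
Proof.
move=> b0; split=> //; rewrite integral_cst//.
apply: (@le_trans _ _ (b%:E * 1)%E); last by rewrite mule1.
by apply: lee_wpmul2l; [rewrite lee_fin|exact: probability_le1].
Qed.

Lemma ebdD f g b b' : ebd f b -> ebd g b' -> ebd (fun w => f w + g w) (b + b').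
Proof.
move=> [mf f0 hf] [mg g0 hg]; split; [exact: measurable_funD|by move=> w; rewrite addr_ge0|].
under eq_integral do rewrite EFinD.
rewrite ge0_integralD//; [|by move=> w _; rewrite lee_fin|by apply/measurable_EFinP|
  by move=> w _; rewrite lee_fin|by apply/measurable_EFinP].
by rewrite EFinD leeD.
Qed.

Lemma ebdZ c f b : 0 <= c -> ebd f b -> ebd (fun w => c * f w) (c * b).
Proof.
move=> c0 [mf f0 hf]; split; [exact: measurable_funM|by move=> w; rewrite mulr_ge0|].
under eq_integral do rewrite EFinM.
rewrite ge0_integralZl//; [|by apply/measurable_EFinP|by move=> w _; rewrite lee_fin].
by rewrite EFinM; apply: lee_wpmul2l => //; rewrite lee_fin.
Qed.

Lemma ebd_sum (I : eqType) (r : seq I) (f : I -> Omega -> R) (b : I -> R) :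
  (forall i, i \in r -> ebd (f i) (b i)) ->
  ebd (fun w => \sum_(i <- r) f i w) (\sum_(i <- r) b i).
Proof.
elim: r => [|i r IH] h.
  rewrite big_nil (_ : (fun w => _) = (fun=> 0)); first exact: ebd_cst.
  by apply: funext => w; rewrite big_nil.
rewrite big_cons (_ : (fun w => _) = (fun w => f i w + \sum_(i <- r) f i w)).
  by apply: ebdD; [apply: h; rewrite inE eqxx|apply: IH => i' hi; apply: h; rewrite inE hi orbT].
by apply: funext => w; rewrite big_cons.
Qed.

Lemma ebd_mono f b b' : b <= b' -> ebd f b -> ebd f b'.
Proof. by move=> bb [? ? h]; split=> //; apply: le_trans h _; rewrite lee_fin. Qed.

Lemma ebd_dom (g f : Omega -> R) b : measurable_fun setT g -> (forall w, 0 <= g w) -> (forall w, g w <= f w) ->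
  ebd f b -> ebd g b.
Proof.
move=> mg g0 gf [mf f0 h]; split=> //; apply: le_trans h.
apply: ge0_le_integral; first by [].
- by move=> w _; rewrite lee_fin.
- by apply/measurable_EFinP.
- by apply/measurable_EFinP.
- by move=> w _; rewrite lee_fin.
Qed.

Lemma ebd_indic B b : measurable B -> (P B <= b%:E)%E -> ebd (\1_B : Omega -> R) b.
Proof.
move=> mB h; split; [exact: measurable_indic|by move=> w; rewrite indicE|].
by rewrite integral_indic ?setIT.
Qed.

End ExpectationBound.

(* Increments of [A] over the indices satisfying [Q] telescope below the last such value. *)
Lemma telescope_cond (R : realType) (A : nat -> nat) (Q : pred nat) (B : R) J N :
  (forall j, (A j <= A j.+1)%N) -> 0 <= B -> (forall j, (J <= j)%N -> Q j -> (A j.+1)%:R <= B) ->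
  \sum_(J <= j < N) ((A j.+1)%:R - (A j)%:R) * (Q j)%:R <= B.
Proof.
move=> A_le B0 hQ; have [JN|NJ] := leqP J N; last by rewrite big_geq// ltnW.
elim: N JN => [|N IH] JN; first by rewrite big_geq.
move: JN; rewrite leq_eqVlt => /orP[/eqP ->|JN]; first by rewrite big_geq.
rewrite ltnS in JN; rewrite big_nat_recr//=; case: (boolP (Q N)) => qN; last first.
  by rewrite mulr0 addr0 IH.
rewrite mulr1; apply: (@le_trans _ _ ((A N.+1)%:R)); last exact: hQ.
apply: (@le_trans _ _ (\sum_(J <= j < N) ((A j.+1)%:R - (A j)%:R) + ((A N.+1)%:R - (A N)%:R))).
  rewrite lerD2r; apply: ler_sum => j _; rewrite -[X in _ <= X]mulr1 ler_wpM2l//.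
    by rewrite subr_ge0 ler_nat.
  by case: (Q j).
rewrite telescope_sumr//; have : 0 <= (A J)%:R :> R by [].
lra.
Qed.

Lemma dmeas_forall d (O : measurableType d) (T : finType) (b : T -> O -> bool) :
  (forall i, dmeas (b i)) -> dmeas (fun w => [forall i, b i w]).
Proof.
move=> h; pose F w : {ffun T -> bool} := [ffun i => b i w].
rewrite (_ : (fun w => _) = (fun w => [forall i, F w i])).
  apply: (dmeas_comp (fun f : {ffun T -> bool} => [forall i, f i])).
  by apply: (@dmeas_ffun _ O T bool (fun w i => b i w)) => i; exact: h.
by apply: funext => w; apply: eq_forallb => i; rewrite ffunE.
Qed.

Lemma ratio_split (R : realType) (eta : R) : 1 < eta ->
  (2 * eta - 1) / (eta - 1) = eta / (eta - 1) + 1 /\ 0 <= eta / (eta - 1).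
Proof.
move=> e1; split; last by rewrite divr_ge0//; lra.
by field; rewrite subr_eq0 gt_eqF.
Qed.

Lemma sum_ge_term (R : realType) (I : eqType) (r : seq I) (F : I -> R) i :
  (forall i, 0 <= F i) -> i \in r -> F i <= \sum_(i <- r) F i.
Proof.
move=> F0 ir; rewrite (big_rem i ir) /= lerDl; exact: sumr_ge0.
Qed.

Lemma sum_nat_widen (R : realType) (F : nat -> R) a b : (0 < a)%N ->
  \sum_(a <= p < b) F p = \sum_(1 <= p < b) (a <= p)%:R * F p.
Proof.
move=> a0; rewrite (big_nat_widenl a 1)// big_mkcond /=; apply: eq_bigr => p _.
by case: (a <= p)%N; rewrite ?mul1r ?mul0r.
Qed.

(** For fixed [t] the increments of [A] over the phases with [a j <= t] telescope, so a failure at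
    [t] is charged once, by the end of the last phase it can spoil. *)
Lemma swap_weight (R : realType) (A a : nat -> nat) (F W : nat -> R) J N M :
  (forall j, (A j <= A j.+1)%N) -> (forall j, (0 < a j)%N) -> (forall t, 0 <= F t) ->
  (forall t, 0 <= W t) -> (forall j t, (J <= j)%N -> (a j <= t)%N -> (A j.+1)%:R <= W t) ->
  \sum_(J <= j < N) ((A j.+1)%:R - (A j)%:R) * \sum_(a j <= t < M) F t <= \sum_(1 <= t < M) F t * W t.
Proof.
move=> A_le a0 F0 W0 h.
under eq_bigr do rewrite (sum_nat_widen _ _ (a0 _)) mulr_sumr.
rewrite exchange_big /=; apply: ler_sum => t _.
rewrite (eq_bigr (fun j => F t * (((A j.+1)%:R - (A j)%:R) * (a j <= t)%:R))); last first.
  by move=> j _; rewrite mulrA mulrC.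
rewrite -mulr_sumr ler_wpM2l//.
exact: (@telescope_cond _ A (fun j => (a j <= t)%N) (W t) J N A_le (W0 t) (fun j Jj => h j t Jj)).
Qed.

(** Phases [2 l] and [2 l + 1] share the rumor round [l]; merging them produces [A] at twice the
    spreading time. *)
Lemma pair_weight (R : realType) (A : nat -> nat) (u : nat -> R) J N :
  (forall j, (A j <= A j.+1)%N) -> (forall l, 0 <= u l) ->
  \sum_(J <= j < N) ((A j.+1)%:R - (A j)%:R) * u (j %/ 2)%N <=
  \sum_(0 <= l < N) ((A (2 * l.+1)%N)%:R - (A (2 * l)%N)%:R) * u l.
Proof.
move=> A_le u0.
have t0 j : 0 <= ((A j.+1)%:R - (A j)%:R) * u (j %/ 2)%N by rewrite mulr_ge0// subr_ge0 ler_nat.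
apply: (@le_trans _ _ (\sum_(0 <= j < N.*2) ((A j.+1)%:R - (A j)%:R) * u (j %/ 2)%N)).
  have [JN|NJ] := leqP J N; last by rewrite big_geq ?(ltnW NJ)// sumr_ge0.
  have N2 : (N <= N.*2)%N by rewrite -addnn leq_addr.
  rewrite [X in _ <= X](big_cat_nat (leq0n J) (leq_trans JN N2)) /=.
  by rewrite [X in _ <= _ + X](big_cat_nat JN N2) /= addrCA lerDl addr_ge0// sumr_ge0.
rewrite le_eqVlt; apply/orP; left; apply/eqP.
elim: N => [|N IH]; first by rewrite !big_geq.
rewrite doubleS !big_nat_recr//= IH -addrA; congr (_ + _).
rewrite -mul2n mulKn// (_ : ((2 * N).+1 %/ 2)%N = N); last by clear; lia.
by rewrite -mulrDl mulnS; congr (_ * _); rewrite add2n; ring.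
Qed.

(** * From the good event of a phase to the expected regret *)

Section Spreading.
Context {R : realType} {d : measure_display} {Omega : measurableType d} {n m : nat}.
Variables (P : probability Omega R) (nu : nat -> probability R R).
Variables (c : config R n m) (X : 'I_n -> nat -> nat -> Omega -> R)
  (sg : 'I_n -> nat -> Omega -> {perm 'I_(n+m)}) (tbI tbB tbU adv : 'I_n -> nat -> Omega -> nat).
Let K := c_K c.
Let A := phaseA (c_beta c).
Let adj := c_adj c.
Let alpha := c_alpha c.
Hypothesis A_lt : forall j, (A j < A j.+1)%N.
Hypothesis K1 : (1 <= c_K c)%N.
Hypothesis Hsticky : forall i, size (c_sticky c i) = c_S c /\
  all (fun k => (1 <= k <= c_K c)%N) (c_sticky c i).
Hypothesis HUL : forall i, (1 <= c_U1 c i <= c_K c)%N /\ (1 <= c_L1 c i <= c_K c)%N.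
Hypothesis HtbI : forall i t, past_measurable K X sg t.-1 (fun j' => (A j' < t)%N) (tbI i t).
Hypothesis HtbB : forall i j, past_measurable K X sg (A j) (fun j' => (j' < j)%N) (tbB i j).
Hypothesis HtbU : forall i j, past_measurable K X sg (A j) (fun j' => (j' <= j)%N) (tbU i j).
Hypothesis Hadv : forall i j, past_measurable K X sg (A j) (fun j' => (j' <= j)%N) (adv i j).
Hypothesis mX : forall i t k, measurable_fun setT (X i t k).
Hypothesis msg : forall i j s, measurable (sg i j @^-1` [set s]).
Hypothesis Hind : mutually_indep P K X sg.
Hypothesis Hsg : forall i j s, (1 <= j)%N -> P (sg i j @^-1` [set s]) = (((n + m)`!)%:R^-1)%:E.
Variable eps : R.
Hypothesis eps0 : 0 <= eps.
Hypothesis alpha0 : 0 < c_alpha c.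

Notation rzw := (rz X sg tbI tbB tbU adv).
Notation trr := (trw c X sg tbI tbB tbU adv).
Notation FBj := (FB c X sg).
Notation FEj := (FE c X sg).
Notation lo := (loph c).
Notation up := (upph c).
Notation kap := (kapph c).
Notation infd := (informed c X sg tbI tbB tbU adv).
Notation hf := (hfail c X sg tbI tbB tbU adv).
Notation clean w t := (clean_at (c_K c) (c_alpha c) eps (trr w) (mean nu) t).
Let A0 : A 0 = 0%N. Proof. by []. Qed.
Let armd := arm_dmeas A_lt K1 Hsticky HUL HtbI HtbB HtbU Hadv.
Let okt w := sim_trace_ok (rzw w) A_lt K1 Hsticky HUL.

Lemma clean_measurable q t : (t <= A q)%N -> measurable ([set w | clean w t] : set (FBj q)).
Proof.
move=> tq.
rewrite (_ : [set w | _] = \bigcap_(i in [set: 'I_n]) \bigcap_(k in [set k | (1 <= k <= c_K c)%N])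
   [set w : FBj q | (0 < cnt (trr w) i t.-1 k)%N -> `|tmh (trr w) i t.-1 k - mean nu k| <=
     (1 - eps) * bonus (c_alpha c) t (cnt (trr w) i t.-1 k)]); last first.
  apply/seteqP; split=> w /=; first by move=> h i _ k hk; exact: h.
  by move=> h i k hk; exact: (h i Logic.I k hk).
apply: fin_bigcap_measurable; first exact: finite_finset.
move=> i _; apply: bigcap_measurable; first by exists 1%N; rewrite /= K1.
move=> k hk.
have hs s : (1 <= s <= t.-1)%N -> dmeas (fun w : FI c X sg s => arm_at c (rzw w) i s).
  by move=> /andP[s1 _]; exact: armd.
have hA j' : (A j' < t.-1)%N -> (j' < q)%N.
  by move=> h; apply: (A_le_lt A_lt); apply: leq_trans h _; apply: leq_trans (leq_pred _) tq.
have tq1 : (t.-1 <= A q)%N := leq_trans (leq_pred _) tq.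
have mc : dmeas (fun w : FBj q => cnt (trr w) i t.-1 k).
  by apply: (cnt_dmeas k hs) => //; apply: leq_trans (leq_pred _) tq1.
have mt : measurable_fun setT (fun w : FBj q => tsum c (rzw w) i t.-1 k).
  exact: (tsum_meas hk hs).
pose f (w : FBj q) : R := `|tsum c (rzw w) i t.-1 k * (cnt (trr w) i t.-1 k)%:R^-1 - mean nu k|
   - (1 - eps) * bonus (c_alpha c) t (cnt (trr w) i t.-1 k).
have mf : measurable_fun setT f.
  apply: measurable_funB.
    apply: measurableT_comp => //; apply: measurable_funB => //; apply: measurable_funM => //.
    exact: (@dmeas_fun_nat _ (FBj q) R (fun x : nat => x%:R^-1)).
  exact: (@dmeas_fun_nat _ (FBj q) R (fun x : nat => (1 - eps) * bonus (c_alpha c) t x)).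
rewrite (_ : [set w | _] = ((fun w : FBj q => cnt (trr w) i t.-1 k) @^-1` [set 0%N]) `|` (f @^-1` `]-oo, 0%R])).
  apply: measurableU; first exact: mc.
  by rewrite -[X in measurable X]setTI; apply: mf => //; exact: measurable_itv.
apply/seteqP; split=> w /=; rewrite in_itv /= /f subr_le0.
  by case: (posnP (cnt (trr w) i t.-1 k)) => [->|c0] h; [left|right; exact: h].
by case=> [->//|h _].
Qed.

(** Good event for the target phase [j], observed up to phase [q]. It involves orderings of phases
    at most [q - 2] only, so it is known before those of phase [q] are drawn. *)
Definition Ev j q w : bool :=
  `[< forall t, (A (lo (lo j)).-1 < t <= A q)%N -> clean w t >] &&
  [forall i' : 'I_n, [forall i : 'I_n, adj (lshift m i') (lshift m i) ==>
    all (fun j0 => ~~ hf ((j0 + 2) %/ 3) (j0 - 2) i' i w) (iota (lo j) (q.+1 - lo j))]].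

Lemma EvP j q w : Ev j q w -> (forall t, (A (lo (lo j)).-1 < t <= A q)%N -> clean w t) /\
  forall i' i j0, adj (lshift m i') (lshift m i) -> (lo j <= j0 <= q)%N -> hear (trr w) i' i j0.
Proof.
case/andP=> /asboolP h1 /forallP h2; split=> // i' i j0 hadj hj.
have /forallP /(_ i) := h2 i'; rewrite hadj /= => /allP /(_ j0).
rewrite mem_iota => /(_ ltac:(clear -hj; lia)); rewrite /hfail -has_predC => /hasP[q'].
rewrite mem_iota /= negb_and !negbK => hq' /orP h; exists q'; first by clear -hq'; lia.
by case: h => [h|/eqP h]; [left|right].
Qed.

Lemma Ev_mono j q q' w : (q <= q')%N -> Ev j q' w -> Ev j q w.
Proof.
move=> qq /andP[/asboolP h1 /forallP h2]; apply/andP; split.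
  apply/asboolP => t /andP[t1 t2]; apply: h1; rewrite t1/=.
  by apply: leq_trans t2 _; exact: (phaseA_le A_lt).
apply/forallP => i'; apply/forallP => i; apply/implyP => ha.
have /forallP /(_ i) := h2 i'; rewrite ha /= => /allP h; apply/allP => j0; rewrite mem_iota => hj.
by apply: h; rewrite mem_iota; clear -hj qq; lia.
Qed.

Lemma Ev_dmeas j q : dmeas (Ev j q.+1 : FBj q.+1 -> bool).
Proof.
apply: (@dmeas_comp2 _ (FBj q.+1) _ _ _ andb).
  apply: dmeas_asbool.
  rewrite (_ : [set w | _] = \bigcap_(t in [set t | (A (lo (lo j)).-1 < t <= A q.+1)%N]) [set w : FBj q.+1 | clean w t]).
    by apply: bigcap_measurableType => t /= /andP[_ ht]; exact: clean_measurable.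
  by apply/seteqP; split=> w /= h t; [move=> ht; exact: h|exact: h].
apply: dmeas_forall => i'; apply: dmeas_forall => i.
case: (adj _ _) => /=; last exact: dmeas_cst.
apply: dmeas_all => j0; rewrite mem_iota => hj0.
apply: (@dmeas_comp _ (FBj q.+1) _ _ negb); apply: (FE_FB A_lt).
apply: (hfail_dmeas A_lt K1 Hsticky HUL HtbI HtbB HtbU Hadv).
by clear -hj0; lia.
Qed.

Variables (J : nat) (istar : 'I_n) (Dl : nat -> R).
Hypothesis adj_sym : symmetric adj.
Hypothesis J5 : (5 <= J)%N.
Hypothesis lo_mono : forall i j, (i <= j)%N -> (lo i <= lo j)%N.
Hypothesis NB : forall j0, (lo J <= j0)%N -> [/\ (0 < lo j0 <= j0)%N, (lo j0 <= (j0 + 2) %/ 3)%N,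
  forall j, (j <= lo j0)%N -> (up j <= (j0 + 2) %/ 3)%N &
  block_margin A (c_K c) (c_S c) (c_alpha c) eps kap lo j0].
Hypothesis loJ : (lo J <= J)%N.
Hypothesis ND : forall p, (J - J %/ 2 <= p)%N -> (2 * (c_S c).+2 <= G A p)%N /\
  dl A (c_S c) (c_alpha c) p < Dl 2.
Hypothesis K2 : (1 < c_K c)%N.
Hypothesis DlE : forall k, (1 <= k <= c_K c)%N -> Dl k = mean nu 1 - mean nu k.
Hypothesis Dl_le1 : forall k, (2 <= k)%N -> 0 < Dl k <= 1.
Hypothesis Dl_le : forall k l, (2 <= k <= l)%N -> (Dl l)^-1 <= (Dl k)^-1.
Hypothesis star : 1%N \in c_sticky c istar.

Lemma lo_bounds j : (J <= j)%N -> [/\ (lo J <= lo j)%N, (0 < lo (lo j) <= lo j)%N,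
  (lo j <= (j + 2) %/ 3)%N & forall j', (j' <= lo j)%N -> (up j' <= (j + 2) %/ 3)%N].
Proof.
move=> Jj; have h := lo_mono Jj; have [h1 _ _ _] := NB h.
by have [_ h2 h3 _] := NB (leq_trans loJ Jj).
Qed.

Lemma Ev_nonblock j q w i i' j0 : (J <= j)%N -> Ev j q w -> (lo j <= j0 <= q)%N ->
  ~ blockat A kap lo (trr w) i j0 (lshift m i').
Proof.
move=> Jj hE /andP[h1 h2] hb; have [lJ lolo _ _] := lo_bounds Jj.
have [a1 a2 a3 a4] := NB (leq_trans lJ h1); have [hc hh] := EvP hE.
have [j01 hH _] := hb.
have ha : adj (lshift m i) (lshift m i').
  have e : j0.-1 = j0.-2.+1 by clear -j01; lia.
  by rewrite e in hH; have [] := ok_H (okt w) hH.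
apply: (nonblock A0 A_lt alpha0 eps0 (okt w) a1 a2 a3 a4 _ _ hb).
  move=> t /andP[t1 t2]; apply: hc; apply/andP; split.
    apply: leq_ltn_trans t1; apply: (phaseA_le A_lt).
    by have := lo_mono h1; move: (lo (lo j)) (lo j0) => u v; clear; lia.
  by apply: leq_trans t2 _; exact: (phaseA_le A_lt).
by apply: hh; [rewrite adj_sym|rewrite h1].
Qed.

(** A ban in force at [q] was decided from [lo j] on, which [Ev_nonblock] excludes, or before, and
    then expired by phase [(j + 2) %/ 3]. The latter is below [j - j %/ 2] for [j >= 5], whence
    [J5]. *)
Lemma Ev_unblocked j q w i h : (J <= j)%N -> (j - j %/ 2 <= q)%N -> Ev j q w ->
  lshift m h \notin tblk (trr w) i q.
Proof.
move=> Jj jq hE; have q0 : q = q.-1.+1 by move: Jj J5 jq; clear; lia.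
apply/negP; rewrite q0 => /(ok_blk (okt w)) [j0 /andP[h1 h2] hb].
have [h3|h3] := leqP (lo j) j0; first by apply: (Ev_nonblock Jj hE _ hb); rewrite h3 q0.
have [_ _ _ /(_ j0 (ltnW h3))] := lo_bounds Jj.
by move: h2 Jj J5 jq; rewrite -q0; move: (up j0) => u; clear; lia.
Qed.

Lemma Ev_best j q w i : (J <= j)%N -> (j - j %/ 2 <= q)%N -> Ev j q w ->
  1%N \in tact (trr w) i q -> tB (trr w) i q = 1%N /\ 1%N \in tact (trr w) i q.+1.
Proof.
move=> Jj jq hE; have [q' q'E] : exists q', q = q'.+1 by exists q.-1; move: Jj J5 jq; clear; lia.
rewrite q'E in jq hE *; have [hc _] := EvP hE.
have [_ lolo lj _] := lo_bounds Jj.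
have Jq : (J - J %/ 2 <= q'.+1)%N by move: Jj jq; clear; lia.
have [g1 g2] := ND Jq.
apply: (best_arm_phase A0 A_lt alpha0 eps0 (okt w) K2 DlE Dl_le1 Dl_le) => // t /andP[t1 t2].
apply: hc; rewrite t2 andbT; apply: leq_ltn_trans t1; apply: (phaseA_le A_lt).
by move: lolo lj jq Jj J5; move: (lo (lo j)) (lo j) => u v; clear; lia.
Qed.

Lemma star_informed w q : istar \in infd w q.
Proof. by rewrite finset.in_set /= /active mem_cat star. Qed.

Notation un := (@unspread R n).

Lemma unspread_decr (B B' : {set 'I_n}) : B \subset B' -> un B' <= un B.
Proof.
move=> BB; rewrite /unspread ler_nat; case: (eqVneq B [set: 'I_n]%SET) => [BT|_]; last by case: (_ != _).
by rewrite (_ : B' = [set: 'I_n]%SET) ?eqxx//; apply/eqP; rewrite -finset.subTset -BT.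
Qed.

(** The comparison starts at phase [j - j %/ 2], when no ban between honest agents is left, and
    lasts [j %/ 2] rounds; this halving is the 2 in [2 * tau_spr]. *)
Lemma spread_bound j : (J <= j)%N ->
  ebd P (fun w => (Ev j j w)%:R * un (infd w j)) (rum adj istar (j %/ 2) un).
Proof.
move=> Jj; have j0 : (0 < j)%N by move: Jj J5; clear; lia.
have g0 B : 0 <= un B by rewrite /unspread; case: (_ != _).
split.
- have := dmeas_pair (FB_dmeas mX msg (@Ev_dmeas j j.-1))
    (FB_dmeas mX msg (@informed_dmeas _ _ _ _ _ c X sg tbI tbB tbU adv A_lt K1 Hsticky HUL HtbI HtbB HtbU Hadv j.-1)).
  rewrite (prednK j0) => mY.
  by move=> _ B mB; rewrite setTI; exact: (mY ((fun y : bool * {set 'I_n} => (y.1)%:R * un y.2) @^-1` B)).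
- by move=> w; rewrite mulr_ge0.
have e : (j - j %/ 2 + j %/ 2)%N = j by clear; lia.
have s0 : (0 < j - j %/ 2)%N by move: j0; clear; lia.
have := @rumor_domination _ _ _ _ _ P c X sg tbI tbB tbU adv A_lt K1 Hsticky HUL HtbI HtbB HtbU Hadv mX msg
  Hind Hsg istar (Ev j) (j - j %/ 2)%N s0 (Ev_dmeas j) _ _ _ _ _ (j %/ 2)%N un g0 unspread_decr.
rewrite e; apply.
- by move=> q w _; exact: Ev_mono.
- by move=> q w i hq hE; rewrite !finset.in_set => /(Ev_best Jj hq hE)[].
- move=> q w i h hq hE hH; rewrite !finset.in_set => /(Ev_best Jj hq hE)[hB _].
  have [q' q'E] : exists q', q = q'.+1 by exists q.-1; move: s0 hq; clear; lia.
  rewrite q'E in hH hB *; apply: (ok_new (okt w)).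
  by rewrite (ok_HR (okt w) hH) hB.
- by move=> q w i h hq hE; exact: (Ev_unblocked i h Jj hq hE).
- by move=> w; exact: star_informed.
Qed.

Lemma good_persist j N w : (J <= j)%N -> Ev j N w -> infd w j = [set: 'I_n]%SET ->
  forall i p, (j <= p <= N)%N -> 1%N \in tact (trr w) i p /\ tB (trr w) i p = 1%N.
Proof.
move=> Jj hE hT i p /andP[jp pN].
have best q : (j <= q <= N)%N -> 1%N \in tact (trr w) i q -> tB (trr w) i q = 1%N /\ 1%N \in tact (trr w) i q.+1.
  move=> /andP[jq qN]; apply: (Ev_best Jj (leq_trans (leq_subr _ _) jq)); exact: (Ev_mono qN).
suff h : 1%N \in tact (trr w) i p by split=> //; have [] := best p; rewrite ?jp.
elim: p jp pN => [|p IH] jp pN; first by move: jp Jj J5; clear; lia.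
move: jp; rewrite leq_eqVlt => /orP[/eqP <-|jp].
  by have : i \in infd w j by [rewrite hT finset.inE]; rewrite finset.in_set.
rewrite ltnS in jp; have pN' := ltnW pN.
by have [] := best p (introT andP (conj jp pN')) (IH jp pN').
Qed.

Variables (i0 : 'I_n) (T N : nat) (eta Cl : R).
Hypothesis eta1 : 1 < eta.
Hypothesis TN : (T <= A N)%N.
Hypothesis LP : forall j, (1 <= j)%N -> exists j1, [/\ (j <= j1)%N,
  forall p, (j1 < p)%N -> (j <= lo p.+1)%N /\
    (A j)%:R + 1 + 4 * c_alpha c * ln (A p.+1)%:R * (Dl 2)^-1 ^+ 2 <= kap p.+1 &
  (c_K c)%:R + 4 * c_alpha c * ((c_K c)%:R * ((Dl 2)^-1 * ln (A j1)%:R)) <= (A j)%:R + Cl].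
Hypothesis GR : forall p p', (up p.+1 < p')%N -> eta * ln (A p)%:R <= ln (A p')%:R.

Definition reg w : R := \sum_(1 <= t < T.+1) (mean nu 1 - mean nu (arm_at c (rzw w) i0 t)).
Let x k := (Dl k)^-1.
Let dm := deg_mal adj i0.
Definition Mn : R := Num.min ((2 * eta - 1) / (eta - 1) * (\sum_(2 <= k < dm + 4) x k)
                    + \sum_(dm + 4 <= k < c_S c + dm + 5) x k) (\sum_(2 <= k < (c_K c).+1) x k).

Lemma x_ge0 k : (2 <= k)%N -> 0 <= x k.
Proof. by move=> /Dl_le1 /andP[h _]; rewrite invr_ge0 ltW. Qed.

Lemma sum_x_ge0 a b : (2 <= a)%N -> 0 <= \sum_(a <= k < b) x k.
Proof.
move=> a2; rewrite big_nat_cond; apply: sumr_ge0 => k /andP[/andP[ak _] _].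
by apply: x_ge0; exact: leq_trans ak.
Qed.

Lemma sum_x_le a b b' : (2 <= a)%N -> (b <= b')%N -> \sum_(a <= k < b) x k <= \sum_(a <= k < b') x k.
Proof.
move=> a2 bb; have [ab|ba] := leqP a b; last by rewrite [X in X <= _]big_geq ?(ltnW ba)// sum_x_ge0.
by rewrite [X in _ <= X](big_cat_nat ab bb) /= lerDl sum_x_ge0// (leq_trans a2).
Qed.

Lemma Mn_ge0 : 0 <= Mn.
Proof.
have e1 := eta1; rewrite /Mn le_min sum_x_ge0// andbT addr_ge0 ?sum_x_ge0//; last by rewrite addn4.
by rewrite mulr_ge0 ?sum_x_ge0// divr_ge0; lra.
Qed.

Lemma arm_gap w t : (1 <= t)%N -> 0 <= mean nu 1 - mean nu (arm_at c (rzw w) i0 t) <= 1.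
Proof.
move=> t1; have [p hp] := @phase_of A A0 A_lt t t1.
have hv : (1 <= tI (trr w) i0 t <= c_K c)%N := ok_valid (okt w) (ok_I (okt w) i0 hp).
rewrite -[arm_at c (rzw w) i0 t]/(tI (trr w) i0 t) -(DlE hv); move: (tI _ _ _) hv => k hv.
have [->|n1] := eqVneq k 1%N; first by rewrite DlE ?subrr ?lexx ?ler01// K1.
have /Dl_le1 /andP[h1 h2] : (2 <= k)%N by move: hv n1; clear; lia.
by rewrite (ltW h1).
Qed.

Lemma reg_le w : 0 <= reg w <= T%:R.
Proof.
rewrite /reg big_nat_cond; apply/andP; split.
  by apply: sumr_ge0 => t /andP[/andP[t1 _] _]; have /andP[] := arm_gap w t1.
apply: (@le_trans _ _ (\sum_(1 <= t < T.+1 | (1 <= t < T.+1)%N && true) 1)).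
  by apply: ler_sum => t /andP[/andP[t1 _] _]; have /andP[] := arm_gap w t1.
by rewrite -big_nat_cond big_const_nat iter_addr_0 subn1.
Qed.

(** One copy of [A j] bounds the regret before phase [j] ends; the other is the price, in [LP], of
    the phases up to [j1]. *)
Lemma good_regret j w : (J <= j <= N)%N -> Ev j N w -> infd w j = [set: 'I_n]%SET ->
  reg w <= 2 * (A j)%:R + (4 * c_alpha c * ln T%:R * Mn + Cl).
Proof.
move=> /andP[Jj jN] hE hT.
have j0 : (0 < j)%N by move: Jj J5; clear; lia.
have [j1 [jj1 hp hC]] := LP j0.
have a4 : 0 < 4 * c_alpha c by rewrite mulr_gt0.
have Aj0 : 0 <= (A j)%:R :> R by [].
have lA1 : 0 <= ln (A j1)%:R :> R.
  by rewrite ln_ge0// ler1n; apply: leq_trans (phaseA_ge A_lt j1); exact: leq_trans jj1.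
have KA : (c_K c)%:R <= (A j)%:R + Cl.
  apply: le_trans hC; rewrite lerDl mulr_ge0 ?(ltW a4)//.
  by rewrite !mulr_ge0// ?x_ge0.
have lT : 0 <= ln T%:R :> R.
  by case: (T) => [|T']; [rewrite ln0|rewrite ln_ge0// ler1n].
have M0 : 0 <= 4 * c_alpha c * ln T%:R * Mn by rewrite mulr_ge0 ?Mn_ge0// mulr_ge0// ltW.
have [TA|AT] := leqP T (A j).
  have /andP[_ h] := reg_le w; apply: le_trans h _.
  apply: (@le_trans _ _ (A j)%:R); first by rewrite ler_nat.
  rewrite [2 * _]mulrC mulr_natr mulr2n -addrA lerDl addrCA addr_ge0//.
  exact: le_trans KA.
have hact i' p : (j <= p <= N)%N -> 1%N \in tact (trr w) i' p.
  by move=> h; have [] := good_persist Jj hE hT i' h.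
have hB i' p : (j <= p <= N)%N -> tB (trr w) i' p = 1%N.
  by move=> h; have [] := good_persist Jj hE hT i' h.
have hcl t : (A j < t <= A N)%N -> clean w t.
  have [hc _] := EvP hE; move=> /andP[t1 t2]; apply: hc; rewrite t2 andbT.
  apply: leq_ltn_trans t1; apply: (phaseA_le A_lt).
  by have [_ lolo lj _] := lo_bounds Jj; move: lolo lj j0; move: (lo (lo j)) (lo j) => u v; clear; lia.
have r1 := regret_all A0 A_lt alpha0 eps0 (okt w) K2 DlE Dl_le1 i0 j0 TN hact hcl.
have T0 : (0 < T)%N by exact: leq_ltn_trans AT.
have [J' hJ'] := @phase_of A A0 A_lt T T0.
have r2 := regret_blocked A0 A_lt alpha0 eps0 (okt w) K2 DlE Dl_le1 Dl_le i0 j0 TN hact hB hcl eta1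
  hJ' jj1 AT hp (fun p p' _ => @GR p p').
have r : reg w <= (A j)%:R + ((A j)%:R + Cl) + 4 * c_alpha c * ln T%:R * Mn.
  rewrite /Mn; case: (leP _ (\sum_(2 <= k < (c_K c).+1) x k)) => _.
    apply: (le_trans r2); apply: lerD; first by rewrite -addrA lerD2l.
    apply: ler_wpM2l; first by rewrite mulr_ge0// ltW.
    (* The coefficient is [eta / (eta - 1) + 1]; its summand 1 completes the second sum to one
       starting at arm 2, long enough to hold the active arms. *)
    have [-> e0] := ratio_split eta1.
    rewrite mulrDl mul1r -addrA; apply: lerD.
      by apply: ler_wpM2l => //; apply: sum_x_le => //; rewrite -/dm; clear; lia.
    rewrite -big_cat_nat /=; [|by rewrite addn4|by clear; lia].
    by apply: sum_x_le => //; clear; lia.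
  apply: (le_trans r1); apply: lerD; first by rewrite lerD2l.
  by rewrite mulrA.
apply: le_trans r _; rewrite [2 * _]mulrC mulr_natr mulr2n -!addrA !lerD2l addrC.
by rewrite lexx.
Qed.

Hypothesis nu01 : forall k, (1 <= k <= K)%N -> nu k `[0%R, 1%R]%classic = 1%E.
Hypothesis lawX : forall i t k, (1 <= t)%N -> (1 <= k <= K)%N -> forall B : set R, measurable B ->
        P (X i t k @^-1` B) = nu k B.
Hypothesis eps1 : eps <= 1.
Hypothesis lo4 : (4 <= lo J)%N.
Hypothesis JN : (J <= N)%N.

Notation bU := (badU nu c X sg tbI tbB tbU adv eps).
Definition pt t : R := 2 * n%:R * (c_K c)%:R * t%:R `^ (1 - 2 * c_alpha c * (1 - eps) ^+ 2).
Definition hb p : R := (n * dbar adj)%:R * (1 - (dbar adj)%:R^-1) ^+ (p - 2 - (p + 2) %/ 3).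
(** Number of ordered honest edges along which nothing is heard in the window of [p]. *)
Definition HF p w : R := \sum_(i' : 'I_n) \sum_(i : 'I_n)
  (adj (lshift m i') (lshift m i))%:R * (hf ((p + 2) %/ 3) (p - 2) i' i w)%:R.

Lemma HF_ge0 p w : 0 <= HF p w.
Proof. by apply: sumr_ge0 => i' _; apply: sumr_ge0 => i _; rewrite mulr_ge0. Qed.

Lemma bad_ebd t : (0 < t)%N -> ebd P (\1_(bU t) : Omega -> R) (pt t).
Proof.
move=> t0; have e01 : 0 <= eps <= 1 by rewrite eps0.
have tb := tail_bound A_lt K1 Hsticky HUL HtbI HtbB HtbU Hadv nu01 mX lawX msg Hind.
apply: ebd_indic; first by apply: badU_measurable => *; exact: (tail_measurable nu A_lt K1 Hsticky HUL HtbI HtbB HtbU Hadv mX msg).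
by apply: (badU_prob e01 alpha0 _ tb) => // *; exact: (tail_measurable nu A_lt K1 Hsticky HUL HtbI HtbB HtbU Hadv mX msg).
Qed.

Lemma HF_ebd p : (4 <= p)%N -> ebd P (HF p) (hb p).
Proof.
move=> p4; set k := (p - 2 - (p + 2) %/ 3)%N.
pose y : R := (1 - (dbar adj)%:R^-1) ^+ k.
have y0 : 0 <= y.
  rewrite exprn_ge0// subr_ge0; case: (posnP (dbar adj)) => [->|d0]; first by rewrite invr0.
  by rewrite invf_le1 ?ltr0n// ler1n.
apply: (@ebd_mono _ _ _ _ _ (\sum_(i' : 'I_n) \sum_(i : 'I_n) (adj (lshift m i') (lshift m i))%:R * y)).
  apply: (@le_trans _ _ (\sum_(i' : 'I_n) (dbar adj)%:R * y)).
    apply: ler_sum => i' _; rewrite -mulr_suml ler_wpM2r// -natr_sum ler_nat.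
    rewrite (deg_hon_sum adj i'); apply: (@leq_trans (deg adj i')); last exact: leq_bigmax.
    by apply: subset_leq_card; apply/fintype.subsetP => h; rewrite !inE => /andP[].
  by rewrite sumr_const card_ord -[X in X <= _]mulr_natl mulrA -natrM.
apply: ebd_sum => i' _; apply: ebd_sum => i _.
case: (boolP (adj _ _)) => ha; last first.
  rewrite mul0r (_ : (fun w => _) = (fun=> 0)); first exact: ebd_cst.
  by apply: funext => w; rewrite mul0r.
rewrite mul1r (_ : (fun w => _) = (fun w => (hf ((p + 2) %/ 3) (p - 2) i' i w)%:R)); last first.
  by apply: funext => w; rewrite mul1r.
have ap : ((p + 2) %/ 3 <= p - 2)%N by move: p4; clear; lia.
have dg0 : (0 < deg adj i')%N by apply/card_gt0P; exists (lshift m i); rewrite inE.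
have dd : (deg adj i' <= dbar adj)%N by exact: leq_bigmax.
split.
- apply: (dmeas_fun_nat (fun x : nat => x%:R)); apply: (dmeas_comp nat_of_bool).
  apply: (FB_dmeas mX msg (j := (p - 2).+1)); apply: (FE_FB A_lt).
  exact: (hfail_dmeas A_lt K1 Hsticky HUL HtbI HtbB HtbU Hadv).
- by [].
apply: le_trans (hfail_prob A_lt K1 Hsticky HUL HtbI HtbB HtbU Hadv mX msg Hind Hsg ha ap) _.
rewrite lee_fin; apply: lerXn2r; rewrite ?nnegrE ?subr_ge0 ?invf_le1 ?ltr0n ?ler1n//.
- exact: leq_trans dd.
- exact: leq_trans dd.
- by rewrite lerD2l lerN2 lef_pV2 ?posrE ?ltr0n ?ler_nat//; exact: leq_trans dd.
Qed.

(** A surrogate for the indicator that phase [j] fails: at least 1 on failure, with an expectation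
    bounded term by term. The last term restricts to [Ev j j], the event under which the rumor
    comparison holds. *)
Definition badness j w : R := \sum_((A (lo (lo j)).-1).+1 <= t < (A N).+1) \1_(bU t) w +
  \sum_(lo j <= p < N.+1) HF p w + (Ev j j w)%:R * un (infd w j).

Lemma badness_ge0 j w : 0 <= badness j w.
Proof.
rewrite /badness !addr_ge0//.
- by apply: sumr_ge0 => t _; rewrite indicE.
- by apply: sumr_ge0 => p _; exact: HF_ge0.
- by rewrite mulr_ge0// /unspread; case: (_ != _).
Qed.

Lemma badness_ebd j : (J <= j <= N)%N -> ebd P (badness j)
  (\sum_((A (lo (lo j)).-1).+1 <= t < (A N).+1) pt t + \sum_(lo j <= p < N.+1) hb p
    + rum adj istar (j %/ 2) un).
Proof.
move=> /andP[Jj jN]; have [lJ _ _ _] := lo_bounds Jj.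
apply: ebdD; last exact: spread_bound.
apply: ebdD; apply: ebd_sum => t; rewrite mem_index_iota => /andP[t1 _].
  by apply: bad_ebd; exact: leq_ltn_trans t1.
by apply: HF_ebd; apply: leq_trans t1; exact: leq_trans lJ.
Qed.

Lemma good_or_bad j w : (J <= j <= N)%N ->
  (Ev j N w /\ infd w j = [set: 'I_n]%SET) \/ 1 <= badness j w.
Proof.
move=> /andP[Jj jN].
have p1 : 0 <= \sum_((A (lo (lo j)).-1).+1 <= t < (A N).+1) (\1_(bU t) w : R).
  by apply: sumr_ge0 => t _; rewrite indicE.
have p2 : 0 <= \sum_(lo j <= p < N.+1) HF p w by apply: sumr_ge0 => p _; exact: HF_ge0.
have p3 : 0 <= (Ev j j w)%:R * un (infd w j) by rewrite mulr_ge0// /unspread; case: (_ != _).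
case hE : (Ev j N w).
  case: (eqVneq (infd w j) [set: 'I_n]%SET) => hI; [by left|right].
  by rewrite /badness (Ev_mono jN hE) /unspread hI mulr1 lerDr addr_ge0.
right; move/negbT: hE; rewrite /Ev negb_and => /orP[/asboolPn|].
  move=> /existsNP[t] /not_implyP[/andP[t1 t2] hb].
  have hU : bU t w.
    have e01 : 0 <= eps <= 1 by rewrite eps0.
    by apply: (bad_sub e01 alpha0) => //; exact: leq_ltn_trans t1.
  rewrite /badness -addrA; apply: ler_wpDr; first exact: addr_ge0.
  apply: le_trans (@sum_ge_term _ _ _ (fun t => \1_(bU t) w) t _ _); first by rewrite indicE mem_set.
    by move=> t'; rewrite indicE.
  by rewrite mem_index_iota t1.
move=> /forallPn[i'] /forallPn[i]; rewrite negb_imply => /andP[ha /allPn[p]].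
rewrite mem_iota => hp; rewrite negbK => hh.
rewrite /badness; apply: ler_wpDr => //; apply: ler_wpDl => //.
apply: le_trans (@sum_ge_term _ _ _ (fun p => HF p w) p _ _); last 2 first.
- by move=> p'; exact: HF_ge0.
- by rewrite mem_index_iota; move: hp; move: (lo j) => u; clear; lia.
rewrite /HF; apply: le_trans (@sum_ge_term _ _ _ (fun i' => \sum_(i : 'I_n)
   (adj (lshift m i') (lshift m i))%:R * (hf ((p + 2) %/ 3) (p - 2) i' i w)%:R) i' _ (mem_index_enum _)).
  apply: le_trans (@sum_ge_term _ _ _ (fun i => (adj (lshift m i') (lshift m i))%:R *
    (hf ((p + 2) %/ 3) (p - 2) i' i w)%:R) i _ (mem_index_enum _)).
    by rewrite ha hh mulr1.
  by move=> i1; rewrite mulr_ge0.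
by move=> i1; apply: sumr_ge0 => i2 _; rewrite mulr_ge0.
Qed.

Let Bc : R := 4 * c_alpha c * ln T%:R * Mn + Cl.
Hypothesis Cl0 : 0 <= Cl.

(* The first good phase is bounded by summing the increments of [A] over bad phases. *)
Lemma regret_path w : reg w <= 2 * ((A J)%:R +
  \sum_(J <= j < N.+1) ((A j.+1)%:R - (A j)%:R) * badness j w) + Bc.
Proof.
have lT : 0 <= ln T%:R :> R by case: (T) => [|T']; [rewrite ln0|rewrite ln_ge0// ler1n].
have Bc0 : 0 <= Bc by rewrite addr_ge0// mulr_ge0 ?Mn_ge0// !mulr_ge0// ltW.
have inc j : 0 <= (A j.+1)%:R - (A j)%:R :> R by rewrite subr_ge0 ler_nat ltnW.
have key M : (J <= M <= N.+1)%N -> reg w <= 2 * ((A J)%:R +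
    \sum_(J <= j < M) ((A j.+1)%:R - (A j)%:R) * badness j w) + Bc \/
   (A M)%:R <= (A J)%:R + \sum_(J <= j < M) ((A j.+1)%:R - (A j)%:R) * badness j w.
  elim: M => [|M IH] /andP[JM MN].
    by right; rewrite big_geq// addr0 ler_nat; exact: (phaseA_le A_lt).
  move: JM; rewrite leq_eqVlt => /orP[/eqP <-|JM]; first by right; rewrite big_geq// addr0.
  rewrite ltnS in JM; rewrite big_nat_recr//.
  set S := \sum_(J <= j < M) _ in IH *; set e := _ * badness M w.
  have e0 : 0 <= e by rewrite mulr_ge0// badness_ge0.
  have JMN : (J <= M <= N.+1)%N by rewrite JM ltnW.
  case: (IH JMN) => [h|h].
    left; apply: le_trans h _; rewrite lerD2r ler_pM2l// addrA lerDl//.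
  have JMN' : (J <= M <= N)%N by rewrite JM.
  case: (good_or_bad w JMN') => [[hE hI]|hbad].
    left; apply: le_trans (good_regret JMN' hE hI) _; rewrite lerD2r ler_pM2l//.
    by apply: le_trans h _; rewrite addrA lerDl.
  right; rewrite addrA; have : (A M.+1)%:R - (A M)%:R <= e.
    by rewrite -[X in X <= _]mulr1 /e ler_wpM2l.
  by move=> h'; rewrite -[X in X <= _](subrK (A M)%:R) addrC lerD.
have JN1 : (J <= N.+1 <= N.+1)%N by rewrite leqnn andbT; exact: leq_trans JN _.
(* If no phase up to [N] is good, the accumulated increments already exceed [A N.+1], which is at
   least [T]. *)
case: (key _ JN1) => // h; apply: ler_wpDr => //.
have /andP[_ hT] := reg_le w; apply: le_trans hT _.
apply: (@le_trans _ _ (A N.+1)%:R).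
  by rewrite ler_nat; apply: leq_trans TN _; exact: (phaseA_le A_lt).
apply: (le_trans h); rewrite ler_peMl ?ler1n//; exact: le_trans h.
Qed.

Lemma reg_measurable : measurable_fun setT reg.
Proof.
rewrite /reg; apply: measurable_sum => t; apply: measurable_funB => //.
case: (posnP t) => [->|t0].
  by rewrite (_ : (fun w => _) = cst (mean nu 0%N))//; apply: funext => w.
apply: (dmeas_fun_nat (mean nu)) => B; apply: (past_measurable_all mX msg).
exact: (armd i0 t0).
Qed.

Lemma expected_regret : ebd P reg (2 * ((A J)%:R + \sum_(J <= j < N.+1) ((A j.+1)%:R - (A j)%:R) *
  (\sum_((A (lo (lo j)).-1).+1 <= t < (A N).+1) pt t + \sum_(lo j <= p < N.+1) hb p
    + rum adj istar (j %/ 2) un)) + Bc).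
Proof.
have lT : 0 <= ln T%:R :> R by case: (T) => [|T']; [rewrite ln0|rewrite ln_ge0// ler1n].
have Bc0 : 0 <= Bc by rewrite addr_ge0// mulr_ge0 ?Mn_ge0// !mulr_ge0// ltW.
apply: (ebd_dom reg_measurable _ regret_path); first by move=> w; have /andP[] := reg_le w.
apply: ebdD; last exact: ebd_cst.
apply: ebdZ => //; apply: ebdD; first exact: ebd_cst.
apply: ebd_sum => j; rewrite mem_index_iota ltnS => hj; apply: ebdZ; last exact: badness_ebd.
by rewrite subr_ge0 ler_nat ltnW.
Qed.

Lemma arm_mean w t : (1 <= t)%N -> 0 <= mean nu (arm_at c (rzw w) i0 t).
Proof.
move=> t1; have [p hp] := @phase_of A A0 A_lt t t1.
have hv : (1 <= tI (trr w) i0 t <= c_K c)%N := ok_valid (okt w) (ok_I (okt w) i0 hp).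
by have [_ /andP[]] := mean_clip (nu01 hv).
Qed.

(** The regret is a sum of differences in the extended reals. Both parts of [mean nu 1] have
    nonnegative integrals with a finite sum, so each is finite and subtraction is legitimate. *)
Lemma regret_integral : (\sum_(1 <= t < T.+1) ((mean nu 1)%:E -
  \int[P]_w (mean nu (arm_at c (rzw w) i0 t))%:E) = \int[P]_w (reg w)%:E)%E.
Proof.
have mm t : (1 <= t)%N -> measurable_fun setT (fun w => mean nu (arm_at c (rzw w) i0 t)).
  move=> t0; apply: (dmeas_fun_nat (mean nu)) => B; apply: (past_measurable_all mX msg).
  exact: (armd i0 t0).
rewrite /reg; elim: (T) => [|T' IH].
  by rewrite big_geq// (eq_integral (cst 0%E)) ?integral0// => w _; rewrite big_geq.
rewrite big_nat_recr//= IH; under [in RHS]eq_integral do rewrite big_nat_recr//= EFinD.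
have t1 : (1 <= T'.+1)%N by [].
have mg : measurable_fun setT (fun w => mean nu 1 - mean nu (arm_at c (rzw w) i0 T'.+1)).
  by apply: measurable_funB => //; exact: mm.
rewrite ge0_integralD//; last 4 first.
- move=> w _; rewrite lee_fin big_nat_cond; apply: sumr_ge0 => t /andP[/andP[h1 _] _].
  by have /andP[] := arm_gap w h1.
- apply/measurable_EFinP; rewrite (_ : (fun w => _) = (fun w => \sum_(t <- index_iota 1 T'.+1)
    (if (1 <= t)%N then mean nu 1 - mean nu (arm_at c (rzw w) i0 t) else 0))); last first.
    by apply: funext => w; apply: eq_big_nat => t /andP[-> _].
  apply: measurable_sum => t; case: (boolP (0 < t)%N) => h1; last exact: measurable_cst.
  by apply: measurable_funB => //; exact: mm.
- by move=> w _; rewrite lee_fin; have /andP[] := arm_gap w t1.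
- by apply/measurable_EFinP.
congr (_ + _)%E.
have hm : (\int[P]_w (mean nu 1)%:E = (mean nu 1)%:E)%E.
  have h1 : P [set: Omega] = 1%E by exact: probability_setT.
  by transitivity ((mean nu 1)%:E * P [set: Omega])%E; [exact: integral_cst|rewrite h1 mule1].
have hs : (\int[P]_w (mean nu 1 - mean nu (arm_at c (rzw w) i0 T'.+1))%:E +
   \int[P]_w (mean nu (arm_at c (rzw w) i0 T'.+1))%:E = (mean nu 1)%:E)%E.
  rewrite -ge0_integralD//.
  - by rewrite -hm; apply: eq_integral => w _; rewrite -EFinD subrK.
  - by move=> w _; rewrite lee_fin; have /andP[] := arm_gap w t1.
  - by apply/measurable_EFinP.
  - by move=> w _; rewrite lee_fin; exact: arm_mean.
  - by apply/measurable_EFinP; exact: mm.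
have i1 : (0 <= \int[P]_w (mean nu 1 - mean nu (arm_at c (rzw w) i0 T'.+1))%:E)%E.
  by apply: integral_ge0 => w _; rewrite lee_fin; have /andP[] := arm_gap w t1.
have i2 : (0 <= \int[P]_w (mean nu (arm_at c (rzw w) i0 T'.+1))%:E)%E.
  by apply: integral_ge0 => w _; rewrite lee_fin; exact: arm_mean.
move: hs i1 i2; case: (\int[P]_w (mean nu 1 - _)%:E)%E => [a| |]; case: (\int[P]_w _)%E => [b| |] //=.
by rewrite -EFinD => -[<-] _ _; rewrite -EFinB addrK.
Qed.

End Spreading.

Local Close Scope classical_set_scope.

(** * Gaps and the logarithmic scale *)

Section Gaps.
Context {R : realType} (nu : nat -> probability R R) (K : nat).
Hypothesis nu01 : forall k, (1 <= k <= K)%N -> nu k `[0%R, 1%R]%classic = 1%E.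
Hypothesis mono : forall k, (1 <= k < K)%N -> mean nu k.+1 <= mean nu k.
Hypothesis mu12 : mean nu 2 < mean nu 1.
Hypothesis K2 : (1 < K)%N.

Lemma mean01 k : (1 <= k <= K)%N -> 0 <= mean nu k <= 1.
Proof. by move=> hk; have [_] := mean_clip (nu01 hk). Qed.

Lemma mean_le k l : (1 <= k)%N -> (k <= l <= K)%N -> mean nu l <= mean nu k.
Proof.
move=> k1; elim: l => [|l IH] /andP[kl lK]; first by move: k1 kl; clear; lia.
move: kl; rewrite leq_eqVlt => /orP[/eqP <-//|kl]; rewrite ltnS in kl.
apply: (@le_trans _ _ (mean nu l)); last by apply: IH; rewrite kl ltnW.
by apply: mono; rewrite lK andbT; exact: leq_trans kl.
Qed.

Lemma gapE k : (1 <= k <= K)%N -> gap nu K k = mean nu 1 - mean nu k.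
Proof. by rewrite /gap => ->. Qed.

Lemma gap_le1 k : (2 <= k)%N -> 0 < gap nu K k <= 1.
Proof.
move=> k2; rewrite /gap; case: ifP => [hk|_]; last by rewrite ltr01 lexx.
have /andP[_ kK] := hk; have K1 : (1 <= K)%N by exact: ltnW.
have h2 : mean nu k <= mean nu 2 by apply: mean_le; rewrite ?k2.
have /andP[m0 _] := mean01 hk; have /andP[_ m1] : 0 <= mean nu 1 <= 1 by apply: mean01; rewrite K1.
apply/andP; split; first by rewrite subr_gt0; exact: le_lt_trans h2 mu12.
by rewrite lerBlDr (le_trans m1)// lerDl.
Qed.

(** The value 1 beyond [K] keeps the gaps monotone because true gaps are at most 1. *)
Lemma gap_inv_le k l : (2 <= k <= l)%N -> (gap nu K l)^-1 <= (gap nu K k)^-1.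
Proof.
move=> /andP[k2 kl]; have /andP[k0 k1] := gap_le1 k2.
have /andP[l0 _] := gap_le1 (leq_trans k2 kl); rewrite lef_pV2 ?posrE//.
have [lK|lK] := leqP l K; last by rewrite [X in _ <= X]/gap (leqNgt l) lK andbF.
rewrite !gapE; [|by rewrite lK andbT; move: k2 kl; clear; lia|by move: k2 kl lK; clear; lia].
by rewrite lerD2l lerN2; apply: mean_le; [exact: ltnW|rewrite kl].
Qed.

End Gaps.

Lemma ln_ge1 (R : realType) (y : R) : 4 <= y -> 1 <= ln y.
Proof.
move=> y4; have h : ln (1 + - (2^-1)) <= - (2^-1) :> R by apply: le_ln1Dx; lra.
have e : 1 + - (2^-1) = 2^-1 :> R by lra.
rewrite e lnV ?posrE// in h.
have l4 : ln 4 = ln 2 + ln 2 :> R by rewrite -lnM ?posrE//; congr ln; lra.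
apply: (@le_trans _ _ (ln 4)); last by rewrite ler_ln ?posrE//; lra.
by rewrite l4; lra.
Qed.

Lemma log_scale (R : realType) (K n m : nat) (x : R) : (3 <= K)%N -> (1 <= n)%N -> 1 <= x ->
  let L := ln (K%:R + n%:R + m%:R + x + 3) in
  [/\ 1 <= L, ln x <= L, ln n%:R <= L, forall s, (0 < s <= K)%N -> ln s%:R <= L &
    forall s, (0 < s <= n + m)%N -> ln s%:R <= L].
Proof.
move=> K3 n1 x1 L.
have K3' : 3 <= K%:R :> R by rewrite ler_nat.
have n1' : 1 <= n%:R :> R by rewrite ler1n.
have m0 : 0 <= m%:R :> R by [].
have Lmono y : 0 < y -> y <= K%:R + n%:R + m%:R + x + 3 -> ln y <= L.
  by move=> y0 yle; rewrite ler_ln ?posrE//; apply: lt_le_trans yle.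
split.
- by apply: ln_ge1; lra.
- by apply: Lmono; lra.
- by apply: Lmono; lra.
- move=> s /andP[s0 sK]; apply: Lmono; first by rewrite ltr0n.
  by apply: (@le_trans _ _ K%:R); rewrite ?ler_nat//; lra.
- move=> s /andP[s0 sK]; apply: Lmono; first by rewrite ltr0n.
  by apply: (@le_trans _ _ (n + m)%:R); rewrite ?ler_nat// natrD; lra.
Qed.

(** * Exponents, weighted failure sums and assembly of the constants *)

Lemma eps_exponent (R : realType) (alpha b r eps : R) : 0 < alpha -> 3 + b + r < 2 * alpha ->
  eps = (4 * alpha)^-1 -> 1 - 2 * alpha * (1 - eps) ^+ 2 + r <= - (1 + b).
Proof.
move=> alpha0 h epsE; have e : alpha * eps = 4^-1 by rewrite epsE; field; rewrite gt_eqF.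
have : 0 <= alpha * eps ^+ 2 by rewrite mulr_ge0 ?sqr_ge0// ltW.
by rewrite (_ : 2 * alpha * _ = 2 * alpha - 4 * (alpha * eps) + 2 * (alpha * eps ^+ 2)); [rewrite e; lra|ring].
Qed.

(** An error at [t] is charged [C1 * t ^ (1 / rho1 ^ 2)], which leaves an exponent at most
    [- (1 + 1 / beta)], with series at most [1 + beta]. *)
Lemma clean_weight (R : realType) (beta rho1 eps C1 : R) (n m : nat) (c : config R n m) J N M :
  0 < C1 -> 0 < beta -> (forall j, (phaseA beta j <= phaseA beta j.+1)%N) ->
  1 - 2 * c_alpha c * (1 - eps) ^+ 2 + (rho1 ^+ 2)^-1 <= - (1 + beta^-1) ->
  (forall j t, (phaseA beta (lob rho1 (lob rho1 j)).-1 < t)%N ->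
    (phaseA beta j.+1)%:R <= C1 * t%:R `^ (rho1 ^+ 2)^-1) ->
  \sum_(J <= j < N) ((phaseA beta j.+1)%:R - (phaseA beta j)%:R) *
    \sum_((phaseA beta (lob rho1 (lob rho1 j)).-1).+1 <= t < M) pt c eps t
    <= 2 * n%:R * (c_K c)%:R * (C1 * (1 + beta)).
Proof.
move=> C10 b0 A_le eps2 H1; have bi0 : 0 < beta^-1 by rewrite invr_gt0.
have pt0 t : 0 <= pt c eps t by rewrite /pt !mulr_ge0// powR_ge0.
have W0 t : 0 <= C1 * t%:R `^ (rho1 ^+ 2)^-1 by rewrite mulr_ge0 ?powR_ge0// ltW.
apply: le_trans (@swap_weight _ _ (fun j => (phaseA beta (lob rho1 (lob rho1 j)).-1).+1) _
  _ J N M A_le (fun j => ltn0Sn _) pt0 W0 (fun j t _ => H1 j t)) _.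
apply: (@le_trans _ _ (\sum_(1 <= t < M) 2 * n%:R * (c_K c)%:R * (C1 * t%:R `^ (- (1 + beta^-1))))).
  rewrite big_nat_cond [X in _ <= X]big_nat_cond; apply: ler_sum => t /andP[/andP[t1 _] _].
  have t0 : (t%:R : R) != 0 by rewrite pnatr_eq0 -lt0n.
  rewrite /pt -[X in X <= _]mulrA ler_wpM2l ?mulr_ge0// mulrCA ler_wpM2l ?(ltW C10)//.
  by rewrite -powRD ?t0 ?implybT// ler_powR// ler1n.
rewrite -mulr_sumr ler_wpM2l ?mulr_ge0// -mulr_sumr ler_wpM2l ?(ltW C10)//.
by have := sum_powR_le M bi0; rewrite invrK.
Qed.

(** A failure at [q] is charged [C2 * q ^ (beta / rho1)], which leaves the series of [q ^ (- 2)], at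
    most 2. *)
Lemma hear_weight_sum (R : realType) (beta rho1 C2 : R) (F : nat -> R) J N :
  0 < C2 -> 0 < rho1 -> (forall j, (phaseA beta j <= phaseA beta j.+1)%N) ->
  (forall j p, (0 < p)%N -> (lob rho1 j <= p)%N -> (phaseA beta j.+1)%:R <= C2 * p%:R `^ (beta / rho1)) ->
  (forall q, (lob rho1 J <= q)%N -> F q <= q%:R `^ (- (beta / rho1 + 2))) ->
  \sum_(J <= j < N) ((phaseA beta j.+1)%:R - (phaseA beta j)%:R) *
    \sum_(lob rho1 j <= q < N) F q <= 2 * C2.
Proof.
move=> C20 rho0 A_le H2 hF.
have F0 q : 0 <= (q%:R : R) `^ (- (beta / rho1 + 2)) by exact: powR_ge0.
have W0 q : 0 <= C2 * q%:R `^ (beta / rho1) by rewrite mulr_ge0 ?powR_ge0// ltW.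
apply: (@le_trans _ _ (\sum_(J <= j < N) ((phaseA beta j.+1)%:R - (phaseA beta j)%:R) *
  \sum_(lob rho1 j <= q < N) q%:R `^ (- (beta / rho1 + 2)))).
  rewrite big_nat_cond [X in _ <= X]big_nat_cond; apply: ler_sum => j /andP[/andP[Jj _] _].
  apply: ler_wpM2l; first by rewrite subr_ge0 ler_nat.
  rewrite big_nat_cond [X in _ <= X]big_nat_cond; apply: ler_sum => q /andP[/andP[jq _] _].
  by apply: hF; apply: leq_trans jq; exact: (lob_mono rho0).
have H2' j q : (J <= j)%N -> (lob rho1 j <= q)%N -> (phaseA beta j.+1)%:R <= C2 * q%:R `^ (beta / rho1).
  by move=> _ hq; apply: H2 => //; apply: leq_trans hq; exact: lob_gt0.
apply: le_trans (@swap_weight _ _ (lob rho1) _ _ J N N A_le (lob_gt0 rho1) F0 W0 H2') _.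
apply: (@le_trans _ _ (\sum_(1 <= q < N) C2 * q%:R `^ (- (1 + 1)))).
  rewrite big_nat_cond [X in _ <= X]big_nat_cond; apply: ler_sum => q /andP[/andP[q1 _] _].
  have q0 : (q%:R : R) != 0 by rewrite pnatr_eq0 -lt0n.
  rewrite mulrCA ler_wpM2l ?(ltW C20)// -powRD ?q0 ?implybT//.
  by rewrite ler_powR ?ler1n//; lra.
rewrite -mulr_sumr mulrC ler_wpM2r ?(ltW C20)//.
by have := sum_powR_le N (@ltr01 R); rewrite invr1; lra.
Qed.

Lemma split_bound (R : realType) (inc a b r : nat -> R) J N (AJ s1 s2 s3 B cl : R) :
  \sum_(J <= j < N) inc j * a j <= s1 -> \sum_(J <= j < N) inc j * b j <= s2 ->
  \sum_(J <= j < N) inc j * r j <= s3 ->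
  2 * (AJ + \sum_(J <= j < N) inc j * (a j + b j + r j)) + (B + cl)
    <= B + 2 * s3 + (2 * AJ + 2 * s1 + 2 * s2 + cl).
Proof.
move=> h1 h2 h3; under eq_bigr do rewrite !mulrDr.
rewrite !big_split /=; move: h1 h2 h3.
move: (\sum_(J <= j < N) inc j * a j) (\sum_(J <= j < N) inc j * b j) (\sum_(J <= j < N) inc j * r j) => u v w.
lra.
Qed.

Lemma collect_constants (R : realType) (p : nat) (L W CJ c1 C2 Cl a nk cl : R) :
  1 <= L -> 1 <= W -> 0 <= CJ -> 0 <= c1 -> 0 <= C2 -> 0 <= Cl ->
  a <= CJ * L ^+ p * W -> nk <= W -> cl <= Cl * L * W ->
  2 * a + 2 * (2 * nk * c1) + 2 * (2 * C2) + cl <= (2 * CJ + 4 * c1 + 4 * C2 + Cl) * L ^+ p.+1 * W.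
Proof.
move=> L1 W1 CJ0 c10 C20 Cl0 ha hn hc.
have Lp : 1 <= L ^+ p by rewrite exprn_ege1.
have Lp1 : 1 <= L ^+ p.+1 by rewrite exprn_ege1.
have [Q QE] : exists Q, Q = L ^+ p.+1 * W by eexists.
have q1 : W <= Q by rewrite QE ler_peMl//; lra.
have q2 : L ^+ p * W <= Q by rewrite QE exprS ler_wpM2r ?ler_peMl//; lra.
have q3 : L * W <= Q by rewrite QE exprS ler_wpM2r ?ler_peMr//; lra.
have f1 : a <= CJ * Q by apply: le_trans ha _; rewrite -mulrA ler_wpM2l.
have f2 : nk * c1 <= c1 * Q by rewrite mulrC ler_wpM2l//; apply: le_trans q1.
have f3 : C2 <= C2 * Q by rewrite ler_peMr//; apply: le_trans q1.
have f4 : cl <= Cl * Q by apply: le_trans hc _; rewrite -mulrA ler_wpM2l.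
rewrite -[X in _ <= X]mulrA -QE; move: f1 f2 f3 f4; clear; lra.
Qed.

Theorem theorem2 (R : realType) (alpha beta eta rho1 rho2 : R) :
  1 < beta -> 1 < eta -> 0 < rho1 -> rho1 <= eta^-1 ->
  3 / 2 + (2 * beta)^-1 + (2 * rho1 ^+ 2)^-1 < alpha ->
  (2 * alpha - 3)^-1 < rho2 -> rho2 < rho1 * (beta - 1) ->
  exists (C : R) (p : nat), 0 < C /\
  forall (n m : nat) (adj : rel 'I_(n+m)) (K S : nat) (nu : nat -> probability R R)
    (sticky : 'I_n -> seq nat) (U1 L1 : 'I_n -> nat) (istar : 'I_n)
    (d : measure_display) (Omega : measurableType d) (P : probability Omega R)
    (X : 'I_n -> nat -> nat -> Omega -> R)
    (sg : 'I_n -> nat -> Omega -> {perm 'I_(n+m)})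
    (tbI tbB tbU adv : 'I_n -> nat -> Omega -> nat),
    (* the communication graph: simple undirected *)
    symmetric adj -> irreflexive adj ->
    (* (A1) *)
    hon_connected adj ->
    (* (A2) and the labelling convention mu_1 >= ... >= mu_K *)
    (forall k, (1 <= k <= K)%N -> nu k `[0%R, 1%R]%classic = 1%E) ->
    (forall k, (1 <= k < K)%N -> mean nu k.+1 <= mean nu k) ->
    mean nu 2 < mean nu 1 ->
    (* sticky sets of size S, 1 <= S <= K - 2; S_1 of the prescribed form *)
    (1 <= S)%N -> (S + 2 <= K)%N ->
    (forall i, [/\ uniq (sticky i), size (sticky i) = S
                 & all (fun k => (1 <= k <= K)%N) (sticky i)]) ->
    (forall i, [/\ (1 <= U1 i <= K)%N, (1 <= L1 i <= K)%N, U1 i != L1 i,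
                   U1 i \notin sticky i & L1 i \notin sticky i]) ->
    (* (A3) *)
    1%N \in sticky istar ->
    (* the randomness: independent rewards X_{i,t}(k) ~ nu_k, independent uniform orderings *)
    (forall i t k, measurable_fun setT (X i t k)) ->
    (forall i t k, (1 <= t)%N -> (1 <= k <= K)%N -> forall B : set R, measurable B ->
        P (X i t k @^-1` B)%classic = nu k B) ->
    (forall i j s, measurable (sg i j @^-1` [set s])%classic) ->
    (forall i j s, (1 <= j)%N ->
        P (sg i j @^-1` [set s])%classic = (((n + m)`!)%:R^-1)%:E) ->
    mutually_indep P K X sg ->
    (* tie-breaking and adversarial choices are measurable w.r.t. the past *)
    (forall i t, past_measurable K X sg t.-1 (fun j' => (phaseA beta j' < t)%N) (tbI i t)) ->
    (forall i j, past_measurable K X sg (phaseA beta j) (fun j' => (j' < j)%N) (tbB i j)) ->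
    (forall i j, past_measurable K X sg (phaseA beta j) (fun j' => (j' <= j)%N) (tbU i j)) ->
    (forall i j, past_measurable K X sg (phaseA beta j) (fun j' => (j' <= j)%N) (adv i j)) ->
    forall (i : 'I_n) (T : nat),
    let c := Config adj K S alpha beta eta rho1 rho2 sticky U1 L1 in
    let arm := fun (w : Omega) =>
      arm_at c (Realiz (fun i t k => X i t k w) (fun i j => sg i j w)
                       (fun i t => tbI i t w) (fun i j => tbB i j w)
                       (fun i j => tbU i j w) (fun i j => adv i j w)) i in
    let Delta := gap nu K in
    let dm := deg_mal adj i in
    (\sum_(1 <= t < T.+1) ((mean nu 1)%:E - \int[P]_w (mean nu (arm w t))%:E)
     <= (4 * alpha * ln T%:R *
           Num.min ((2 * eta - 1) / (eta - 1) * (\sum_(2 <= k < dm + 4) (Delta k)^-1)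
                    + \sum_(dm + 4 <= k < S + dm + 5) (Delta k)^-1)
                   (\sum_(2 <= k < K.+1) (Delta k)^-1))%:E
        + 2%:E * exp_A2tau beta adj istar
        + (C * ln (K%:R + n%:R + m%:R + (Delta 2)^-1 + 3) ^+ p
             * Cstar_max beta rho1 adj K S (Delta 2) i)%:E)%E.
Proof.
move=> beta1 eta1 rho0 rho1e alpha_gt rho2_gt rho2_lt.
have b0 : 0 < beta by lra.
have bi0 : 0 < beta^-1 by rewrite invr_gt0.
have r20 : 0 < (rho1 ^+ 2)^-1 by rewrite invr_gt0 exprn_gt0.
have alpha_gt' : 3 + beta^-1 + (rho1 ^+ 2)^-1 < 2 * alpha.
  by move: alpha_gt; rewrite !invfM; lra.
have alpha0 : 0 < alpha by lra.
have rho20 : 0 < rho2 by apply: lt_trans rho2_gt; rewrite invr_gt0; lra.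
have rho1_lt1 : rho1 < 1 by apply: le_lt_trans rho1e _; rewrite invf_lt1//; lra.
have [eps epsE] : exists eps, eps = (4 * alpha)^-1 by eexists.
have eps0 : 0 < eps by rewrite epsE invr_gt0; lra.
have eps1 : eps <= 1 by rewrite epsE invf_le1; lra.
have eps2 := eps_exponent alpha0 alpha_gt' epsE.
have [C1 C10 H1] := phaseA_lob2 beta1 rho0.
have [C2 C20 H2] := phaseA_lob beta1 rho0.
have [Cb Cb3 Hb] := block_margin_ok beta1 rho0 rho1_lt1 alpha0 eps0 rho2_lt.
have [Cd Cd1 Hd] := dl_lt_gap beta1 rho0 rho1_lt1 alpha0.
(* Decay asked of the hearing failures: [beta / rho1] for their weight and 2 for summability. *)
have M0 : 0 <= beta / rho1 + 2 by rewrite addr_ge0// divr_ge0 ?ltW.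
have [Ch Ch1 Hh] := hear_decay M0.
(* Asking for [Cb + 1] instead of [Cb] forces [lob rho1 J >= 4]. *)
have Cb4 : 4 <= Cb + 1 by lra.
have [CJ CJ0 [p HJ]] := @threshold _ _ _ beta1 rho0 (Cb + 1) Cd Ch ltac:(lra) ltac:(lra) ltac:(lra).
have [Cl Cl0 Hl] := blocking_phase beta1 rho0 rho1_lt1 alpha0 rho20.
exists (2 * CJ + 4 * (C1 * (1 + beta)) + 4 * C2 + Cl), p.+1.
have C1b : 0 < C1 * (1 + beta) by rewrite mulr_gt0//; lra.
split; first by lra.
move=> n m adj K S nu sticky U1 L1 istar d Omega P X sg tbI tbB tbU adv.
move=> adj_sym _ _ nu01 mono mu12 S1 SK hst hUL star mX lawX msg Hsg Hind HtbI HtbB HtbU Hadv i T.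
lazy zeta; set Delta := gap nu K; set dm := deg_mal adj i.
have K2 : (1 < K)%N by move: S1 SK; clear; lia.
have K1 : (1 <= K)%N by exact: ltnW.
have Hst i' : size (sticky i') = S /\ all (fun k => (1 <= k <= K)%N) (sticky i') by have [] := hst i'.
have HUL' i' : (1 <= U1 i' <= K)%N /\ (1 <= L1 i' <= K)%N by have [] := hUL i'.
have A_lt := phaseA_lt beta1.
have Dle1 := gap_le1 nu01 mono mu12 K2.
have Dinv := gap_inv_le nu01 mono mu12 K2.
have DE := @gapE _ nu K.
have /andP[D20 D21] := Dle1 2%N isT.
have [x xE] : exists x, x = (Delta 2%N)^-1 by eexists.
have x1 : 1 <= x by rewrite xE invf_ge1.
have n0 : (0 < n)%N by exact: leq_ltn_trans (ltn_ord i).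
have K3 : (3 <= K)%N by move: S1 SK; clear; lia.
have [L1' lx ln_ lKs lnm] := log_scale m K3 n0 x1.
rewrite -xE; set L := ln (_ + 3) in L1' lx ln_ lKs lnm *.
have lK : ln K%:R <= L by apply: lKs; rewrite K1 leqnn.
have SK' : (S <= K)%N by move: SK; clear; lia.
have lS : ln S%:R <= L by apply: lKs; rewrite S1.
have db_nm : (dbar adj <= n + m)%N.
  by apply/bigmax_leqP => i' _; rewrite (leq_trans (max_card _))// card_ord.
have [W WE] : exists W, W = Cstar_max beta rho1 adj K S (Delta 2%N) i by eexists.
have [w2 w3 w4 w5 w6] : [/\ (K%:R / Delta 2%N) ^+ 2 <= W, S%:R `^ (beta / (rho1 ^+ 2 * (beta - 1))) <= W,
   (S%:R / Delta 2%N ^+ 2) `^ (beta / (beta - 1)) <= W, (dbar adj)%:R `^ (beta / rho1) <= W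
   & (n * K ^ 2 * S)%:R <= W].
  by rewrite WE /Cstar_max; split; rewrite !le_max lexx ?orbT.
have W1 : 1 <= W.
  by apply: le_trans w2; rewrite expr_ge1 ?divr_ge0 ?(ltW D20)// -xE mulr_ege1// ler1n.
rewrite -WE.
have z0 : 0 <= S%:R / Delta 2%N ^+ 2 by rewrite divr_ge0// exprn_ge0// ltW.
have [J [J5 hJb hJh hJd hJA]] := HJ S (dbar adj) _ L W L1' z0 W1 w3 w4 w5.
have Sr1 : 1 <= (S%:R : R) `^ (rho1 * (beta - 1))^-1.
  by rewrite powR_ge1 ?ler1n// invr_ge0 mulr_ge0 ?(ltW rho0)// subr_ge0 ltW.
have lo4 : (4 <= lob rho1 J)%N.
  by rewrite -(ler_nat R); apply: le_trans hJb; rewrite -[X in X <= _]mulr1 ler_pM.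
have hJb' : Cb * S%:R `^ (rho1 * (beta - 1))^-1 <= (lob rho1 J)%:R.
  by apply: le_trans hJb; rewrite ler_wpM2r ?powR_ge0// lerDl.
have J3 : (3 <= J)%N by exact: leq_trans J5.
have loJ : (lob rho1 J <= J)%N.
  by apply: leq_trans (lob_le_third rho0 rho1_lt1 J3) _; move: J3; clear; lia.
have NB j0 : (lob rho1 J <= j0)%N -> [/\ (0 < lob rho1 j0 <= j0)%N, (lob rho1 j0 <= (j0 + 2) %/ 3)%N,
    forall j, (j <= lob rho1 j0)%N -> (ceiln (j%:R `^ eta) <= (j0 + 2) %/ 3)%N &
    block_margin (phaseA beta) K S alpha eps (kappa rho2 K S) (lob rho1) j0].
  move=> hj; have j3 : (3 <= j0)%N by apply: leq_trans hj; exact: leq_trans lo4.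
  have h3 := lob_le_third rho0 rho1_lt1 j3; split=> //.
  - rewrite lob_gt0 /=; apply: leq_trans h3 _; move: j3; clear; lia.
  - by move=> j; exact: up_le_third.
  - by apply: Hb => //; apply: le_trans hJb' _; rewrite ler_nat.
have ND q : (J - J %/ 2 <= q)%N -> (2 * S.+2 <= G (phaseA beta) q)%N /\ dl (phaseA beta) S alpha q < Delta 2%N.
  move=> hq; have Jq : (lob rho1 J <= q)%N.
    by apply: leq_trans (lob_le_third rho0 rho1_lt1 J3) _; move: J5 hq; clear; lia.
  have [h1 _ _ [dd [_ hv _]]] := NB _ Jq.
  split; first by apply: (hv q _).1; rewrite leqnn andbT; case/andP: h1.
  apply: (Hd S q (Delta 2%N) L) => //; [by rewrite D20|by rewrite -xE|].
  by apply: le_trans hJd _; rewrite ler_nat.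
(* A horizon in phases: [A N >= N >= T], and the final bounds do not depend on [N]. *)
pose N := maxn J T.
have JN : (J <= N)%N by rewrite leq_maxl.
have TN : (T <= phaseA beta N)%N.
  by apply: leq_trans (phaseA_ge_id beta1 N); rewrite leq_maxr.
pose ClL := Cl * L * (K%:R * x) ^+ 2.
have L0 : 0 <= L by exact: le_trans L1'.
have ClL0 : 0 <= ClL by apply: mulr_ge0; [apply: mulr_ge0 (ltW Cl0) L0|exact: sqr_ge0].
have LP j : (1 <= j)%N -> exists j1, [/\ (j <= j1)%N,
  forall q, (j1 < q)%N -> (j <= lob rho1 q.+1)%N /\
    (phaseA beta j)%:R + 1 + 4 * alpha * ln (phaseA beta q.+1)%:R * (Delta 2%N)^-1 ^+ 2 <= kappa rho2 K S q.+1 &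
  K%:R + 4 * alpha * (K%:R * ((Delta 2%N)^-1 * ln (phaseA beta j1)%:R)) <= (phaseA beta j)%:R + ClL].
  move=> j1; rewrite -xE; apply: Hl => //.
  by rewrite S1.
have GR q q' : (ceiln (q.+1%:R `^ eta) < q')%N -> eta * ln (phaseA beta q)%:R <= ln (phaseA beta q')%:R.
  exact: phaseA_growth.
pose c := Config adj K S alpha beta eta rho1 rho2 sticky U1 L1.
have lo_mono' a b : (a <= b)%N -> (loph c a <= loph c b)%N by exact: (lob_mono rho0).
have [_ _ hint] := @expected_regret _ _ _ _ _ P nu c X sg tbI tbB tbU adv A_lt K1 Hst HUL' HtbI HtbB HtbU
  Hadv mX msg Hind Hsg eps (ltW eps0) alpha0 J istar Delta adj_sym J5 lo_mono' NB loJ ND K2 DE Dle1 Dinv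
  star i T N eta ClL eta1 TN LP GR nu01 lawX eps1 lo4 JN ClL0.
have RI := @regret_integral _ _ _ _ _ P nu c X sg tbI tbB tbU adv A_lt K1 Hst HUL' HtbI HtbB HtbU Hadv
  mX msg Delta DE Dle1 i T nu01.
apply: (@le_trans _ _ (\int[P]_w (reg nu c X sg tbI tbB tbU adv i T w)%:E)%E); first by rewrite -RI lexx.
apply: le_trans hint _.
have A_le j : (phaseA beta j <= phaseA beta j.+1)%N by exact: ltnW.
have B1 := @clean_weight _ beta rho1 eps C1 _ _ c J N.+1 (phaseA beta N).+1 C10 b0 A_le eps2 H1.
have hbq q : (lob rho1 J <= q)%N -> hb c q <= q%:R `^ (- (beta / rho1 + 2)).
  move=> hq; rewrite /hb /=; have [->|d0] := posnP (dbar adj); first by rewrite muln0 mul0r powR_ge0.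
  apply: (Hh n (dbar adj) q L) => //; last by apply: le_trans hJh _; rewrite ler_nat.
  by apply: lnm; rewrite d0.
have B2 := @hear_weight_sum _ beta rho1 C2 (hb c) J N.+1 C20 rho0 A_le H2 hbq.
pose u l := rum adj istar l (@unspread R n).
have u0 l : 0 <= u l by exact: unspread_ge0.
have B3 := @pair_weight R (phaseA beta) u J N.+1 A_le u0.
have B3' := exp_A2tau_ge adj istar A_lt N.+1.
move: B3 B3'; set Rr := \sum_(0 <= l < N.+1) _ => B3 B3'.
apply: (@le_trans _ _ (4 * alpha * ln T%:R * Mn c Delta i eta + 2 * Rr + (2 * (phaseA beta J)%:R +
   2 * (2 * n%:R * K%:R * (C1 * (1 + beta))) + 2 * (2 * C2) + ClL))%:E).
  by rewrite lee_fin; exact: (split_bound _ _ _ B1 B2 B3).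
(* The inaccurate estimates contribute a multiple of [n * K], covered by the term [n * K ^ 2 * S] of
   the constant. *)
have nK : n%:R * K%:R <= W.
  apply: le_trans w6; rewrite -natrM ler_nat -mulnA leq_mul2l; apply/orP; right.
  by move: K1 S1; clear; nia.
have hcl : ClL <= Cl * L * W.
  by apply: ler_wpM2l; [apply: mulr_ge0 (ltW Cl0) L0|rewrite xE; exact: w2].
have := collect_constants L1' W1 (ltW CJ0) (ltW C1b) (ltW C20) (ltW Cl0) hJA nK hcl.
rewrite (mulrA 2 n%:R K%:R) => hconst.
rewrite 2!EFinD; apply: leeD; last by rewrite lee_fin.
apply: leeD; first exact: lexx.
by rewrite EFinM; apply: lee_wpmul2l => //; rewrite lee_fin.
Qed.
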